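(* Suppose $\mathcal A$ is a rank two normalized Laurent phenomenon algebra of finite type over the coefficient ring $S$. Then, for a suitable naming of its cluster variables and suitable elements of $S$ (or polynomials, as indicated), the list of seeds of $\mathcal A$ has one of the following five forms (each seed is written as a set of pairs (cluster variable, exchange polynomial)). (1) Triangle: $\{(x,P),(y,P)\}$, $\{(x,P),(z,P)\}$, $\{(z,P),(y,P)\}$, where $P\in S$ and $z=P/(xy)$. (2) Square: $\{(x,P),(y,Q)\}$, $\{(z,P),(y,Q)\}$, $\{(z,R),(u,Q)\}$, $\{(x,R),(u,Q)\}$, where $Q\in S$, $P\in S[y]$ has degree $k$ in $y$, $R\in S[u]$, $P\not\propto Q$, and the exchange Laurent polynomials are $\hat P=P/y^d$, $\hat Q=Q$, $\hat R=R/u^{k-d}=\hat P$ for an integer $d$. (3) Pentagon, with $A,B,C,D,E\in S$: $\{(x, Ay+BE),(y, Cx+DE)\}$, $\{(z, Ay+EB),(y, Dz+CB)\}$, $\{(z, Eu+AC),(u, Dz+BC)\}$, $\{(t, Eu+CA),(u, Bt+DA)\}$, $\{(t, Cx+ED),(x, Bt+AD)\}$, where $\gcd(A,B)=\gcd(A,E)=\gcd(B,D)=\gcd(C,D)=\gcd(C,E)=1$. (4) Hexagon, with $A,B,C,D,E,F,G\in S$: $\{(x, Ay^2+BGy+CFG^2),(y, Dx+EFG)\}$, $\{(z, Ay^2+BGy+FCG^2),(y, Ez+DCG)\}$, $\{(z, Fu^2+BDu+ACD^2),(u, Ez+GCD)\}$, $\{(v, Fu^2+BDu+CAD^2),(u,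 Gv+EAD)\}$, $\{(v, Ct^2+BEt+FAE^2),(t, Gv+DAE)\}$, $\{(x, Ct^2+BEt+AFE^2),(t, Dx+GFE)\}$, where $\gcd(A,G)=\gcd(C,E)=\gcd(D,E)=\gcd(D,F)=\gcd(D,G)=\gcd(E,G)=\gcd(A,B,C)=\gcd(A,B,F)=\gcd(B,C,F)=1$. (5) Octagon, with $A,B,C,D,E,F,G,H,K,L\in S$: $\{(x, Ay^3+BKLy^2+CHK^2L^2y+DGH^2K^3L^3),(y, Ex+FGHKL^2)\}$, $\{(z, Ay^3+BLKy^2+CHL^2K^2y+GDH^2L^3K^3),(y, Fz+EDHLK^2)\}$, $\{(z, Gu^3+CEKu^2+BDE^2K^2u+AHD^2E^3K^3),(u, Fz+LHDEK^2)\}$, $\{(w, Gu^3+CKEu^2+BDK^2E^2u+HAD^2K^3E^3),(u, Lw+FADKE^2)\}$, $\{(w, Hs^3+BFEs^2+CAF^2E^2s+GDA^2F^3E^3),(s, Lw+KDAFE^2)\}$, $\{(v, Hs^3+BEFs^2+CAE^2F^2s+DGA^2E^3F^3),(s, Kv+LGAEF^2)\}$, $\{(v, Dt^3+CLFt^2+BGL^2F^2t+HAG^2L^3F^3),(t, Kv+EAGLF^2)\}$, $\{(x, Dt^3+CFLt^2+BGF^2L^2t+AHG^2F^3L^3),(t, Ex+KHGFL^2)\}$, where $\gcd(A,K)=\gcd(A,L)=\gcd(D,F)=\gcd(D,L)=\gcd(E,F)=\gcd(E,G)=\gcd(E,H)=\gcd(E,K)=\gcd(E,L)=\gcd(F,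H)=\gcd(F,K)=\gcd(F,L)=\gcd(G,K)=\gcd(K,L)=\gcd(A,B,H)=\gcd(C,D,G)=\gcd(A,B,C,D)=\gcd(A,B,C,G)=\gcd(B,C,D,H)=\gcd(B,C,G,H)=1$.
   Context: Seeds. $S$ is a coefficient ring over $\mathbb Z$ which is a unique factorization domain (gcd's in $S$ are defined up to units); $n\ge 1$, $[n]=\{1,\dots,n\}$; the ambient field $\mathcal F$ is the field of rational functions in $n$ independent variables over $\mathrm{Frac}(S)$. A seed of rank $n$ in $\mathcal F$ is a pair $(\mathbf x,\mathbf F)$ where $\mathbf x=\{x_1,\dots,x_n\}$ (the cluster; its elements are cluster variables) is a transcendence basis of $\mathcal F$ over $\mathrm{Frac}(S)$, and $\mathbf F=\{F_1,\dots,F_n\}$ (the exchange polynomials) are polynomials in $\mathcal P=S[x_1,\dots,x_n]$ such that (LP1) each $F_i$ is irreducible in $\mathcal P$ and not divisible by any variable $x_j$; (LP2) $F_i$ does not involve $x_i$. The sets are unordered, but it is recorded which exchange polynomial belongs to which cluster variable, so a seed may be written as a set of pairs $(x_i,F_i)$. Write $f\propto g$ if $f,g\in\mathcal F$ differ multiplicatively by a unit of $S$. Exchange Laurent polynomials. For a seed, $\hat F_1,\dots,\hat F_n\in S[x_1^{\pm1},\dots,x_n^{\pm1}]$ are the unique elements such that $\hat F_i=\big(\prod_{k\ne i}x_k^{a_k}\big)F_i$ for some integers $a_k\le 0$, and for all $j\neq i$ the element $\hat F_i|_{x_j\leftarrow F_j/x}$ lies in $S[x_1^{\pm1},\dots,x_{j-1}^{\pm1},x^{\pm1},x_{j+1}^{\pm1},\dots,x_n^{\pm1}]$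 and is not divisible by $F_j$ in this ring. Mutation. For $i\in[n]$, $(\mathbf x',\mathbf F')=\mu_i(\mathbf x,\mathbf F)$ is obtained from $(\mathbf x,\mathbf F)$ by mutation at $i$ if it results from the following non-deterministic procedure. Put $x_i'=\hat F_i/x_i$ and $x_j'=x_j$ for $j\ne i$; $F_i'=F_i$. For $j\neq i$: if $F_j$ does not depend on $x_i$, then $F_j'$ is any polynomial in $\mathcal P'=S[x_1',\dots,x_n']$ with $F'_j\propto F_j$. If $F_j$ depends on $x_i$ (in which case $\hat F_i|_{x_j\leftarrow 0}$ is defined), put $G_j=F_j|_{x_i\leftarrow (\hat F_i|_{x_j\leftarrow0})/x_i'}$; let $H_j$ be $G_j$ with all common factors in $S[x_k:k\ne i,j]$ with $\hat F_i|_{x_j\leftarrow 0}$ removed (every irreducible factor of $\hat F_i|_{x_j\leftarrow0}$ is divided out of $G_j$ to the full power to which it divides $G_j$, monomials being immaterial); finally $F_j'=MH_j$ where $M$ is a Laurent monomial in the $x_k'$, $k\neq j$, with coefficient a unit in $S$, such that $F_j'\in\mathcal P'$, $F'_j$ does not involve $x'_j$, and $F_j'$ is not divisible by any variable of $\mathcal P'$. The result is always a seed. LP algebras. A Laurent phenomenon (LP) algebra of rank $n$ is a subring $\mathcal A\subset\mathcal F$ together with a distinguished collection of seeds in $\mathcal F$ such that: for each seed of the collection and each $i\in[n]$ we are given a seed of the collection obtained from it by mutation at $i$ (so seeds form the vertices of an $n$-regular graph whose edges are mutations); all seeds are connected by mutations; and $\mathcal A$ is generated over $S$ by all cluster variables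 of all the seeds. Normalized, finite type. Two seeds $(\mathbf x,\mathbf F)$, $(\mathbf x',\mathbf F')$ are equivalent if (for suitable indexing) $x_i\propto x_i'$ and $F_i\propto F_i'$ as elements of $\mathcal F$, for each $i$. An LP algebra is normalized if any two equivalent seeds of it are equal. A normalized LP algebra is of finite type if it has finitely many seeds. *)

(* Defs.v *)
From HB Require Import structures.
From mathcomp Require Import all_boot all_order all_algebra.
From mathcomp Require Import finmap.
From mathcomp Require Import mpoly.
From Stdlib Require Import Relation_Operators.

Set Implicit Arguments.
Unset Strict Implicit.
Unset Printing Implicit Defensive.

Import GRing.Theory.
Local Open Scope fset_scope.
Local Open Scope ring_scope.

Definition divides (R : comNzRingType) (a b : R) : Prop :=
  exists c, b = c * a.

Definition associates (R : comUnitRingType) (a b : R) : Prop :=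
  exists2 u : R, u \is a GRing.unit & a = u * b.

Definition irreducible_elt (R : idomainType) (a : R) : Prop :=
  [/\ a != 0, a \isn't a GRing.unit &
      forall b c : R, a = b * c -> b \is a GRing.unit \/ c \is a GRing.unit].

Definition irreducible_seq (R : idomainType) (r : seq R) : Prop :=
  forall a, a \in r -> irreducible_elt a.

Definition ufd (R : idomainType) : Prop :=
  (forall a : R, a != 0 ->
     exists2 r : seq R, irreducible_seq r & associates a (\prod_(p <- r) p))
  /\
  (forall r1 r2 : seq R,
     irreducible_seq r1 -> irreducible_seq r2 ->
     associates (\prod_(p <- r1) p) (\prod_(p <- r2) p) ->
     exists2 r : seq R, perm_eq r r2 &
       size r1 = size r /\
       (forall i, (i < size r1)%N -> associates r1`_i r`_i)).

(* gcd's are only defined up to units. *)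
Definition is_gcd (R : comNzRingType) (r : seq R) (d : R) : Prop :=
  (forall a, a \in r -> divides d a) /\
  (forall e, (forall a, a \in r -> divides e a) -> divides e d).

Section Ambient.

Variables (S : idomainType) (n : nat).

Definition ambient : fieldType := {fraction {mpoly {fraction S}[n]}}.

Definition fcst : {rmorphism {fraction S} -> ambient} :=
  @tofrac {mpoly {fraction S}[n]} \o @mpolyC n {fraction S}.

Definition cst : {rmorphism S -> ambient} := fcst \o @tofrac S.

Definition feval (x : 'I_n -> ambient) (p : {mpoly {fraction S}[n]}) : ambient :=
  mmap fcst x p.

Definition eval m (x : 'I_m -> ambient) (p : {mpoly S[m]}) : ambient :=
  mmap cst x p.

Definition propto (f g : ambient) : Prop :=
  exists2 u : S, u \is a GRing.unit & f = cst u * g.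

Definition algebraically_independent (x : 'I_n -> ambient) : Prop :=
  forall p : {mpoly {fraction S}[n]}, feval x p = 0 -> p = 0.

Definition in_rational_subfield (x : 'I_n -> ambient) (f : ambient) : Prop :=
  exists p q : {mpoly {fraction S}[n]},
    feval x q != 0 /\ f = feval x p / feval x q.

Definition transcendence_basis (x : 'I_n -> ambient) : Prop :=
  algebraically_independent x /\
  (forall f : ambient, exists p : {poly ambient},
     [/\ p != 0, forall k, in_rational_subfield x p`_k & root p f]).

Definition laurent (x : 'I_n -> ambient) (f : ambient) : Prop :=
  exists (p : {mpoly S[n]}) (m : 'X_{1..n}),
    f = eval x p / \prod_(k < n) x k ^+ m k.

Definition laurent_dvd (x : 'I_n -> ambient) (g f : ambient) : Prop :=
  exists2 h, laurent x h & f = h * g.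

Definition subst (x : 'I_n -> ambient) (j : 'I_n) (f : ambient) :
  'I_n -> ambient := fun k => if k == j then f else x k.

Definition involves (p : {mpoly S[n]}) (i : 'I_n) : bool :=
  has (fun m : 'X_{1..n} => m i != 0%N) (msupp p).

Definition variable_free (p : {mpoly S[n]}) : Prop :=
  forall j : 'I_n, ~ divides 'X_j p.

(* The [i]-th exchange polynomial is stored as a polynomial in formal
   variables; the [k]-th variable stands for [cvar k]. *)
Record labeled_seed := LabeledSeed {
  cvar : 'I_n -> ambient;
  epoly : 'I_n -> {mpoly S[n]};
  cvar_basis : transcendence_basis cvar;
  epoly_irreducible : forall i, irreducible_elt (epoly i);
  epoly_variable_free : forall i, variable_free (epoly i);
  epoly_not_involves : forall i, ~~ involves (epoly i) i
}.

Definition epoly_val (s : labeled_seed) (i : 'I_n) : ambient :=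
  eval (cvar s) (epoly s i).

(* As the x_i are algebraically independent, the element F_i of the ambient
   field determines the polynomial, so a seed is a set of pairs (x_i, F_i) of
   elements of the ambient field. *)
Definition unlabel (s : labeled_seed) : {fset ambient * ambient} :=
  [fset (cvar s i, epoly_val s i) | i : 'I_n].

Definition is_seed (X : {fset ambient * ambient}) : Prop :=
  exists s, X = unlabel s.

Definition cluster (X : {fset ambient * ambient}) : {fset ambient} :=
  [fset q.1 | q in X].

Definition equivalent (X Y : {fset ambient * ambient}) : Prop :=
  exists s t, [/\ X = unlabel s, Y = unlabel t &
    forall i, propto (cvar s i) (cvar t i) /\
              propto (epoly_val s i) (epoly_val t i)].

(* The Laurent polynomial (prod_(k != i) x_k ^ a_k) F_i at the point [y]. *)
Definition hat_at (s : labeled_seed) (i : 'I_n) (a : 'I_n -> int)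
    (y : 'I_n -> ambient) : ambient :=
  (\prod_(k < n | k != i) y k ^ a k) * eval y (epoly s i).

(* The fresh variable replacing x_j in the substitution x_j <- F_j / x is
   again called x_j: F_j does not involve x_j, so renaming x to x_j
   identifies S[x_k^(+-1) (k != j), x^(+-1)] with S[x_1^(+-1),..,x_n^(+-1)]. *)
Definition hat_exponents (s : labeled_seed) (i : 'I_n) (a : 'I_n -> int) :
  Prop :=
  (forall k, k != i -> a k <= 0) /\
  (forall j, j != i ->
     let f := hat_at s i a
                (subst (cvar s) j (epoly_val s j / cvar s j)) in
     laurent (cvar s) f /\ ~ laurent_dvd (cvar s) (epoly_val s j) f).

Definition exchange_laurent (X : {fset ambient * ambient})
    (v h : ambient) : Prop :=
  exists s i a, [/\ X = unlabel s, v = cvar s i, hat_exponents s i a &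
                    h = hat_at s i a (cvar s)].

(* [variable_free] discards the irreducibles x_k, which are units of the
   Laurent polynomial ring; an element of S[x_k : k != i, j] is irreducible
   there iff it is irreducible in S[x_1,..,x_n]. *)
Definition irreducible_factor (x : 'I_n -> ambient) (i j : 'I_n)
    (c : ambient) (f : ambient) : Prop :=
  exists q : {mpoly S[n]},
    [/\ ~~ involves q i, ~~ involves q j, irreducible_elt q, variable_free q &
        f = eval x q /\ laurent_dvd x f c].

(* [G] and [H] live in the Laurent polynomial ring of the new cluster [x'],
   [c] in that of the old cluster [x]; the factors only involve the variables
   x_k = x'_k with k != i, j. *)
Definition common_factors_removed (x x' : 'I_n -> ambient) (i j : 'I_n)
    (c G H : ambient) : Prop :=
  [/\ laurent x' H,
      exists2 r : seq ambient,
        (forall f, f \in r -> irreducible_factor x i j c f) &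
        G = (\prod_(f <- r) f) * H &
      forall f, irreducible_factor x i j c f -> ~ laurent_dvd x' f H].

Definition labeled_mutation (i : 'I_n) (s t : labeled_seed) : Prop :=
  exists a : 'I_n -> int,
  [/\ hat_exponents s i a,
      cvar t i = hat_at s i a (cvar s) / cvar s i,
      forall j, j != i -> cvar t j = cvar s j,
      epoly_val t i = epoly_val s i &
      forall j, j != i ->
        if ~~ involves (epoly s j) i then propto (epoly_val t j) (epoly_val s j)
        else
          (* Here a j = 0, so that evaluating at x_j = 0 is meaningful. *)
          let c := hat_at s i a (subst (cvar s) j 0) in
          let G := eval (subst (cvar s) i (c / cvar t i)) (epoly s j) in
          exists H : ambient,
            common_factors_removed (cvar s) (cvar t) i j c G H /\
            (exists (u : S) (b : 'I_n -> int),
               u \is a GRing.unit /\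
               epoly_val t j =
                 cst u * (\prod_(k < n | k != j) cvar t k ^ b k) * H)].

Definition mutation (X : {fset ambient * ambient}) (v : ambient)
    (Y : {fset ambient * ambient}) : Prop :=
  exists s t i, [/\ X = unlabel s, Y = unlabel t, v = cvar s i &
                    labeled_mutation i s t].

End Ambient.

Record LP_algebra (S : idomainType) (n : nat) := LPAlgebra {
  carrier : ambient S n -> Prop;
  seeds : {fset ambient S n * ambient S n} -> Prop;
  mutate : {fset ambient S n * ambient S n} -> ambient S n ->
           {fset ambient S n * ambient S n};
  seeds_seed : forall X, seeds X -> is_seed X;
  seeds_inhabited : exists X, seeds X;
  seeds_mutate : forall X v, seeds X -> v \in cluster X ->
    seeds (mutate X v) /\ mutation X v (mutate X v);
  seeds_connected : forall X Y, seeds X -> seeds Y ->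
    clos_refl_sym_trans _
      (fun X1 X2 => seeds X1 /\
         exists2 v, v \in cluster X1 & X2 = mutate X1 v) X Y;
  carrier_generated : forall f, carrier f <->
    exists m (v : 'I_m -> ambient S n),
      (forall k, exists2 X, seeds X & v k \in cluster X) /\
      exists p : {mpoly S[m]}, f = eval v p
}.

Definition normalized (S : idomainType) (n : nat) (A : LP_algebra S n) : Prop :=
  forall X Y, seeds A X -> seeds A Y -> equivalent X Y -> X = Y.

Definition finite_type (S : idomainType) (n : nat) (A : LP_algebra S n) : Prop :=
  exists l : seq {fset ambient S n * ambient S n},
    forall X, seeds A X -> X \in l.

Definition seed_list (S : idomainType) (n : nat) (A : LP_algebra S n)
    (l : seq {fset ambient S n * ambient S n}) : Prop :=
  forall X, seeds A X <-> X \in l.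

Section RankTwo.

Variables (S : idomainType) (A0 : LP_algebra S 2).

Local Notation "c %:S" := (cst S 2 c) (at level 1, format "c %:S").
Local Notation "p @[ y ]" := (map_poly (cst S 2) p).[y]
  (at level 2, y at level 200, format "p @[ y ]").

Definition triangle : Prop :=
  exists (x y z : ambient S 2) (P : S),
    z = P%:S / (x * y) /\
    seed_list A0 [::
      [fset (x, P%:S); (y, P%:S)];
      [fset (x, P%:S); (z, P%:S)];
      [fset (z, P%:S); (y, P%:S)]].

Definition square : Prop :=
  exists (x y z u : ambient S 2) (Q : S) (P R : {poly S}) (k : nat) (d : int),
    [/\ size P = k.+1, ~ propto P@[y] Q%:S &
    let s1 := [fset (x, P@[y]); (y, Q%:S)] in
    let s2 := [fset (z, P@[y]); (y, Q%:S)] in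
    let s3 := [fset (z, R@[u]); (u, Q%:S)] in
    let s4 := [fset (x, R@[u]); (u, Q%:S)] in
    [/\ seed_list A0 [:: s1; s2; s3; s4],
        exchange_laurent s1 x (P@[y] / y ^ d) /\
          exchange_laurent s2 z (P@[y] / y ^ d),
        [/\ exchange_laurent s1 y Q%:S, exchange_laurent s2 y Q%:S,
            exchange_laurent s3 u Q%:S & exchange_laurent s4 u Q%:S],
        exchange_laurent s3 z (R@[u] / u ^ (k%:Z - d)) /\
          exchange_laurent s4 x (R@[u] / u ^ (k%:Z - d)) &
        R@[u] / u ^ (k%:Z - d) = P@[y] / y ^ d]].

Definition pentagon : Prop :=
  exists (x y z u t : ambient S 2) (A B C D E : S),
    seed_list A0 [::
      [fset (x, A%:S * y + (B * E)%:S); (y, C%:S * x + (D * E)%:S)];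
      [fset (z, A%:S * y + (E * B)%:S); (y, D%:S * z + (C * B)%:S)];
      [fset (z, E%:S * u + (A * C)%:S); (u, D%:S * z + (B * C)%:S)];
      [fset (t, E%:S * u + (C * A)%:S); (u, B%:S * t + (D * A)%:S)];
      [fset (t, C%:S * x + (E * D)%:S); (x, B%:S * t + (A * D)%:S)]] /\
    [/\ is_gcd [:: A; B] 1, is_gcd [:: A; E] 1, is_gcd [:: B; D] 1,
        is_gcd [:: C; D] 1 & is_gcd [:: C; E] 1].

Definition hexagon : Prop :=
  exists (x y z u v t : ambient S 2) (A B C D E F G : S),
    seed_list A0 [::
      [fset (x, A%:S * y ^+ 2 + (B * G)%:S * y + (C * F * G ^+ 2)%:S);
            (y, D%:S * x + (E * F * G)%:S)];
      [fset (z, A%:S * y ^+ 2 + (B * G)%:S * y + (F * C * G ^+ 2)%:S);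
            (y, E%:S * z + (D * C * G)%:S)];
      [fset (z, F%:S * u ^+ 2 + (B * D)%:S * u + (A * C * D ^+ 2)%:S);
            (u, E%:S * z + (G * C * D)%:S)];
      [fset (v, F%:S * u ^+ 2 + (B * D)%:S * u + (C * A * D ^+ 2)%:S);
            (u, G%:S * v + (E * A * D)%:S)];
      [fset (v, C%:S * t ^+ 2 + (B * E)%:S * t + (F * A * E ^+ 2)%:S);
            (t, G%:S * v + (D * A * E)%:S)];
      [fset (x, C%:S * t ^+ 2 + (B * E)%:S * t + (A * F * E ^+ 2)%:S);
            (t, D%:S * x + (G * F * E)%:S)]] /\
    [/\ is_gcd [:: A; G] 1 /\ is_gcd [:: C; E] 1,
        [/\ is_gcd [:: D; E] 1, is_gcd [:: D; F] 1 & is_gcd [:: D; G] 1],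
        is_gcd [:: E; G] 1 &
        [/\ is_gcd [:: A; B; C] 1, is_gcd [:: A; B; F] 1 &
            is_gcd [:: B; C; F] 1]].

Definition octagon : Prop :=
  exists (x y z u w s v t : ambient S 2) (A B C D E F G H K L : S),
    seed_list A0 [::
      [fset (x, A%:S * y ^+ 3 + (B * K * L)%:S * y ^+ 2
                + (C * H * K ^+ 2 * L ^+ 2)%:S * y
                + (D * G * H ^+ 2 * K ^+ 3 * L ^+ 3)%:S);
            (y, E%:S * x + (F * G * H * K * L ^+ 2)%:S)];
      [fset (z, A%:S * y ^+ 3 + (B * L * K)%:S * y ^+ 2
                + (C * H * L ^+ 2 * K ^+ 2)%:S * y
                + (G * D * H ^+ 2 * L ^+ 3 * K ^+ 3)%:S);
            (y, F%:S * z + (E * D * H * L * K ^+ 2)%:S)];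
      [fset (z, G%:S * u ^+ 3 + (C * E * K)%:S * u ^+ 2
                + (B * D * E ^+ 2 * K ^+ 2)%:S * u
                + (A * H * D ^+ 2 * E ^+ 3 * K ^+ 3)%:S);
            (u, F%:S * z + (L * H * D * E * K ^+ 2)%:S)];
      [fset (w, G%:S * u ^+ 3 + (C * K * E)%:S * u ^+ 2
                + (B * D * K ^+ 2 * E ^+ 2)%:S * u
                + (H * A * D ^+ 2 * K ^+ 3 * E ^+ 3)%:S);
            (u, L%:S * w + (F * A * D * K * E ^+ 2)%:S)];
      [fset (w, H%:S * s ^+ 3 + (B * F * E)%:S * s ^+ 2
                + (C * A * F ^+ 2 * E ^+ 2)%:S * s
                + (G * D * A ^+ 2 * F ^+ 3 * E ^+ 3)%:S);
            (s, L%:S * w + (K * D * A * F * E ^+ 2)%:S)];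
      [fset (v, H%:S * s ^+ 3 + (B * E * F)%:S * s ^+ 2
                + (C * A * E ^+ 2 * F ^+ 2)%:S * s
                + (D * G * A ^+ 2 * E ^+ 3 * F ^+ 3)%:S);
            (s, K%:S * v + (L * G * A * E * F ^+ 2)%:S)];
      [fset (v, D%:S * t ^+ 3 + (C * L * F)%:S * t ^+ 2
                + (B * G * L ^+ 2 * F ^+ 2)%:S * t
                + (H * A * G ^+ 2 * L ^+ 3 * F ^+ 3)%:S);
            (t, K%:S * v + (E * A * G * L * F ^+ 2)%:S)];
      [fset (x, D%:S * t ^+ 3 + (C * F * L)%:S * t ^+ 2
                + (B * G * F ^+ 2 * L ^+ 2)%:S * t
                + (A * H * G ^+ 2 * F ^+ 3 * L ^+ 3)%:S);
            (t, E%:S * x + (K * H * G * F * L ^+ 2)%:S)]] /\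
    [/\ [/\ is_gcd [:: A; K] 1, is_gcd [:: A; L] 1, is_gcd [:: D; F] 1 &
            is_gcd [:: D; L] 1],
        [/\ is_gcd [:: E; F] 1, is_gcd [:: E; G] 1, is_gcd [:: E; H] 1,
            is_gcd [:: E; K] 1 & is_gcd [:: E; L] 1],
        [/\ is_gcd [:: F; H] 1, is_gcd [:: F; K] 1, is_gcd [:: F; L] 1,
            is_gcd [:: G; K] 1 & is_gcd [:: K; L] 1],
        is_gcd [:: A; B; H] 1 /\ is_gcd [:: C; D; G] 1 &
        [/\ is_gcd [:: A; B; C; D] 1, is_gcd [:: A; B; C; G] 1,
            is_gcd [:: B; C; D; H] 1 & is_gcd [:: B; C; G; H] 1]].

End RankTwo.

(* Main.v *)
From HB Require Import structures.
From mathcomp Require Import all_boot all_order all_algebra.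
From mathcomp Require Import finmap.
From mathcomp Require Import mpoly ring zify.
From Stdlib Require Import Relation_Operators Classical.
Require Import Defs.

Set Implicit Arguments.
Unset Strict Implicit.
Unset Printing Implicit Defensive.

Import GRing.Theory.
Local Open Scope ring_scope.

(** A seed of rank two is {(x, p(y)), (y, q(x))} with p and q univariate.  If
    q involves x, then the mutation at x is x' = p(y) / x, the polynomial p is
    kept, and q is replaced by the primitive part of x'^(deg q) q(p(0) / x'); in
    particular the degrees of p and q do not change.  If q is a constant c, then
    x' = p(y) / (x y^d), where c^d exactly divides p(c / y), and q only changes by
    a unit.

    When p or q is constant, three or four mutations lead back to the initial
    seed up to units, and normalization turns this into equalities: these are
    the triangle and the square.  When both polynomials have positive degree,
    the weighted degrees of the cluster variables obey
    d_(j+1) = b_j d_j - d_(j-1) with b_j alternating between deg p and deg q,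
    and grow strictly if deg p * deg q >= 4; hence finite type leaves the
    degrees (1,1), (2,1) and (3,1).  There the coefficients of p and q are
    decomposed by moving common prime factors one at a time until the required
    gcd's are trivial.  The two mutations then act on the parameters by two
    reflections of a dihedral group, and the recursion
    x_(j+1) = P_j(x_j) / x_(j-1) has period 5, 6 or 8.  Along this cycle the
    actual seeds differ from the ones given by the parameters by units; since
    the cycle closes up, the units can be absorbed into the parameters. *)

(** * Unique factorization *)

(** A mutation removes common factors one irreducible at a time and fixes the new exchange
    polynomial only up to a unit. In rank two the removed factors are constants of S, so the new
    polynomial is proportional to the reversed one; both the reversal and primitivity being
    explicit, Gauss's lemma then determines it up to a unit, and the removal procedure never has to
    be followed. The remaining units are the main obstacle. A chain of mutations agrees with the
    formal recursion only after every variable and every exchange polynomial has been rescaled by a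
    unit, so two sequences of units are carried along. Once the formal recursion closes, the last
    seed is equivalent to the first one, and normalization forces the units at both ends to be 1;
    the few free ones in between amount to a change of the parameters. Growth is measured by
    specializing the initial cluster to (t^m, t^n), with m and n chosen so that the degrees,
    compared with their weights, increase from the start. *)

Section Divisibility.

Variable R : idomainType.
Implicit Types a b c p : R.

Lemma divides0 a : divides a 0.
Proof. by exists 0; rewrite mul0r. Qed.

Lemma divides_refl a : divides a a.
Proof. by exists 1; rewrite mul1r. Qed.

Lemma divides_trans b a c : divides a b -> divides b c -> divides a c.
Proof. by move=> [u ->] [v ->]; exists (v * u); rewrite mulrA. Qed.

Lemma divides_mull a b c : divides a b -> divides a (c * b).
Proof. by move=> [u ->]; exists (c * u); rewrite mulrA. Qed.

Lemma divides_mulr a b c : divides a b -> divides a (b * c).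
Proof. by rewrite mulrC; exact: divides_mull. Qed.

Lemma divides_unitl u a b : u \is a GRing.unit -> divides a (u * b) -> divides a b.
Proof. by move=> hu [c e]; exists (u^-1 * c); rewrite -mulrA -e mulKr. Qed.

Lemma divides_unitr u a b : u \is a GRing.unit -> divides a (b * u) -> divides a b.
Proof. by rewrite mulrC; exact: divides_unitl. Qed.

Lemma irreducible_neq0 p : irreducible_elt p -> p != 0.
Proof. by case. Qed.

Lemma irreducible_nunit p : irreducible_elt p -> p \isn't a GRing.unit.
Proof. by case. Qed.

Lemma irreducible_ndvd1 p : irreducible_elt p -> ~ divides p 1.
Proof.
case=> _ /negP h _ [c e]; apply: h; apply/unitrP; exists c.
by rewrite [p * c]mulrC -e.
Qed.

Lemma irreducible_dvd_assoc p q : irreducible_elt p -> irreducible_elt q ->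
  divides p q -> exists2 u, u \is a GRing.unit & q = u * p.
Proof.
move=> ip [_ _ iq] [c e]; case: (iq _ _ e) => h; first by exists c.
by move: (irreducible_nunit ip); rewrite h.
Qed.

Lemma associates_refl a : associates a a.
Proof. by exists 1; rewrite ?unitr1 ?mul1r. Qed.

Lemma associates_sym a b : associates a b -> associates b a.
Proof. by move=> [u hu ->]; exists u^-1; rewrite ?unitrV ?mulKr. Qed.

Lemma associates_trans b a c : associates a b -> associates b c -> associates a c.
Proof.
by move=> [u hu ->] [v hv ->]; exists (u * v); rewrite ?unitrM ?hu ?mulrA.
Qed.

Lemma associatesM a b c d :
  associates a b -> associates c d -> associates (a * c) (b * d).
Proof.
move=> [u hu ->] [v hv ->]; exists (u * v); rewrite ?unitrM ?hu //; ring.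
Qed.

Lemma irreducible_associates p q :
  associates p q -> irreducible_elt p -> irreducible_elt q.
Proof.
move=> [u hu e] [p0 pu pi]; split.
- by apply: contraNneq p0 => q0; rewrite e q0 mulr0.
- by move: pu; rewrite e unitrM hu.
- move=> b c q_e.
  have [] := pi (u * b) c; first by rewrite e q_e mulrA.
    by rewrite unitrM hu; left.
  by right.
Qed.

Definition coprime_seq (s : seq R) : Prop :=
  forall p, irreducible_elt p -> ~ (forall a, a \in s -> divides p a).

End Divisibility.

(** * Primes, extraction of common factors and primitive polynomials over a factorial ring *)

Section UFD.

Variable R : idomainType.
Hypothesis hR : ufd R.
Implicit Types a b c p q : R.

(** If a b = c p is nonzero, unique factorization matches p and the factors of c with the factors of
    a and b taken together, so p is associate to one of the latter. Putting p at the head of its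
    list lets index 0 pick it out. *)
Lemma irreducible_prime p a b :
  irreducible_elt p -> divides p (a * b) -> divides p a \/ divides p b.
Proof.
move=> ip [c e].
have [->|a0] := eqVneq a 0; first by left; exact: divides0.
have [->|b0] := eqVneq b 0; first by right; exact: divides0.
have c0 : c != 0.
  by apply: contraTneq (mulf_neq0 a0 b0) => c0; rewrite e c0 mul0r eqxx.
have [ra ira ea] := hR.1 _ a0; have [rb irb eb] := hR.1 _ b0.
have [rc irc ec] := hR.1 _ c0.
have [] := hR.2 (p :: rc) (ra ++ rb).
- by move=> x; rewrite inE => /orP[/eqP ->|/irc].
- by move=> x; rewrite mem_cat => /orP[/ira|/irb].
- rewrite big_cons big_cat /=.
  have h1 : associates (p * \prod_(i <- rc) i) (a * b).
    by rewrite e mulrC; apply: associatesM; [exact: associates_sym | exact: associates_refl].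
  exact: (associates_trans h1 (associatesM ea eb)).
move=> r pr [sz /(_ 0%N isT)] /=.
case: r pr sz => [|x r] //= pr _ hx.
have : x \in ra ++ rb by rewrite -(perm_mem pr) mem_head.
have px : divides p x by have [u _ ->] := associates_sym hx; exists u.
have aux s (d : R) : associates d (\prod_(i <- s) i) -> x \in s -> divides p d.
  move=> [u _ ->] xs; apply: divides_mull; rewrite (big_rem _ xs) /=.
  exact: divides_mulr.
rewrite mem_cat => /orP[xa|xb]; first by left; exact: aux ea xa.
by right; exact: aux eb xb.
Qed.

Lemma irreducible_prime_exp p a n :
  irreducible_elt p -> divides p (a ^+ n) -> divides p a.
Proof.
move=> ip; elim: n => [|n IH]; first by move/(irreducible_ndvd1 ip).
by rewrite exprS => /(irreducible_prime ip)[].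
Qed.

Lemma exists_irreducible_factor a : a != 0 -> a \isn't a GRing.unit ->
  exists2 p, irreducible_elt p & divides p a.
Proof.
move=> a0 au; have [[|p r] ir [u hu ea]] := hR.1 _ a0.
  by move: au; rewrite ea big_nil mulr1 hu.
exists p; first by apply: ir; rewrite mem_head.
by rewrite ea big_cons; apply/divides_mull/divides_mulr/divides_refl.
Qed.

(** An upper bound for the number of irreducible factors with multiplicity. It is the induction
    measure whenever primes are moved from one parameter to another. *)
Definition factors_le (n : nat) a : Prop :=
  forall r, irreducible_seq r -> divides (\prod_(i <- r) i) a -> (size r <= n)%N.

Lemma exists_factors_le a : a != 0 -> exists n, factors_le n a.
Proof.
move=> a0; have [r ir ea] := hR.1 _ a0; exists (size r) => s is_ [c ec].
have c0 : c != 0 by apply: contraNneq a0 => c0; rewrite ec c0 mul0r.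
have [rc irc ecc] := hR.1 _ c0.
have [] := hR.2 (s ++ rc) r => //.
- by move=> x; rewrite mem_cat => /orP[/is_|/irc].
- apply: (associates_trans (b := a)) => //.
  rewrite ec big_cat /= mulrC.
  by apply: associatesM; [exact: associates_sym|exact: associates_refl].
move=> r' pr [sz _]; rewrite -(perm_size pr) -sz size_cat; exact: leq_addr.
Qed.

Lemma factors_le_mulS p a n : irreducible_elt p -> factors_le n (p * a) ->
  exists2 m, n = m.+1 & factors_le m a.
Proof.
move=> ip h.
have key r : irreducible_seq r -> divides (\prod_(i <- r) i) a -> (size r < n)%N.
  move=> ir [c ec]; apply: (h (p :: r)).
    by move=> x; rewrite inE => /orP[/eqP ->|/ir].
  by rewrite big_cons ec; exists c; ring.
case: n h key => [|n] _ key; last by exists n => // r ir dr; rewrite -ltnS key.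
suff: (0 < 0)%N by [].
by apply: (key [::]) => //; rewrite big_nil; exists a; rewrite mulr1.
Qed.

(** Common irreducible factors are moved into d one at a time; each of them lowers the number of
    factors of a. *)
Lemma coprime_extraction a b : a != 0 -> exists d a' b',
  [/\ a = d * a', b = d * b', d != 0 &
   forall p, irreducible_elt p -> divides p a' -> ~ divides p b'].
Proof.
move=> a0; have [n] := exists_factors_le a0.
elim: n a b a0 => [|n IH] a b a0 hn.
  exists 1, a, b; split; rewrite ?mul1r ?oner_neq0 // => p ip pa _.
  have [c e] := pa; have := @factors_le_mulS p c 0 ip.
  by rewrite mulrC -e => /(_ hn)[].
have [[p [ip [a' ea] [b' eb]]]|h] :=
  classic (exists p, [/\ irreducible_elt p, divides p a & divides p b]); last first.
  exists 1, a, b; split; rewrite ?mul1r ?oner_neq0 // => p ip pa pb.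
  by apply: h; exists p.
have a'0 : a' != 0 by apply: contraNneq a0 => h; rewrite ea h mul0r.
have [|d [a'' [b'' [e1 e2 d0 h]]]] := IH a' b' a'0.
  by have [|m [<-]] := @factors_le_mulS p a' n.+1 ip; rewrite // mulrC -ea.
exists (p * d), a'', b''; split => //.
- by rewrite ea e1; ring.
- by rewrite eb e2; ring.
- by rewrite mulf_neq0 // irreducible_neq0.
Qed.

(** Over a field there are no irreducibles, so [coprime_seq] holds even for a list of zeros, whose
    gcd is 0; a nonzero entry rules this out. *)
Lemma coprime_is_gcd1 (s : seq R) a :
  a \in s -> a != 0 -> coprime_seq s -> is_gcd s 1.
Proof.
move=> as_ a0 cs; split=> [b _|e he]; first by exists b; rewrite mulr1.
have e0 : e != 0.
  by apply: contraNneq a0 => e0; case: (he _ as_) => c ->; rewrite e0 mulr0.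
have [eu|eu] := boolP (e \is a GRing.unit).
  by exists e^-1; rewrite mulVr.
have [p ip pe] := exists_irreducible_factor e0 eu.
by case: (cs p ip) => b /he; exact: divides_trans pe.
Qed.

Definition primitive (f : {poly R}) : Prop :=
  forall p, irreducible_elt p -> ~ (forall i, divides p f`_i).

(** After the common part of r and s is cancelled, an irreducible factor of what remains of r would
    divide all coefficients of g, and likewise for s and f; so both remainders are units. This
    recovers an exchange polynomial from any nonzero constant multiple of it. *)
Lemma primitive_scale_eq r s (f g : {poly R}) : r != 0 -> s != 0 ->
  primitive f -> primitive g -> r *: f = s *: g ->
  exists2 u, u \is a GRing.unit & f = u *: g.
Proof.
move=> r0 s0 pf pg e.
have [d [r' [s' [er es d0 cp]]]] := coprime_extraction s r0.
have r'0 : r' != 0 by apply: contraNneq r0 => h; rewrite er h mulr0.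
have s'0 : s' != 0 by apply: contraNneq s0 => h; rewrite es h mulr0.
have e' : r' *: f = s' *: g.
  apply/polyP => i; have /polyP/(_ i) := e; rewrite !coefZ er es => ei.
  by apply: (mulfI d0); rewrite !mulrA.
have unit_of a b (f1 g1 : {poly R}) : a != 0 -> primitive g1 ->
    (forall p, irreducible_elt p -> divides p a -> ~ divides p b) ->
    a *: f1 = b *: g1 -> a \is a GRing.unit.
  move=> a0 pg1 hab eab; apply/negPn/negP => au.
  have [p ip pa] := exists_irreducible_factor a0 au.
  apply: (pg1 p ip) => i.
  have : divides p (b * g1`_i).
    by rewrite -coefZ -eab coefZ; exact: divides_mulr.
  by case/(irreducible_prime ip) => // /(hab p ip pa).
have ur := unit_of _ _ _ _ r'0 pg cp e'.
have us : s' \is a GRing.unit.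
  apply: (unit_of _ _ _ _ s'0 pf _ (esym e')) => p ip ps pr.
  exact: cp ip pr ps.
exists (r'^-1 * s'); first by rewrite unitrM unitrV ur.
by rewrite -scalerA -e' scalerA mulVr // scale1r.
Qed.

End UFD.

(** * Evaluation of polynomials *)

Lemma poly_rmorph_ext (A C : comNzRingType) (f g : {rmorphism {poly A} -> C}) :
  (forall a, f a%:P = g a%:P) -> f 'X = g 'X -> f =1 g.
Proof.
move=> hc hX w; rewrite -[w]coefK poly_def !rmorph_sum.
by apply: eq_bigr => i _; rewrite -mul_polyC !rmorphM !rmorphXn /= hc hX.
Qed.

Lemma mpoly_rmorph_ext n (A C : comNzRingType)
    (f g : {rmorphism {mpoly A[n]} -> C}) :
  (forall a, f a%:MP = g a%:MP) -> (forall i, f 'X_i = g 'X_i) -> f =1 g.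
Proof.
move=> hc hX w; rewrite [w]mpolyE !rmorph_sum.
apply: eq_bigr => m _; rewrite -mul_mpolyC !rmorphM /= hc mpolyXE_id.
by rewrite !rmorph_prod; congr (_ * _); apply: eq_bigr => i _; rewrite !rmorphXn /= hX.
Qed.

Lemma ord2_other (i j : 'I_2) : (j != i) = (j == rev_ord i).
Proof. by case: i => [[|[|//]] ?]; case: j => [[|[|//]] ?]. Qed.

Lemma rev_ord2_neq (i : 'I_2) : (rev_ord i != i).
Proof. by rewrite ord2_other. Qed.

Lemma big_ord2 (C : Type) (idx : C) (op : Monoid.com_law idx) (i : 'I_2) (f : 'I_2 -> C) :
  \big[op/idx]_(k < 2) f k = op (f i) (f (rev_ord i)).
Proof.
rewrite (bigD1 i) //=; congr (op _ _).
by rewrite (eq_bigl (pred1 (rev_ord i))) ?big_pred1_eq // => k; rewrite /= ord2_other.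
Qed.

Lemma big_ord2_neq (C : Type) (idx : C) (op : Monoid.com_law idx) (i : 'I_2) (f : 'I_2 -> C) :
  \big[op/idx]_(k < 2 | k != i) f k = f (rev_ord i).
Proof.
by rewrite (eq_bigl (pred1 (rev_ord i))) ?big_pred1_eq // => k; rewrite /= ord2_other.
Qed.

Section Evaluation.

Variables (S : idomainType) (F : fieldType) (cst : {rmorphism S -> F}).

Definition ev (x : F) (p : {poly S}) : F := (map_poly cst p).[x].
Arguments ev : simpl never.
HB.instance Definition _ x :=
  GRing.RMorphism.copy (ev x) (horner_eval x \o map_poly cst).

Definition ev2 (x y : F) (w : {poly {poly S}}) : F := (map_poly (ev x) w).[y].
Arguments ev2 : simpl never.
HB.instance Definition _ x y :=
  GRing.RMorphism.copy (ev2 x y) (horner_eval y \o map_poly (ev x)).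

Definition indep (x y : F) : Prop := forall w, ev2 x y w = 0 -> w = 0.

Lemma evC x c : ev x c%:P = cst c.
Proof. by rewrite /ev map_polyC hornerC. Qed.

Lemma evX x : ev x 'X = x.
Proof. by rewrite /ev map_polyX hornerX. Qed.

Lemma evZ x c p : ev x (c *: p) = cst c * ev x p.
Proof. by rewrite -mul_polyC rmorphM /= evC. Qed.

Lemma ev2C x y p : ev2 x y p%:P = ev x p.
Proof. by rewrite /ev2 map_polyC hornerC. Qed.

Lemma ev2X x y : ev2 x y 'X = y.
Proof. by rewrite /ev2 map_polyX hornerX. Qed.

Lemma ev2_map x y p : ev2 x y (map_poly polyC p) = ev y p.
Proof.
pose f : {rmorphism {poly S} -> F} := ev2 x y \o map_poly (@polyC S).
apply: (poly_rmorph_ext (f := f)) => [a|] /=.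
  by rewrite map_polyC /= ev2C !evC.
by rewrite map_polyX ev2X evX.
Qed.

Section Indep.

Variables x y : F.
Hypothesis hxy : indep x y.

Lemma ev2_inj : injective (ev2 x y).
Proof.
by move=> v w e; apply/eqP; rewrite -subr_eq0; apply/eqP/hxy; rewrite rmorphB /= e subrr.
Qed.

Lemma ev_injl : injective (ev x).
Proof. by move=> p q; rewrite -!(ev2C x y) => /ev2_inj/polyC_inj. Qed.

Lemma ev_injr : injective (ev y).
Proof.
move=> p q; rewrite -!(ev2_map x y) => /ev2_inj.
by apply: map_inj_poly => //; apply: polyC_inj.
Qed.

Lemma cst_inj : injective cst.
Proof. by move=> a b; rewrite -!(evC x) => /ev_injl/polyC_inj. Qed.

Lemma indep_neq0l : x != 0.
Proof.
apply/eqP => h; have := @ev_injl 'X 0; rewrite evX rmorph0 => /(_ h)/eqP.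
by rewrite polyX_eq0.
Qed.

Lemma indep_neq0r : y != 0.
Proof.
apply/eqP => h; have := @ev_injr 'X 0; rewrite evX rmorph0 => /(_ h)/eqP.
by rewrite polyX_eq0.
Qed.

Lemma ev_neq0r p : p != 0 -> ev y p != 0.
Proof. by apply: contra_neq => e; apply: ev_injr; rewrite e rmorph0. Qed.

Lemma ev_neq0l p : p != 0 -> ev x p != 0.
Proof. by apply: contra_neq => e; apply: ev_injl; rewrite e rmorph0. Qed.

Lemma cst_neq0 c : c != 0 -> cst c != 0.
Proof. by apply: contra_neq => e; apply: cst_inj; rewrite e rmorph0. Qed.

(** The relation x - u y, as a polynomial in y, has the nonzero constant term x. This later rules
    out that an identification of seeds exchanges the two variables of a cluster. *)
Lemma indep_not_cstM u : x <> cst u * y.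
Proof.
move=> e; have : ev2 x y ('X%:P - u%:P%:P * 'X) = 0.
  by rewrite rmorphB rmorphM /= !ev2C ev2X evC evX {1}e subrr.
move=> /hxy h; have {h} := congr1 (fun w : {poly {poly S}} => w`_0) h.
rewrite coefB coefC eqxx coefMX eqxx coef0 subr0 => /eqP.
by rewrite polyX_eq0.
Qed.

End Indep.

End Evaluation.

(** * From multivariate polynomials in two variables to iterated univariate ones *)

Section AmbientEvaluation.

Variable S : idomainType.
Local Notation F := (ambient S 2).
Local Notation cst := (cst S 2).
Local Notation ev := (ev cst).
Local Notation ev2 := (ev2 cst).
Local Notation indep := (indep cst).

Definition inj (j : 'I_2) (p : {poly S}) : {mpoly S[2]} :=
  (map_poly (@mpolyC 2 S) p).['X_j].
Arguments inj : simpl never.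
HB.instance Definition _ j :=
  GRing.RMorphism.copy (inj j) (horner_eval 'X_j \o map_poly (@mpolyC 2 S)).

Lemma injC j c : inj j c%:P = c%:MP.
Proof. by rewrite /inj map_polyC hornerC. Qed.

Lemma injX j : inj j 'X = 'X_j.
Proof. by rewrite /inj map_polyX hornerX. Qed.

Lemma eval_inj (v : 'I_2 -> F) j p : eval v (inj j p) = ev (v j) p.
Proof.
pose f : {rmorphism {poly S} -> F} := mmap cst v \o inj j.
apply: (poly_rmorph_ext (f := f)) => [a|] /=.
  by rewrite evC injC mmapC.
by rewrite evX injX mmapX mmap1U.
Qed.

Lemma eval_ev2 (v : 'I_2 -> F) i (p : {mpoly S[2]}) :
  exists w, eval v p = ev2 (v i) (v (rev_ord i)) w.
Proof.
pose W : {rmorphism {mpoly S[2]} -> {poly {poly S}}} :=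
  mmap (polyC \o @polyC S) (fun k => if k == i then 'X%:P else 'X).
exists (W p).
pose g : {rmorphism {mpoly S[2]} -> F} := ev2 (v i) (v (rev_ord i)) \o W.
apply: (mpoly_rmorph_ext (f := mmap cst v) (g := g)) => [a|k].
  by rewrite /= !mmapC /= ev2C evC.
rewrite /= !mmapX !mmap1U.
have [->|] := eqVneq k i; first by rewrite ev2C evX.
by rewrite ord2_other => /eqP ->; rewrite ev2X.
Qed.

(** The target ring is arbitrary because w has to be compared in the field, in the multivariate ring
    and in the iterated ring over Frac(S); naturality in the target does this. *)
Definition bieval (C : comNzRingType) (c : {rmorphism S -> C}) (x y : C)
    (w : {poly {poly S}}) : C :=
  (map_poly (horner_eval x \o map_poly c) w).[y].

Lemma rmorph_bieval (C D : comNzRingType) (c : {rmorphism S -> C})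
    (d : {rmorphism S -> D}) (f : {rmorphism C -> D}) x y w :
  f \o c =1 d -> f (bieval c x y w) = bieval d (f x) (f y) w.
Proof.
move=> fc; rewrite /bieval -horner_map -map_poly_comp; congr (_.[_]).
apply: eq_map_poly => p /=; rewrite /horner_eval -(horner_map f) -map_poly_comp.
by congr (_.[_]); exact: eq_map_poly.
Qed.

(** A relation w over S becomes a multivariate polynomial Phi over Frac(S) that vanishes at v, hence
    Phi = 0. Mapping Phi back to iterated polynomials recovers w with coefficients in Frac(S), where
    S embeds. *)
Lemma algebraically_independent_indep (v : 'I_2 -> F) i :
  algebraically_independent v -> indep (v i) (v (rev_ord i)).
Proof.
move=> hv w.
pose c1 : {rmorphism S -> {mpoly {fraction S}[2]}} := @mpolyC 2 _ \o @tofrac S.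
pose c2 : {rmorphism S -> {poly {poly {fraction S}}}} :=
  polyC \o (@polyC _) \o @tofrac S.
pose j := rev_ord i.
pose Phi := bieval c1 'X_i 'X_j w.
have -> : ev2 (v i) (v j) w = mmap (fcst S 2) v Phi.
  have hc : mmap (fcst S 2) v \o c1 =1 cst.
    move=> a; exact: (mmapC v (fcst S 2) (tofrac a)).
  have hX k : mmap (fcst S 2) v 'X_k = v k.
    rewrite mmapX. exact: mmap1U.
  have := rmorph_bieval (f := mmap (fcst S 2) v) 'X_i 'X_j w hc.
  rewrite -/Phi.
  rewrite /= !hX => ->.
  by [].
move/hv => h2.
pose Psi : {rmorphism {mpoly {fraction S}[2]} -> {poly {poly {fraction S}}}} :=
  mmap (polyC \o @polyC _) (fun k => if k == i then 'X%:P else 'X).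
have h3 : Psi Phi = map_poly (map_poly (@tofrac S)) w.
  rewrite (rmorph_bieval (d := c2)) => [|a] /=; last by rewrite mmapC.
  rewrite !mmapX !mmap1U eqxx (negPf (rev_ord2_neq i)) /bieval.
  rewrite -[RHS]comp_polyXr /comp_poly -map_poly_comp.
  congr (_.[_]); apply: eq_map_poly => p /=.
  rewrite /horner_eval -[in RHS](comp_polyXr (map_poly _ p)) /comp_poly.
  rewrite -(horner_map (@polyC _)) -!map_poly_comp /=.
  by congr (_.[_]); apply: eq_map_poly => a /=.
apply: (@map_inj_poly _ _ (map_poly (@tofrac S))); rewrite ?rmorph0 //.
  by apply: map_inj_poly; [move=> a b /eqP; rewrite tofrac_eq => /eqP|exact: rmorph0].
by rewrite -h3 h2 rmorph0.
Qed.

End AmbientEvaluation.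

(** * Exchange polynomials *)

Section SeedPolynomials.

Variable S : idomainType.
Local Notation F := (ambient S 2).
Local Notation cst := (cst S 2).
Local Notation ev := (ev cst).
Local Notation ev2 := (ev2 cst).
Local Notation indep := (indep cst).

Lemma injZ j c (p : {poly S}) : inj j (c *: p) = c%:MP * inj j p.
Proof. by rewrite -mul_polyC rmorphM /= injC. Qed.

(** Sending both variables to X undoes [inj j], so that units of the two-variable ring can be pulled
    back to S[X]. *)
Lemma inj_retract j : exists f : {rmorphism {mpoly S[2]} -> {poly S}}, cancel (inj j) f.
Proof.
exists (mmap (@polyC S) (fun _ => 'X)) => p /=.
pose f : {rmorphism {poly S} -> {poly S}} := mmap (@polyC S) (fun _ => 'X) \o inj j.
have h : f =1 idfun.
  apply: (poly_rmorph_ext (g := idfun)) => [a|] /=; first by rewrite injC mmapC.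
  by rewrite injX mmapX mmap1U.
exact: h.
Qed.

Lemma mpolyC_unit (c : S) : (c%:MP : {mpoly S[2]}) \is a GRing.unit -> c \is a GRing.unit.
Proof.
case/unitrP => q [_ e]; apply/unitrP; exists (q@_0%MM).
have h : c * q@_0%MM = 1 by rewrite -mcoeffCM e mcoeff1 eqxx.
by split; rewrite // mulrC.
Qed.

Lemma not_involves_inj (p : {mpoly S[2]}) i :
  ~~ involves p i -> exists f, p = inj (rev_ord i) f.
Proof.
move=> /hasPn h; exists (\sum_(m <- msupp p) p@_m *: 'X^(m (rev_ord i))).
rewrite {1}[p]mpolyE rmorph_sum; apply: eq_big_seq => m /h.
rewrite negbK => /eqP mi; rewrite /= injZ rmorphXn /= injX mul_mpolyC.
by congr (_ *: _); rewrite mpolyXE_id (big_ord2 _ i) /= mi expr0 mul1r.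
Qed.

Lemma involves_inj j (p : {poly S}) : involves (inj j p) j = (1 < size p)%N.
Proof.
have [sp|sp] := ltnP.
  apply/hasP; exists (U_(j) *+ (size p).-1)%MM; last first.
    by rewrite mulmnE mnm1E eqxx mul1n -lt0n; case: (size p) sp => [|[]].
  rewrite mcoeff_msupp -{2}[p]coefK poly_def rmorph_sum raddf_sum /=.
  have sp0 : ((size p).-1 < size p)%N by case: (size p) sp.
  rewrite (bigD1 (Ordinal sp0)) //= big1 ?addr0 => [|k hk].
    rewrite injZ rmorphXn /= injX mcoeffCM mpolyXn mcoeffX eqxx mulr1.
    by rewrite lead_coef_eq0 -size_poly_eq0; case: (size p) sp.
  rewrite injZ rmorphXn /= injX mcoeffCM mpolyXn mcoeffX.
  case: eqP => [/mnmP/(_ j)|]; last by rewrite mulr0.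
  rewrite !mulmnE !mnm1E eqxx !mul1n => e.
  by case/eqP: hk; apply: val_inj.
rewrite (size1_polyC sp) injC; apply/negbTE/hasPn => m.
by rewrite mcoeff_msupp mcoeffC; have [->|_] := eqVneq m 0%MM; rewrite ?mnm0E // mulr0 eqxx.
Qed.

(** The consequences of the seed axioms on which the classification rests: p(0) is nonzero because
    no variable divides p, and irreducibility gives primitivity in positive degree and an
    irreducible element of S in degree zero. *)
Definition exchange_poly (p : {poly S}) : Prop :=
  [/\ p`_0 != 0, ((1 < size p)%N -> primitive p) &
      ((size p <= 1)%N -> irreducible_elt p`_0)].

Lemma coef0_eq0_mulX (p : {poly S}) : p`_0 = 0 -> exists q, p = q * 'X.
Proof.
move=> p0; have /factor_theorem[q e] : root p 0 by rewrite rootE horner_coef0 p0.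
by exists q; rewrite {1}e subr0.
Qed.

Lemma exchange_poly_inj j (p : {poly S}) :
  irreducible_elt (inj j p) -> variable_free (inj j p) -> exchange_poly p.
Proof.
move=> [n0 nu ir] vf; split.
- apply: contra_notN (vf j) => /eqP/coef0_eq0_mulX[q ->].
  by exists (inj j q); rewrite rmorphM /= injX.
- move=> sp a ia h.
  have [g eg] : exists g, p = a *: g.
    have /fin_all_exists[g hg] (i : 'I_(size p)) : exists c, p`_i = c * a by exact: h.
    exists (\poly_(i < size p) oapp g 0 (insub i)).
    apply/polyP => i; rewrite coefZ coef_poly; case: ltnP => hi.
      by rewrite insubT /= mulrC -hg.
    by rewrite mulr0 nth_default.
  have := ir _ _ (eq_trans (congr1 _ eg) (injZ j a g)).
  case=> [/mpolyC_unit|]; first by apply/negP/irreducible_nunit.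
  have [f fK] := inj_retract j; move/(rmorph_unit f); rewrite fK => ug.
  have a0 := irreducible_neq0 ia.
  move: sp; rewrite eg size_scale //.
  by move: ug; rewrite poly_unitE => /andP[/eqP -> _].
- move=> /size1_polyC e; move: n0 nu ir; rewrite {1 2 3}e !injC => n0 nu ir; split.
  + by apply: contraNneq n0 => ->; rewrite mpolyC0.
  + by apply: contraNN nu => u0; apply: rmorph_unit.
  + move=> b c ebc; have [] := ir b%:MP c%:MP; first by rewrite ebc mpolyCM.
      by move/mpolyC_unit; left.
    by move/mpolyC_unit; right.
Qed.

Lemma epoly_inj (s : labeled_seed S 2) i :
  exists2 p, epoly s i = inj (rev_ord i) p & exchange_poly p.
Proof.
have [p e] := not_involves_inj (epoly_not_involves s i); exists p => //.
by apply: (exchange_poly_inj (j := rev_ord i)); rewrite -e;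
  [exact: epoly_irreducible|exact: epoly_variable_free].
Qed.

Lemma labeled_indep (s : labeled_seed S 2) i :
  indep (cvar s i) (cvar s (rev_ord i)).
Proof. by apply: algebraically_independent_indep; case: (cvar_basis s). Qed.

Lemma unlabel2 (s : labeled_seed S 2) i :
  unlabel s = [fset (cvar s i, epoly_val s i);
                    (cvar s (rev_ord i), epoly_val s (rev_ord i))]%fset.
Proof.
apply/fsetP => x; rewrite in_fset2; apply/imfsetP/orP => /=.
  move=> [k _ ->]; have [->|] := eqVneq k i; first by left.
  by rewrite ord2_other => /eqP ->; right.
by case=> /eqP ->; [exists i|exists (rev_ord i)].
Qed.

End SeedPolynomials.

(** * Mutation of labelled seeds *)

(* [rev_at p c] is y^(deg p) p(c / y) as a polynomial in y. *)
Definition rev_at (R : nzRingType) (p : {poly R}) (c : R) : {poly R} :=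
  \poly_(k < size p) (p`_((size p).-1 - k) * c ^+ ((size p).-1 - k)).

Lemma horner_rev_at (R : comNzRingType) (K : fieldType) (f : {rmorphism R -> K})
    (p : {poly R}) c u : u != 0 ->
  (map_poly f (rev_at p c)).[u] = u ^+ (size p).-1 * (map_poly f p).[f c / u].
Proof.
move=> u0; have sz : (size (map_poly f (rev_at p c)) <= size p)%N.
  by rewrite (leq_trans (size_poly _ _)) // size_poly.
rewrite (horner_coef_wide _ sz) (horner_coef_wide _ (size_poly _ _ : (size (map_poly f p) <= size p)%N)).
rewrite (reindex_inj rev_ord_inj) mulr_sumr; apply: eq_bigr => i _ /=.
rewrite !coef_map coef_poly /=.
have hi := ltn_ord i.
have -> : (size p - i.+1 < size p)%N by lia.
have -> : ((size p).-1 - (size p - i.+1) = i)%N by lia.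
rewrite rmorphM rmorphXn /= expr_div_n; have -> : (size p).-1 = (i + (size p - i.+1))%N by lia.
rewrite exprD; have := expf_neq0 i u0; set a := f _; set b := f _ ^+ _; set v := u ^+ i.
by move=> v0; field.
Qed.

Lemma dvd_coefs_scale (R : idomainType) (a : R) (p : {poly R}) :
  (forall i, divides a p`_i) -> exists g, p = a *: g.
Proof.
move=> h; have /fin_all_exists[g hg] (i : 'I_(size p)) : exists c, p`_i = c * a by exact: h.
exists (\poly_(i < size p) oapp g 0 (insub i)).
apply/polyP => i; rewrite coefZ coef_poly; case: ltnP => hi.
  by rewrite insubT /= mulrC -hg.
by rewrite mulr0 nth_default.
Qed.

(** X does not divide g, so every factor X of the product comes from h; cancelling them all leaves g
    dividing a nonzero constant. *)
Lemma mul_monomial_size1 (R : idomainType) (g h : {poly R}) c m :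
  g`_0 != 0 -> c != 0 -> g * h = c *: 'X^m -> size g = 1%N.
Proof.
move=> g0 c0; elim: m h => [|m IH] h e.
  have : size (g * h) = 1%N by rewrite e expr0 alg_polyC size_polyC c0.
  by rewrite -/(nat_of_ord 1) => /eqP; rewrite size_mul_eq1 => /andP[/eqP].
have [k ek] : exists k, h = k * 'X.
  apply: coef0_eq0_mulX; apply/eqP.
  have /eqP := congr1 (fun w : {poly R} => w`_0) e.
  by rewrite coef0M coefZ coefXn mulr0 mulf_eq0 (negPf g0).
apply: (IH k); apply: (mulIf (negbT (polyX_eq0 R))).
by rewrite -mulrA -ek e exprSr scalerAl.
Qed.

(** The next four field identities are stated in opaque letters, which stand for powers and
    polynomial values in the ambient field. *)
Lemma divf_mulr_cancel (K : fieldType) (W xm yn P yd Qd yN : K) :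
  xm != 0 -> yn != 0 -> Qd != 0 -> yN != 0 ->
  P * yd / (Qd * yN) = W / (xm * yn) -> P * xm * (yn * yd) = W * Qd * yN.
Proof.
move=> h1 h2 h3 h4 e.
have -> : P * xm * (yn * yd) = P * yd / (Qd * yN) * (Qd * yN * xm * yn).
  by field; rewrite h3 h4.
by rewrite e; field; rewrite h1 h2.
Qed.

Lemma divf_split (K : fieldType) (yd Qd yN P : K) :
  Qd != 0 -> yd != 0 -> yN != 0 -> (Qd / yd)^-1 * P = yN * P * yd / (Qd * yN).
Proof. by move=> h1 h2 h3; field; rewrite h1 h2 h3. Qed.

Lemma divf_common (K : fieldType) (c Qd yd yN h : K) : c != 0 -> Qd != 0 -> yN != 0 ->
  Qd * c * h * yd / (Qd * yN) = h * yd / yN * c.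
Proof. by move=> h0 h1 h2; field; rewrite h1 h2. Qed.

Lemma mulf_shift (K : fieldType) (zn zb u c G : K) : zn != 0 ->
  c * (u * zb * G) = zb / zn * (u * (zn * (c * G))).
Proof. by move=> h; field. Qed.

Section LabeledMutation.

Variable S : idomainType.
Local Notation F := (ambient S 2).
Local Notation cst := (cst S 2).
Local Notation ev := (ev cst).
Local Notation ev2 := (ev2 cst).
Local Notation indep := (indep cst).

(** The exponent of c in the content of y^(deg p) p(c / y). In a seed whose exchange polynomial at y
    is the constant c, the exchange Laurent polynomial at x is p(y) / y^d. *)
Definition content_exp (p : {poly S}) (c : S) (d : nat) : Prop :=
  (exists h, rev_at p c = c ^+ d *: h) /\
  ~ (exists h, rev_at p c = c ^+ d.+1 *: h).

Lemma ev_rev_at (p : {poly S}) c (u : F) : u != 0 ->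
  ev u (rev_at p c) = u ^+ (size p).-1 * ev (cst c / u) p.
Proof. exact: horner_rev_at. Qed.

Lemma hat_at2 (s : labeled_seed S 2) i a v p :
  epoly s i = inj (rev_ord i) p ->
  hat_at s i a v = v (rev_ord i) ^ a (rev_ord i) * ev (v (rev_ord i)) p.
Proof. by move=> e; rewrite /hat_at big_ord2_neq /= e eval_inj. Qed.

Lemma laurent_ev2 (v : 'I_2 -> F) i f : laurent v f ->
  exists w m n, f = ev2 (v i) (v (rev_ord i)) w / (v i ^+ m * v (rev_ord i) ^+ n).
Proof.
move=> [p [m ->]]; have [w ew] := eval_ev2 v i p.
by exists w, (m i), (m (rev_ord i)); rewrite ew (big_ord2 _ i).
Qed.

Lemma ev_laurent (v : 'I_2 -> F) j p n : laurent v (ev (v j) p / v j ^+ n).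
Proof.
exists (inj j p), (U_(j) *+ n)%MM; rewrite eval_inj (big_ord2 _ j) /=.
rewrite !mulmnE !mnm1E eqxx mul1n eq_sym (negPf (rev_ord2_neq j)) mul0n.
by rewrite expr0 mulr1.
Qed.

Section Step.

Variables (s : labeled_seed S 2) (i : 'I_2).
Local Notation j := (rev_ord i).
Local Notation x := (cvar s i).
Local Notation y := (cvar s j).
Variables p q : {poly S}.
Hypothesis ep : epoly s i = inj j p.
Hypothesis eq_ : epoly s j = inj i q.
Hypothesis gp : exchange_poly p.
Hypothesis gq : exchange_poly q.

Let hxy : indep x y := @labeled_indep S s i.
Let x0 : x != 0 := indep_neq0l hxy.
Let y0 : y != 0 := indep_neq0r hxy.
Let p00 : p`_0 != 0. Proof. by case: gp. Qed.
Let q00 : q`_0 != 0. Proof. by case: gq. Qed.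
Let qn0 : q != 0. Proof. by apply: contraNneq q00 => ->; rewrite coef0. Qed.
Let pn0 : p != 0. Proof. by apply: contraNneq p00 => ->; rewrite coef0. Qed.

Lemma epoly_valj : epoly_val s j = ev x q.
Proof. by rewrite /epoly_val eq_ eval_inj. Qed.

Lemma epoly_vali : epoly_val s i = ev y p.
Proof. by rewrite /epoly_val ep eval_inj. Qed.

(** With a_j = -d, substituting q / y for y in y^(-d) p(y) gives y^d p(q / y) / q^d, and p(q / y) is
    the reversed polynomial over S[x] divided by y^(deg p). The outer variable of that polynomial is
    y, the inner one x; clearing denominators turns the Laurent condition into a polynomial
    identity. *)
Lemma hat_exponents2 a : hat_exponents s i a -> exists d : nat,
  [/\ a j = - (d%:Z),
     exists w m n, ev2 x y (rev_at (map_poly polyC p) q) * x ^+ m * y ^+ (n + d) =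
       ev2 x y w * ev x q ^+ d * y ^+ (size p).-1 &
     ~ laurent_dvd (cvar s) (ev x q)
         (ev2 x y (rev_at (map_poly polyC p) q) * y ^+ d
            / (ev x q ^+ d * y ^+ (size p).-1)) ].
Proof.
move=> [ha /(_ j (rev_ord2_neq i))].
have [d ed] : exists d : nat, a j = - (d%:Z).
  have := ha j (rev_ord2_neq i); case: (a j) => [[|n]|n] // _; first by exists 0%N.
  by exists n.+1; rewrite NegzE.
have Q0 : ev x q != 0 by apply: ev_neq0l hxy _ _.
have e2 : ev2 x y (rev_at (map_poly polyC p) q) = y ^+ (size p).-1 * ev (ev x q / y) p.
  rewrite /ev2 (horner_rev_at _ _ _ y0) size_map_polyC; congr (_ * _).
  rewrite /ev; congr (_.[_]); rewrite -map_poly_comp; apply: eq_map_poly => c /=.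
  by rewrite evC.
rewrite /= (hat_at2 _ _ ep) /subst eqxx epoly_valj ed.
have -> : (ev x q / y) ^ (- d%:Z) * ev (ev x q / y) p =
  ev2 x y (rev_at (map_poly polyC p) q) * y ^+ d / (ev x q ^+ d * y ^+ (size p).-1).
  rewrite e2 -exprnN expr_div_n.
  exact: (divf_split _ (expf_neq0 _ Q0) (expf_neq0 _ y0) (expf_neq0 _ y0)).
move=> [/(laurent_ev2 i)[w [m [n ew]]] nd]; exists d; split => //.
exists w, m, n; rewrite exprD.
exact: (divf_mulr_cancel (expf_neq0 m x0) (expf_neq0 n y0) (expf_neq0 d Q0) (expf_neq0 _ y0) ew).
Qed.

(* Comparing the terms of lowest degree of p in the Laurent condition shows that
   q^d divides p(0) x^m; as q(0) is not zero, q^d must be constant. *)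
Lemma hat_exponents_involves a : hat_exponents s i a -> (1 < size q)%N -> a j = 0.
Proof.
move=> /hat_exponents2[d [-> [w [m [n e]]] _]] sq.
have {e} : rev_at (map_poly polyC p) q * ('X^m)%:P * 'X^(n + d) =
           w * (q ^+ d)%:P * 'X^((size p).-1).
  apply: (ev2_inj hxy); rewrite !rmorphM /= !rmorphXn /= !ev2X !ev2C evX.
  exact: e.
(* In this degree in y the reversed polynomial contributes its top coefficient p(0), and the
   equation becomes p(0) x^m = w_(n+d) q^d. *)
move/(congr1 (fun w : {poly {poly S}} => w`_((size p).-1 + (n + d)))).
rewrite !coefMXn !ltnNge leq_addl leq_addr /= addnK addKn !coefMC.
rewrite coef_poly size_map_polyC subnn expr0 mulr1 coef_map /=.
have -> : ((size p).-1 < size p)%N by rewrite ltn_predL size_poly_gt0.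
case: d => [|d] // e.
have := @mul_monomial_size1 _ (q ^+ d.+1) w`_(n + d.+1) p`_0 m.
have -> : (q ^+ d.+1)`_0 != 0 by rewrite -horner_coef0 horner_exp horner_coef0 expf_neq0.
rewrite [q ^+ _ * _]mulrC -e mul_polyC => /(_ isT p00 erefl).
move/(congr1 predn); rewrite size_exp /= => /eqP; rewrite muln_eq0 orbF.
by case: (size q) sq => [|[]].
Qed.

(** For constant q = c, being Laurent says that c^d divides every coefficient of the reversed
    polynomial, and not being divisible by c excludes c^(d+1). *)
Lemma hat_exponents_const a c : hat_exponents s i a -> q = c%:P ->
  exists2 d : nat, a j = - d%:Z & content_exp p c d.
Proof.
move=> /hat_exponents2[d [-> [w [m [n e]]] nd]] qc; exists d => //.
have erev : rev_at (map_poly polyC p) q = map_poly polyC (rev_at p c).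
  apply/polyP => k; rewrite coef_map [LHS]coef_poly [in RHS]coef_poly size_map_polyC qc.
  by case: ifP => _; rewrite ?rmorph0 // coef_map /= rmorphM rmorphXn.
split.
- apply: dvd_coefs_scale => k.
  have {e} : rev_at (map_poly polyC p) q * ('X^m)%:P * 'X^(n + d) =
           w * 'X^((size p).-1) * (q ^+ d)%:P.
    apply: (ev2_inj hxy); rewrite !rmorphM /= !rmorphXn /= !ev2X !ev2C evX.
    by rewrite e mulrAC.
  (* The coefficient of y^(n+d+k) x^m isolates the k-th coefficient of the reversed polynomial. *)
  move/(congr1 (fun w : {poly {poly S}} => w`_(n + d + k)`_m)).
  rewrite coefMXn ltnNge leq_addr /= addKn !coefMC erev coef_map /= qc.
  rewrite mul_polyC coefZ coefXn eqxx mulr1 -rmorphXn /= coefMC => ->.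
  by exists (w * 'X^((size p).-1))`_(n + d + k)`_m.
- move=> [h eh]; apply: nd; rewrite erev ev2_map eh qc evC evZ rmorphXn.
  have c0 : cst c != 0.
    by apply: (cst_neq0 hxy); apply: contraNneq q00; rewrite qc coefC eqxx => ->.
  exists (ev y (h * 'X^d) / y ^+ (size p).-1); first exact: ev_laurent.
  rewrite rmorphM /= rmorphXn /= evX exprSr.
  exact: (divf_common _ _ c0 (expf_neq0 d c0) (expf_neq0 _ y0)).
Qed.

Lemma hat_at_cvar a d : a j = - d%:Z -> hat_at s i a (cvar s) = ev y p / y ^+ d.
Proof. by move=> ea; rewrite (hat_at2 _ _ ep) ea -exprnN mulrC. Qed.

Variable t : labeled_seed S 2.
Hypothesis st : labeled_mutation i s t.
Local Notation z := (cvar t i).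

Let hzy : indep z y.
Proof.
case: st => a [_ _ cy _ _]; rewrite -(cy _ (rev_ord2_neq i)).
exact: labeled_indep.
Qed.

Lemma mutation_epoly_i : epoly t i = inj j p.
Proof.
case: st => a [_ _ cy eti _]; have [p' ep' _] := epoly_inj t i.
have e : ev y p' = ev y p.
  by rewrite -epoly_vali -eti /epoly_val ep' eval_inj (cy _ (rev_ord2_neq i)).
by rewrite ep' (ev_injr hzy e).
Qed.

Lemma mutation_const c : q = c%:P -> exists d u,
  [/\ content_exp p c d, u \is a GRing.unit, hat_exponents s i (fun _ => - d%:Z),
      z = ev y p / y ^+ d / x & epoly t j = inj i (u *: q)].
Proof.
move=> qc; case: (st) => a [ha ez cy _ /(_ j (rev_ord2_neq i))].
have [d ed cd] := hat_exponents_const ha qc.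
have szc : (1 < size c%:P)%N = false by rewrite size_polyC; case: (c == 0).
rewrite eq_ involves_inj qc szc /= => -[u uu eu].
exists d, u; split => //.
- case: ha => h1 h2; split; first by move=> k _; rewrite -ed; apply: h1; exact: rev_ord2_neq.
  move=> k hk; have := h2 k hk; move: hk; rewrite ord2_other => /eqP ->.
  by rewrite /= !(hat_at2 _ _ ep) ed.
- by rewrite ez (hat_at_cvar ed).
- have [q' eq' _] := epoly_inj t j; rewrite rev_ordK in eq'.
  rewrite eq'; congr (inj i _); apply: (ev_injl hzy).
  rewrite evZ evC.
  move: eu; rewrite epoly_valj qc evC => <-.
  by rewrite /epoly_val eq' eval_inj.
Qed.

(** G_j = q(p(0) / z) is the reversed polynomial divided by z^(deg q), what is removed from it is a
    constant, and the monomial M is a power of z up to a unit. So the new polynomial and the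
    reversed one agree up to a constant and a power of z. *)
Lemma mutation_involves : (1 < size q)%N -> exists q' r,
  [/\ z = ev y p / x, r != 0, r *: q' = rev_at q p`_0, epoly t j = inj i q' &
      hat_exponents s i (fun _ => 0)].
Proof.
move=> sq; case: (st) => a [ha ez cy _ /(_ j (rev_ord2_neq i))].
have ea := hat_exponents_involves ha sq.
rewrite eq_ involves_inj sq /=.
rewrite (hat_at2 _ _ ep) ea /subst eqxx expr0z mul1r.
have -> : ev 0 p = cst p`_0.
  by rewrite /ev horner_coef0 coef_map.
rewrite eval_inj eqxx => -[H [[_ [rs hrs eG] _] [u [b [uu eu]]]]].
have [q' eq' gq'] := epoly_inj t j; rewrite rev_ordK in eq'.
have z0 : z != 0 by apply: indep_neq0l hzy.
(* The removed irreducibles involve neither of the two variables, so their product lies in S. *)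
have [c c0 ec] : exists2 c, c != 0 & \prod_(f <- rs) f = cst c.
  elim: rs hrs {eG} => [|f rs IH] hrs.
    by exists 1; rewrite ?oner_neq0 // big_nil rmorph1.
  have [|c c0 ec] := IH; first by move=> g hg; apply: hrs; rewrite inE hg orbT.
  have [g [gi gj irg _ [ef _]]] := hrs f (mem_head _ _).
  have [g1 eg1] := not_involves_inj gi.
  move: gj; rewrite eg1 involves_inj -leqNgt => /size1_polyC eg2.
  exists (g1`_0 * c); last by rewrite big_cons ec ef eg1 eval_inj eg2 evC coefC eqxx rmorphM.
  rewrite mulf_neq0 //; apply: contraTneq (irreducible_neq0 irg) => g10.
  by rewrite eg1 eg2 g10 rmorph0 eqxx.
move: eu; rewrite big_ord2_neq rev_ordK.
rewrite /epoly_val eq' eval_inj => eu.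
have u0 : u != 0 by apply: contraTneq uu => ->; rewrite unitr0.
have key : ev z (c *: q') = z ^ (b i - ((size q).-1)%:Z) * ev z (u *: rev_at q p`_0).
  rewrite !evZ (ev_rev_at _ _ z0) (expfzDr _ _ z0) -exprnN eu.
  rewrite eG ec; exact: (mulf_shift _ _ _ _ (expf_neq0 (size q).-1 z0)).
have rev0 : (u *: rev_at q p`_0)`_0 != 0.
  rewrite coefZ coef_poly size_poly_gt0 qn0 subn0.
  rewrite !mulf_neq0 ?expf_neq0 //.
  by rewrite -lead_coefE lead_coef_eq0.
have q'0 : (c *: q')`_0 != 0 by rewrite coefZ mulf_neq0 //; case: gq'.
(* Both polynomials have a nonzero constant term, which excludes positive and negative powers of z
   alike. *)
have key2 : c *: q' = u *: rev_at q p`_0.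
  move: key; case: (b i - _) => n key.
    case: n key => [|n] key; first by apply: (ev_injl hzy); rewrite key expr0z mul1r.
    case/eqP: q'0; have -> : c *: q' = u *: rev_at q p`_0 * 'X^(n.+1).
      by apply: (ev_injl hzy); rewrite key rmorphM rmorphXn /= evX mulrC.
    by rewrite coefMXn.
  case/eqP: rev0; have -> : u *: rev_at q p`_0 = c *: q' * 'X^(n.+1).
    apply: (ev_injl hzy); rewrite rmorphM rmorphXn /= evX key NegzE -exprnN.
    by rewrite [RHS]mulrC (mulVKf (expf_neq0 n.+1 z0)).
  by rewrite coefMXn.
exists q', (u^-1 * c); split => //.
- by rewrite ez (hat_at_cvar (d := 0)) // expr0 divr1.
- by rewrite mulf_neq0 // invr_eq0.
- by rewrite -scalerA key2 scalerA mulVr // scale1r.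
- case: ha => h1 h2; split => // k hk; have := h2 k hk; move: hk.
  rewrite ord2_other => /eqP ->.
  by rewrite /= !(hat_at2 _ _ ep) ea.
Qed.

End Step.

End LabeledMutation.

(** * Seeds as sets of pairs *)

Section Relabel.

Definition swap_vars (R : comNzRingType) (p : {mpoly R[2]}) : {mpoly R[2]} :=
  mmap (@mpolyC 2 R) (fun k => 'X_(rev_ord k)) p.
Arguments swap_vars : simpl never.
HB.instance Definition _ (R : comNzRingType) :=
  GRing.RMorphism.copy (@swap_vars R) (mmap (@mpolyC 2 R) (fun k => 'X_(rev_ord k))).

Lemma swap_varsC (R : comNzRingType) (c : R) : swap_vars c%:MP = c%:MP.
Proof. exact: mmapC. Qed.

Lemma swap_varsX (R : comNzRingType) k : swap_vars ('X_k : {mpoly R[2]}) = 'X_(rev_ord k).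
Proof. by rewrite /swap_vars mmapX mmap1U. Qed.

Lemma swap_varsK (R : comNzRingType) : involutive (@swap_vars R).
Proof.
move=> p; pose f : {rmorphism {mpoly R[2]} -> {mpoly R[2]}} := @swap_vars R \o @swap_vars R.
apply: (mpoly_rmorph_ext (f := f) (g := idfun)) => [a|i] /=.
  by rewrite !swap_varsC.
by rewrite !swap_varsX rev_ordK.
Qed.

Lemma mmap_swap (R C : comNzRingType) (f : {rmorphism R -> C}) (v : 'I_2 -> C) p :
  mmap f (v \o @rev_ord 2) p = mmap f v (swap_vars p).
Proof.
pose g : {rmorphism {mpoly R[2]} -> C} := mmap f v \o @swap_vars R.
apply: (mpoly_rmorph_ext (f := mmap f (v \o @rev_ord 2)) (g := g)) => [a|i].
  exact: (etrans (mmapC _ f a) (esym (etrans (congr1 _ (swap_varsC a)) (mmapC v f a)))).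
have mmX (w : 'I_2 -> C) k : mmap f w 'X_k = w k by rewrite mmapX; exact: mmap1U.
apply: etrans (mmX _ _) _; rewrite /= swap_varsX.
exact: (esym (mmX v _)).
Qed.

Lemma swap_vars_irreducible (R : idomainType) (p : {mpoly R[2]}) :
  irreducible_elt p -> irreducible_elt (swap_vars p).
Proof.
have un (q : {mpoly R[2]}) : swap_vars q \is a GRing.unit -> q \is a GRing.unit.
  by move=> h; rewrite -[q]swap_varsK; apply: rmorph_unit.
move=> [p0 pu ir]; split.
- by apply: contraNneq p0 => e; rewrite -[p]swap_varsK e rmorph0.
- by apply: contraNN pu => /un.
- move=> b c e; have [] := ir (swap_vars b) (swap_vars c).
  + by rewrite -rmorphM /= -e swap_varsK.
  + by move/un; left.
  + by move/un; right.
Qed.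

Variable S : idomainType.
Local Notation F := (ambient S 2).
Local Notation cst := (cst S 2).
Local Notation ev := (ev cst).
Local Notation ev2 := (ev2 cst).
Local Notation indep := (indep cst).

Lemma inj_not_involves j (p : {poly S}) : ~~ involves (inj j p) (rev_ord j).
Proof.
apply/hasPn => m; rewrite mcoeff_msupp negbK -{1}[p]coefK poly_def rmorph_sum raddf_sum /=.
apply: contraNT => mj; rewrite big1 // => k _.
rewrite injZ rmorphXn /= injX mcoeffCM mpolyXn mcoeffX.
case: eqP => [e|]; last by rewrite mulr0.
by move: mj; rewrite -e mulmnE mnm1E [j == _]eq_sym (negPf (rev_ord2_neq j)) mul0n eqxx.
Qed.

Lemma swap_vars_inj j (p : {poly S}) : swap_vars (inj j p) = inj (rev_ord j) p.
Proof.
pose f : {rmorphism {poly S} -> {mpoly S[2]}} := @swap_vars S \o inj j.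
apply: (poly_rmorph_ext (f := f)) => [a|] /=; first by rewrite !injC swap_varsC.
by rewrite !injX swap_varsX.
Qed.

Lemma swap_transcendence_basis (v : 'I_2 -> F) :
  transcendence_basis v -> transcendence_basis (v \o @rev_ord 2).
Proof.
move=> [ai tr].
have e p : feval (v \o @rev_ord 2) (swap_vars p) = feval v p.
  exact: (etrans (mmap_swap (fcst S 2) v (swap_vars p)) (congr1 _ (swap_varsK p))).
split=> [p|f].
  by rewrite /feval mmap_swap => /ai h; rewrite -[p]swap_varsK h rmorph0.
have [p [p0 hp rp]] := tr f; exists p; split => // k.
have [a [b [hb hab]]] := hp k.
exists (swap_vars a), (swap_vars b).
split.
  exact: (eq_ind_r (fun u => u != 0) hb (e b)).
exact: (etrans hab (esym (f_equal2 (fun u w => u / w) (e a) (e b)))).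
Qed.

(** [equivalent] compares two labelled seeds index by index, but an unlabelled seed does not fix an
    indexing; exchanging the two labels makes the indexings agree. *)
Lemma relabel (s : labeled_seed S 2) : exists s' : labeled_seed S 2,
  [/\ unlabel s' = unlabel s, forall k, cvar s' k = cvar s (rev_ord k) &
      forall k p, epoly s (rev_ord k) = inj k p -> epoly s' k = inj (rev_ord k) p].
Proof.
have h1 := swap_transcendence_basis (cvar_basis s).
have h2 i := swap_vars_irreducible (epoly_irreducible s (rev_ord i)).
have h3 i : variable_free (swap_vars (epoly s (rev_ord i))).
  move=> j [c ec]; apply: (@epoly_variable_free _ _ s (rev_ord i) (rev_ord j)).
  by exists (swap_vars c); rewrite -[epoly _ _]swap_varsK ec rmorphM /= swap_varsX.
have h4 i : ~~ involves (swap_vars (epoly s (rev_ord i))) i.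
  have [p -> _] := epoly_inj s (rev_ord i).
  rewrite rev_ordK swap_vars_inj -{2}[i]rev_ordK; exact: inj_not_involves.
pose s' := LabeledSeed h1 h2 h3 h4.
have e3 k p : epoly s (rev_ord k) = inj k p -> epoly s' k = inj (rev_ord k) p.
  by move=> e; rewrite /= e swap_vars_inj.
exists s'; split => //.
have ev_ k : epoly_val s' k = epoly_val s (rev_ord k).
  have [p e _] := epoly_inj s (rev_ord k); rewrite rev_ordK in e.
  by rewrite /epoly_val (e3 _ _ e) e !eval_inj /= rev_ordK.
rewrite (unlabel2 s' ord0) (unlabel2 s ord0) !ev_ /= rev_ordK.
exact: fsetUC.
Qed.

End Relabel.

Lemma fset2_eq (T : choiceType) (a b c d : T) :
  [fset a; b]%fset = [fset c; d]%fset -> a != b ->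
  (a = c /\ b = d) \/ (a = d /\ b = c).
Proof.
move=> e ab.
have : a \in [fset c; d]%fset by rewrite -e in_fset2 eqxx.
have : b \in [fset c; d]%fset by rewrite -e in_fset2 eqxx orbT.
rewrite !in_fset2 => /orP[]/eqP eb /orP[]/eqP ea; subst; try by rewrite eqxx in ab.
  by right.
by left.
Qed.

(** * Unordered seeds with a chosen order of the cluster *)

Section SeedData.

Variable S : idomainType.
Local Notation F := (ambient S 2).
Local Notation cst := (cst S 2).
Local Notation ev := (ev cst).
Local Notation ev2 := (ev2 cst).
Local Notation indep := (indep cst).
Implicit Types (X Y : {fset F * F}) (x y z : F) (p q : {poly S}).

(** The order of the arguments is crosswise: p belongs to x and is a polynomial in y, q belongs to y
    and is a polynomial in x. *)
Definition seed_data X x y p q : Prop :=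
  exists (s : labeled_seed S 2) i, [/\ X = unlabel s, x = cvar s i, y = cvar s (rev_ord i),
    epoly s i = inj (rev_ord i) p & epoly s (rev_ord i) = inj i q].

Lemma is_seed_data X : is_seed X -> exists x y p q, seed_data X x y p q.
Proof.
move=> [s ->]; have [p ep _] := epoly_inj s ord0.
have [q eq_ _] := epoly_inj s (rev_ord ord0); rewrite rev_ordK in eq_.
by exists (cvar s ord0), (cvar s (rev_ord ord0)), p, q, s, ord0.
Qed.

Lemma seed_data_sym X x y p q : seed_data X x y p q -> seed_data X y x q p.
Proof. by move=> [s [i [-> -> -> ep eq_]]]; exists s, (rev_ord i); rewrite rev_ordK. Qed.

Lemma seed_data_indep X x y p q : seed_data X x y p q -> indep x y.
Proof. by move=> [s [i [_ -> -> _ _]]]; exact: labeled_indep. Qed.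

Lemma seed_data_poly X x y p q : seed_data X x y p q -> exchange_poly p.
Proof.
move=> [s [i [_ _ _ ep _]]]; apply: (exchange_poly_inj (j := rev_ord i)); rewrite -ep.
  exact: epoly_irreducible.
exact: epoly_variable_free.
Qed.

Lemma seed_data_set X x y p q : seed_data X x y p q ->
  X = [fset (x, ev y p); (y, ev x q)]%fset.
Proof.
move=> [s [i [-> -> -> ep eq_]]]; rewrite (unlabel2 s i).
by rewrite (epoly_vali ep) (epoly_valj eq_).
Qed.

Lemma seed_data_cluster X x y p q v : seed_data X x y p q ->
  (v \in cluster X) = (v == x) || (v == y).
Proof.
move/seed_data_set => ->; apply/imfsetP/orP => /=.
  move=> [u]; rewrite in_fset2 => /orP[]/eqP -> -> /=; [left|right]; exact: eqxx.
case=> /eqP ->; [exists (x, ev y p)|exists (y, ev x q)] => //.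
  exact: fset21.
exact: fset22.
Qed.

Lemma seed_data_neq X x y p q : seed_data X x y p q -> x <> y.
Proof.
move/seed_data_indep => hxy e; apply: (indep_not_cstM hxy (u := 1)).
by rewrite rmorph1 mul1r.
Qed.

Lemma seed_data_eq X x y p q x' y' p' q' :
  seed_data X x y p q -> seed_data X x' y' p' q' ->
  [/\ x = x', y = y', p = p' & q = q'] \/ [/\ x = y', y = x', p = q' & q = p'].
Proof.
move=> h h'; have hn := seed_data_neq h.
have e := etrans (esym (seed_data_set h)) (seed_data_set h').
have hn' : (x, ev y p) != (y, ev x q) by apply/eqP => -[/hn].
have hi := seed_data_indep h'.
case: (fset2_eq e hn') => [[[ex ep] [ey eq_]]|[[ex ep] [ey eq_]]]; [left|right]; subst.
  by split; [exact: erefl|exact: erefl|exact: ev_injr hi _ _ ep|exact: ev_injl hi _ _ eq_].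
by split; [exact: erefl|exact: erefl|exact: ev_injl hi _ _ ep|exact: ev_injr hi _ _ eq_].
Qed.

Lemma equivalent_data X Y x y p q x' y' p' q' :
  seed_data X x y p q -> seed_data Y x' y' p' q' ->
  propto x x' -> propto y y' -> propto (ev y p) (ev y' p') ->
  propto (ev x q) (ev x' q') -> equivalent X Y.
Proof.
move=> [s [i [-> -> -> ep eq_]]] [t [j [-> -> -> ep' eq_']]] hx hy hp hq.
have key (t' : labeled_seed S 2) : unlabel t' = unlabel t ->
    cvar t' i = cvar t j -> cvar t' (rev_ord i) = cvar t (rev_ord j) ->
    epoly t' i = inj (rev_ord i) p' -> epoly t' (rev_ord i) = inj i q' ->
    equivalent (unlabel s) (unlabel t).
  move=> e1 e2 e3 e4 e5; exists s, t'; split; [exact: erefl|exact: (esym e1)|move=> k].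
  have [->|] := eqVneq k i; last rewrite ord2_other => /eqP ->.
    by rewrite e2 (epoly_vali ep) (epoly_vali e4) e3; split; [exact: hx|exact: hp].
  by rewrite e3 (epoly_valj eq_) (epoly_valj e5) e2; split; [exact: hy|exact: hq].
have [eji|] := eqVneq j i; first by subst; exact: (key t).
rewrite ord2_other => /eqP eji; subst.
have [t' [e1 e2 e3]] := relabel t.
rewrite rev_ordK in ep'.
apply: (key t' e1).
- exact: e2.
- exact: e2.
- exact: e3.
- by have := e3 _ _ eq_'; rewrite rev_ordK.
Qed.

Lemma mutation_data X x y p q Y : seed_data X x y p q -> mutation X x Y ->
  exists s t i, [/\ X = unlabel s, Y = unlabel t, [/\ x = cvar s i & y = cvar s (rev_ord i)],
    epoly s i = inj (rev_ord i) p /\ epoly s (rev_ord i) = inj i q &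
    labeled_mutation i s t].
Proof.
move=> h [s [t [i [eX eY ex m]]]]; exists s, t, i.
have [p' ep' _] := epoly_inj s i.
have [q' eq_' _] := epoly_inj s (rev_ord i); rewrite rev_ordK in eq_'.
have h' : seed_data X x (cvar s (rev_ord i)) p' q' by exists s, i; split.
case: (seed_data_eq h h') => [[_ ey ep eq_]|[e1 e2 _ _]]; last first.
  by case: (seed_data_neq h (esym e2)).
by split; [exact: eX|exact: eY|split|rewrite ep eq_; split|exact: m].
Qed.

Lemma mutation_data_const X x y p q Y c : seed_data X x y p q ->
  mutation X x Y -> q = c%:P ->
  exists d u, [/\ content_exp p c d, u \is a GRing.unit,
    seed_data Y (ev y p / y ^+ d / x) y p (u *: q) &
    exchange_laurent X x (ev y p / y ^+ d)].
Proof.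
move=> h m qc; have gp := seed_data_poly h; have gq := seed_data_poly (seed_data_sym h).
have [s [t [i [-> -> [ex ey] [ep eq_] st]]]] := mutation_data h m.
have [d [u [h1 h2 h3 h4 h5]]] := mutation_const ep eq_ gq st qc.
rewrite ex ey; exists d, u; split=> //.
  exists t, i; split; [exact: erefl|exact: (esym h4)| |exact: (mutation_epoly_i ep st)|exact: h5].
  by case: st => a [_ _ cy _ _]; rewrite (cy _ (rev_ord2_neq i)).
exists s, i, (fun _ => - d%:Z); split; [exact: erefl|exact: erefl|exact: h3|].
by rewrite (hat_at_cvar ep (d := d)).
Qed.

Lemma mutation_data_involves X x y p q Y : seed_data X x y p q ->
  mutation X x Y -> (1 < size q)%N ->
  exists q' r, [/\ r != 0, r *: q' = rev_at q p`_0,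
    seed_data Y (ev y p / x) y p q' & exchange_laurent X x (ev y p)].
Proof.
move=> h m sq; have gp := seed_data_poly h; have gq := seed_data_poly (seed_data_sym h).
have [s [t [i [-> -> [ex ey] [ep eq_] st]]]] := mutation_data h m.
have [q' [r [h1 h2 h3 h4 h5]]] := mutation_involves ep eq_ gp gq st sq.
rewrite ex ey; exists q', r; split=> //.
  exists t, i; split; [exact: erefl|exact: (esym h1)| |exact: (mutation_epoly_i ep st)|exact: h4].
  by case: st => a [_ _ cy _ _]; rewrite (cy _ (rev_ord2_neq i)).
exists s, i, (fun _ => 0); split; [exact: erefl|exact: erefl|exact: h5|].
by rewrite (hat_at_cvar ep (d := 0)) // expr0 divr1.
Qed.

End SeedData.

(** * Exchange systems *)

Section RevAt.

Variable R : idomainType.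
Implicit Types (p q : {poly R}) (c : R).

Lemma coef_rev_at p c k : (k < size p)%N ->
  (rev_at p c)`_k = p`_((size p).-1 - k) * c ^+ ((size p).-1 - k).
Proof. by move=> h; rewrite coef_poly h. Qed.

Lemma size_rev_at p c : p`_0 != 0 -> size (rev_at p c) = size p.
Proof. by move=> p0; apply: size_poly_eq; rewrite subnn expr0 mulr1. Qed.

Lemma rev_atZ r p c : r != 0 -> rev_at (r *: p) c = r *: rev_at p c.
Proof.
move=> r0; apply/polyP => k; rewrite coefZ !coef_poly size_scale //.
by case: ifP; rewrite ?mulr0 // coefZ mulrA.
Qed.

Lemma rev_atK p c : p`_0 != 0 -> rev_at (rev_at p c) c = c ^+ (size p).-1 *: p.
Proof.
move=> p0; apply/polyP => k; rewrite coefZ.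
have [h|h] := ltnP k (size p); last by rewrite !nth_default ?mulr0 // (leq_trans (size_poly _ _)) // size_rev_at.
rewrite coef_rev_at size_rev_at // coef_rev_at; last by lia.
rewrite subKn; last by lia.
by rewrite -mulrA -exprD mulrC; congr (c ^+ _ * _); lia.
Qed.

Lemma rev_at_mul p c u k : (rev_at p (u * c))`_k = u ^+ ((size p).-1 - k) * (rev_at p c)`_k.
Proof. by rewrite !coef_poly; case: ifP => _; rewrite ?mulr0 // exprMn; ring. Qed.

Lemma rev_at_const a c : rev_at a%:P c = a%:P.
Proof.
have [->|a0] := eqVneq a 0.
  by rewrite polyC0; apply/polyP => k; rewrite coef_poly !coef0 mul0r; case: ifP.
apply/polyP => k; rewrite coef_poly [RHS]coefC size_polyC a0 /= ltnS leqn0.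
by have [->|//] := eqVneq k 0%N; rewrite subnn coefC mulr1.
Qed.

End RevAt.

Section ContentExp.

Variable S : idomainType.
Implicit Types (p : {poly S}) (c u : S).

Lemma content_exp_le p c u d e : u \is a GRing.unit -> c != 0 ->
  content_exp p c d -> content_exp p (u * c) e -> (e <= d)%N.
Proof.
move=> uu c0 [_ h] [[g eg] _]; rewrite leqNgt; apply/negP => de; apply: h.
apply: dvd_coefs_scale => k.
have /polyP/(_ k) := eg; rewrite rev_at_mul coefZ => ek.
apply: (divides_unitl (u := u ^+ ((size p).-1 - k))); first by rewrite unitrX.
rewrite ek exprMn; have -> : c ^+ e = c ^+ (e - d.+1) * c ^+ d.+1 by rewrite -exprD subnK.
exists (u ^+ e * c ^+ (e - d.+1) * g`_k); ring.
Qed.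

Lemma content_exp_uniq p c u d e : u \is a GRing.unit -> c != 0 ->
  content_exp p c d -> content_exp p (u * c) e -> e = d.
Proof.
move=> uu c0 hd he; apply/eqP; rewrite eqn_leq (content_exp_le uu c0 hd he).
apply: (content_exp_le (u := u^-1) (c := u * c)) he _; rewrite ?unitrV // ?mulKr //.
by rewrite mulf_neq0 //; apply: contraTneq uu => ->; rewrite unitr0.
Qed.

(** Reversal fixes constants, and a is a unit times c, so exactly the first power of c divides
    it. *)
Lemma content_exp_const_assoc a c d : irreducible_elt a -> irreducible_elt c ->
  divides c a -> content_exp a%:P c d -> d = 1%N.
Proof.
move=> ia ic [b eb] [[h eh] nh]; rewrite rev_at_const in eh nh.
case: d eh nh => [|[|d]] // eh nh.
  by case: nh; exists b%:P; rewrite expr1 -mul_polyC -polyCM eb mulrC.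
case: (irreducible_ndvd1 ic).
have /polyP/(_ 0%N) := eh; rewrite coefC coefZ eqxx eb => e.
have [u uu eu] := irreducible_dvd_assoc ic ia (ex_intro _ b eb).
have c0 := irreducible_neq0 ic.
apply: (divides_unitl uu); rewrite mulr1.
have -> : u = b by apply: (mulIf c0); rewrite -eu eb.
exists (c ^+ d * h`_0); apply: (mulIf c0); rewrite e !exprS; ring.
Qed.

Lemma content_exp_const0 a c d : irreducible_elt a -> ~ divides c a ->
  content_exp a%:P c d -> d = 0%N.
Proof.
move=> ia nd [[h eh] _]; rewrite rev_at_const in eh; case: d eh => // d eh.
have /polyP/(_ 0%N) := eh; rewrite coefC coefZ eqxx exprS => e.
by case: nd; exists (c ^+ d * h`_0); rewrite e; ring.
Qed.

End ContentExp.

(* The rank two LP algebras enter the classification only through these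
   properties, with [T] the type of unlabelled seeds. *)
Record exchange_system (S : idomainType) (K : fieldType)
    (cst : {rmorphism S -> K}) (T : eqType) := ExchangeSystem {
  seed : T -> Prop;
  mut : T -> K -> T;
  data : T -> K -> K -> {poly S} -> {poly S} -> Prop;
  laurent_exchange : T -> K -> K -> Prop;
  seed_inhabited : exists X, seed X;
  seed_finite : exists l : seq T, forall X, seed X -> X \in l;
  seed_ind : forall P : T -> Prop, (exists2 X, seed X & P X) ->
    (forall X x y p q, seed X -> data X x y p q -> (P X <-> P (mut X x))) ->
    forall X, seed X -> P X;
  seed_has_data : forall X, seed X -> exists x y p q, data X x y p q;
  seed_mut : forall X x y p q, seed X -> data X x y p q -> seed (mut X x);
  data_sym : forall X x y p q, data X x y p q -> data X y x q p;
  data_indep : forall X x y p q, data X x y p q -> indep cst x y;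
  data_poly : forall X x y p q, data X x y p q -> exchange_poly p;
  data_uniq : forall X x y p q x' y' p' q', data X x y p q -> data X x' y' p' q' ->
    [/\ x = x', y = y', p = p' & q = q'] \/ [/\ x = y', y = x', p = q' & q = p'];
  data_equiv : forall X Y x y p q x' y' p' q' u v a b, seed X -> seed Y ->
    data X x y p q -> data Y x' y' p' q' ->
    u \is a GRing.unit -> v \is a GRing.unit -> a \is a GRing.unit -> b \is a GRing.unit ->
    x = cst u * x' -> y = cst v * y' -> ev cst y p = cst a * ev cst y' p' ->
    ev cst x q = cst b * ev cst x' q' -> X = Y;
  mut_const : forall X x y p q c, seed X -> data X x y p q -> q = c%:P ->
    exists d u, [/\ content_exp p c d, u \is a GRing.unit,
      data (mut X x) (ev cst y p / y ^+ d / x) y p (u *: q) &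
      laurent_exchange X x (ev cst y p / y ^+ d)];
  mut_involves : forall X x y p q, seed X -> data X x y p q -> (1 < size q)%N ->
    exists q' r, [/\ r != 0, r *: q' = rev_at q p`_0,
      data (mut X x) (ev cst y p / x) y p q' & laurent_exchange X x (ev cst y p)]
}.

Section System.

Variables (S : idomainType) (hS : ufd S) (K : fieldType) (cst : {rmorphism S -> K}).
Variables (T : eqType) (A : exchange_system cst T).
Local Notation ev := (ev cst).
Local Notation seed := (seed A).
Local Notation mut := (mut A).
Local Notation data := (data A).
Local Notation xl := (laurent_exchange A).
Implicit Types (X Y : T) (x y z : K) (p q : {poly S}) (a c u v : S).

Lemma cst_unit_neq0 u : u \is a GRing.unit -> cst u != 0.
Proof. by move=> uu; rewrite -unitfE; apply: rmorph_unit. Qed.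

Lemma unit_neq0 u : u \is a GRing.unit -> u != 0.
Proof. by apply: contraTneq => ->; rewrite unitr0. Qed.

Lemma data_cst_inj X x y p q : data X x y p q -> injective cst.
Proof. by move/data_indep/cst_inj. Qed.

Lemma data_neq0 X x y p q : data X x y p q -> (x != 0) * (y != 0).
Proof. by move/data_indep => h; rewrite (indep_neq0l h) (indep_neq0r h). Qed.

Lemma data_ev_neq0 X x y p q : data X x y p q -> (ev y p != 0) * (ev x q != 0).
Proof.
move=> h; have hi := data_indep h; have hp := data_poly h; have hq := data_poly (data_sym h).
split; [apply: (ev_neq0r hi)|apply: (ev_neq0l hi)].
  by case: hp => p0 _ _; apply: contraNneq p0 => ->; rewrite coef0.
by case: hq => p0 _ _; apply: contraNneq p0 => ->; rewrite coef0.
Qed.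

(** Normalization identifies the seeds, and a seed determines its data up to exchanging the
    variables, which is impossible as x' and y' are not proportional. Proportionality is thus
    sharpened to equality. *)
Lemma data_equiv_eq X Y x y p q x' y' p' q' u v a b : seed X -> seed Y ->
    data X x y p q -> data Y x' y' p' q' ->
    u \is a GRing.unit -> v \is a GRing.unit -> a \is a GRing.unit -> b \is a GRing.unit ->
    x = cst u * x' -> y = cst v * y' -> ev y p = cst a * ev y' p' ->
    ev x q = cst b * ev x' q' ->
  X = Y /\ [/\ x = x', y = y', p = p' & q = q'].
Proof.
move=> sX sY dX dY uu uv ua ub ex ey ep eq_.
have e := data_equiv sX sY dX dY uu uv ua ub ex ey ep eq_; subst Y; split=> //.
case: (data_uniq dX dY) => // -[e1 _ _ _].
have hi := data_indep (data_sym dY).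
by case: (indep_not_cstM hi (u := u)); rewrite -e1.
Qed.

(** Since p is kept, mutating twice returns x = p / (p / x). Reversing q twice with the same p(0)
    multiplies it by p(0)^(deg q); by primitivity the second mutation returns q up to a unit, and
    normalization returns the seed itself. *)
Lemma mut_involves_inv X x y p q : seed X -> data X x y p q -> (1 < size q)%N ->
  exists q' r, [/\ r != 0, r *: q' = rev_at q p`_0, size q' = size q,
      data (mut X x) (ev y p / x) y p q' &
      [/\ mut (mut X x) (ev y p / x) = X, xl X x (ev y p) &
          xl (mut X x) (ev y p / x) (ev y p)]].
Proof.
move=> sX d sq; have [q' [r [r0 er d' hx]]] := mut_involves sX d sq.
have [p0 _ _] := data_poly d; have [q0 hq _] := data_poly (data_sym d).
have sz : size q' = size q.
  by rewrite -(size_scale q' r0) er size_rev_at.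
have sX' := seed_mut sX d.
have sq' : (1 < size q')%N by rewrite sz.
have [q2 [r2 [r20 er2 d2 hx']]] := mut_involves sX' d' sq'.
have [_ hq2 _] := data_poly (data_sym d2).
have q2sz : size q2 = size q.
  have [q'0 _ _] := data_poly (data_sym d').
  by rewrite -(size_scale q2 r20) er2 size_rev_at.
have [] := @primitive_scale_eq _ hS (r * r2) (p`_0 ^+ (size q).-1) q2 q.
- by rewrite mulf_neq0.
- by rewrite expf_neq0.
- by apply: hq2; rewrite q2sz.
- exact: hq.
- by rewrite -scalerA er2 -rev_atZ // er rev_atK.
move=> u uu e2.
have exx : ev y p / (ev y p / x) = x.
  by have := data_neq0 d; have := data_ev_neq0 d => -[h1 _] [h2 _]; field; rewrite h1 h2.
rewrite exx in d2.
exists q', r; split => //; split => //.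
apply: (proj1 (@data_equiv_eq _ _ _ _ _ _ _ _ _ _ 1 1 1 u (seed_mut sX' d') sX d2 d _ _ _ _ _ _ _ _));
  rewrite ?unitr1 ?rmorph1 ?mul1r //.
by rewrite e2 evZ.
Qed.

(** The exponent d depends on c only up to a unit, so both mutations divide by the same y^d and the
    second one returns x. *)
Lemma mut_const_inv X x y p q c : seed X -> data X x y p q -> q = c%:P ->
  exists d u, [/\ content_exp p c d, u \is a GRing.unit,
      data (mut X x) (ev y p / y ^+ d / x) y p (u *: q),
      mut (mut X x) (ev y p / y ^+ d / x) = X &
      xl X x (ev y p / y ^+ d) /\ xl (mut X x) (ev y p / y ^+ d / x) (ev y p / y ^+ d)].
Proof.
move=> sX d qc; have [n [u [hn uu d' hx]]] := mut_const sX d qc.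
exists n, u.
have sX' := seed_mut sX d.
have qc' : u *: q = (u * c)%:P by rewrite qc -mul_polyC polyCM.
have [n' [u' [hn' uu' d2 hx']]] := mut_const sX' d' qc'.
have c0 : c != 0.
  by have [+ _ _] := data_poly (data_sym d); rewrite qc coefC eqxx.
have en := content_exp_uniq uu c0 hn hn'; subst n'.
have := data_neq0 d; have := data_ev_neq0 d => -[h1 _] [h2 h3].
have exx : ev y p / y ^+ n / (ev y p / y ^+ n / x) = x.
  by have := expf_neq0 n h3; set yn := y ^+ n => h4; field; rewrite h1 h2 h4.
rewrite exx in d2.
split => //.
apply: (proj1 (@data_equiv_eq _ _ _ _ _ _ _ _ _ _ 1 1 1 (u' * u) (seed_mut sX' d') sX d2 d _ _ _ _ _ _ _ _));
  rewrite ?unitr1 ?rmorph1 ?mul1r ?unitrM ?uu ?uu' //.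
by rewrite scalerA evZ.
Qed.

Lemma mut_inv X x y p q : seed X -> data X x y p q ->
  exists z q', data (mut X x) z y p q' /\ mut (mut X x) z = X.
Proof.
move=> sX d; have [sq|sq] := ltnP 1 (size q).
  have [q' [r [_ _ _ h1 [h2 _ _]]]] := mut_involves_inv sX d sq.
  by exists (ev y p / x), q'.
have [n [u [_ _ h1 h2 _]]] := mut_const_inv sX d (size1_polyC sq).
by exists (ev y p / y ^+ n / x), (u *: q).
Qed.

Definition neighbours_in (l : seq T) X : Prop :=
  exists x y p q, [/\ data X x y p q, mut X x \in l & mut X y \in l].

(** Mutation being involutive, X is itself a mutation of [mut X x]; closure of l under mutation
    therefore gives both directions required by [seed_ind]. *)
Lemma seed_list_closed (l : seq T) X0 : X0 \in l ->
  (forall X, X \in l -> seed X /\ neighbours_in l X) ->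
  forall X, seed X <-> X \in l.
Proof.
move=> X0l hl X; split; last by case/hl.
move: X; have [sX0 _] := hl _ X0l.
have step X x y p q : data X x y p q -> X \in l -> mut X x \in l.
  move=> d /hl[_ [x' [y' [p' [q' [d' m1 m2]]]]]].
  by case: (data_uniq d d') => -[-> _ _ _].
apply: (seed_ind (e := A)); first by exists X0.
move=> X x y p q sX d; split; first exact: step d.
by have [z [q' [d' {2}<-]]] := mut_inv sX d; exact: step d'.
Qed.

End System.

(** * Rank two LP algebras as exchange systems *)

Section LPSystem.

Variables (S : idomainType) (A : LP_algebra S 2).
Hypotheses (hnorm : normalized A) (hfin : finite_type A).
Local Notation F := (ambient S 2).
Local Notation cst := (cst S 2).

Lemma LP_mutation X x y p q : seeds A X -> seed_data X x y p q ->
  seeds A (mutate A X x) /\ mutation X x (mutate A X x).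
Proof.
move=> sX d; apply: seeds_mutate => //.
by rewrite (seed_data_cluster _ d) eqxx.
Qed.

(** Connecting paths may use mutations in either direction, so an invariant must be carried both
    forwards and backwards. *)
Lemma LP_seed_ind (P : {fset F * F} -> Prop) :
  (exists2 X, seeds A X & P X) ->
  (forall X x y p q, seeds A X -> seed_data X x y p q -> (P X <-> P (mutate A X x))) ->
  forall X, seeds A X -> P X.
Proof.
move=> [X0 sX0 PX0] step X sX.
have := seeds_connected sX0 sX.
suff h Y Z : clos_refl_sym_trans _
      (fun X1 X2 => seeds A X1 /\
         exists2 v, v \in cluster X1 & X2 = mutate A X1 v) Y Z -> P Y <-> P Z.
  by move/h => -[h1 _]; exact: h1.
elim=> {Y Z} [Y Z [sY [v vY ->]]|Y|Y Z _ [h1 h2]|Y Z W _ [h1 h2] _ [h3 h4]].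
- have [x [y [p [q d]]]] := is_seed_data (seeds_seed sY).
  move: vY; rewrite (seed_data_cluster _ d) => /orP[]/eqP ->.
    exact: step d.
  exact: step (seed_data_sym d).
- by split.
- by split.
- by split=> h; [apply/h3/h1|apply/h2/h4].
Qed.

Lemma LP_data_equiv X Y x y p q x' y' p' q' u v a b :
  seeds A X -> seeds A Y -> seed_data X x y p q -> seed_data Y x' y' p' q' ->
  u \is a GRing.unit -> v \is a GRing.unit -> a \is a GRing.unit -> b \is a GRing.unit ->
  x = cst u * x' -> y = cst v * y' -> ev cst y p = cst a * ev cst y' p' ->
  ev cst x q = cst b * ev cst x' q' -> X = Y.
Proof.
move=> sX sY dX dY uu uv ua ub ex ey ep eq_; apply: hnorm => //.
by apply: (equivalent_data dX dY); [exists u|exists v|exists a|exists b].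
Qed.

Lemma LP_mut_const X x y p q c : seeds A X -> seed_data X x y p q -> q = c%:P ->
  exists d u, [/\ content_exp p c d, u \is a GRing.unit,
    seed_data (mutate A X x) (ev cst y p / y ^+ d / x) y p (u *: q) &
    exchange_laurent X x (ev cst y p / y ^+ d)].
Proof. by move=> sX d; apply: mutation_data_const d (LP_mutation sX d).2. Qed.

Lemma LP_mut_involves X x y p q : seeds A X -> seed_data X x y p q -> (1 < size q)%N ->
  exists q' r, [/\ r != 0, r *: q' = rev_at q p`_0,
    seed_data (mutate A X x) (ev cst y p / x) y p q' & exchange_laurent X x (ev cst y p)].
Proof. by move=> sX d; apply: mutation_data_involves d (LP_mutation sX d).2. Qed.

Definition LP_exchange_system : exchange_system cst {fset F * F} :=
  @ExchangeSystem S F cst {fset F * F} (seeds A) (mutate A)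
    (@seed_data S) (@exchange_laurent S 2) (seeds_inhabited A) hfin LP_seed_ind
    (fun X sX => is_seed_data (seeds_seed sX))
    (fun X x y p q sX d => (LP_mutation sX d).1)
    (@seed_data_sym S) (@seed_data_indep S) (@seed_data_poly S) (@seed_data_eq S)
    LP_data_equiv LP_mut_const LP_mut_involves.

End LPSystem.

(** * Triangles and squares *)

Section ContentExpMore.

Variable S : idomainType.
Hypothesis hS : ufd S.
Implicit Types (p R : {poly S}) (c u r : S).

Lemma content_exp_unit p c u d : u \is a GRing.unit ->
  content_exp p c d -> content_exp p (u * c) d.
Proof.
move=> uu [[h eh] nh]; split.
  apply: dvd_coefs_scale => k; rewrite rev_at_mul exprMn.
  have -> : (rev_at p c)`_k = c ^+ d * h`_k by rewrite eh coefZ.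
  exists (u ^+ ((size p).-1 - k) * u^-1 ^+ d * h`_k).
  have : u^-1 ^+ d * u ^+ d = 1 by rewrite -exprMn mulVr // expr1n.
  set a := u^-1 ^+ d; set b := u ^+ d; set e := u ^+ _ => ab.
  by rewrite -[LHS]mul1r -ab; ring.
case=> g eg; apply: nh; apply: dvd_coefs_scale => k.
apply: (divides_unitl (u := u ^+ ((size p).-1 - k))); first by rewrite unitrX.
rewrite -rev_at_mul eg coefZ exprMn; exists (u ^+ d.+1 * g`_k); ring.
Qed.

(** This separates the square from the triangle: for an exchange polynomial p and an irreducible c
    it fails only if p is a constant associate to c. *)
Definition nonmultiple p c : Prop := ~ exists h, p = c *: h.

Lemma nonmultiple_exchange p c : irreducible_elt c -> exchange_poly p ->
  ((size p <= 1)%N -> ~ divides c p`_0) -> nonmultiple p c.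
Proof.
move=> ic [p0 hp _] hc [h eh]; have [sp|sp] := ltnP 1 (size p).
  apply: (hp sp c ic) => i; rewrite eh coefZ; exact/divides_mulr/divides_refl.
by apply: (hc sp); rewrite eh coefZ; exact/divides_mulr/divides_refl.
Qed.

(** In positive degree c^d is the whole content of the reversed polynomial: another prime in the
    content would divide every coefficient of p, and a further factor c contradicts the choice of d.
    The primitive R is then the quotient up to a unit. For constant p the exponent d is 0. *)
Lemma content_exp_rev p R c r d : irreducible_elt c ->
  exchange_poly p -> exchange_poly R -> nonmultiple p c ->
  content_exp p c d -> r != 0 -> r *: R = rev_at p c -> size R = size p ->
  exists2 u, u \is a GRing.unit & rev_at p c = (u * c ^+ d) *: R.
Proof.
move=> ic [p0 hp hp'] [_ hR hR'] nm hd r0 er sz; have c0 := irreducible_neq0 ic.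
have [[h eh] nh] := hd.
have [sp|sp] := ltnP 1 (size p); last first.
  have ep := size1_polyC sp.
  have ia := hp' sp.
  have na : ~ divides c p`_0.
    move=> [b eb]; apply: nm; exists b%:P.
    by rewrite {1}ep eb -mul_polyC -polyCM mulrC.
  have d0 : d = 0%N by apply: (content_exp_const0 ia na); rewrite -ep.
  exists r; last by rewrite d0 expr0 mulr1.
  have : r * R`_0 = p`_0 by rewrite -coefZ er {1}ep rev_at_const coefC eqxx.
  move=> e; have [_ _ /(_ _ _ (esym e))[]//] := ia.
  have iR : irreducible_elt R`_0 by apply: hR'; rewrite sz.
  by have := irreducible_nunit iR => /negPf ->.
have ph : primitive h.
  move=> f hf hk; have [fc|fc] := classic (divides f c).
    have [u uu ec] := irreducible_dvd_assoc hf ic fc.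
    apply: nh; rewrite eh.
    apply: dvd_coefs_scale => i; rewrite coefZ exprSr.
    have [b eb] := hk i; exists (b * u^-1); rewrite eb ec.
    have -> : b * u^-1 * ((u * f) ^+ d * (u * f)) = b * ((u * f) ^+ d * (u^-1 * u * f)) by ring.
    by rewrite mulVr //; ring.
  apply: (hp sp f hf) => i.
  have [hi|hi] := ltnP i (size p); last by rewrite nth_default //; exact: divides0.
  have := congr1 (fun w : {poly S} => w`_((size p).-1 - i)) eh.
  rewrite coef_rev_at; last by lia.
  rewrite subKn; last by lia.
  rewrite coefZ => e.
  have : divides f (p`_i * c ^+ i) by rewrite e; exact: divides_mull.
  case/(irreducible_prime hS hf) => // /(irreducible_prime_exp hS hf)//.
have [] := @primitive_scale_eq _ hS r (c ^+ d) R h => //.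
- by rewrite expf_neq0.
- by apply: hR; rewrite sz.
- by rewrite er eh.
move=> u uu eR; exists u^-1; rewrite ?unitrV //.
rewrite eh eR scalerA; congr (_ *: _).
by rewrite -mulrA mulrC -mulrA mulrV // mulr1.
Qed.

(** Reversing twice multiplies p by c^(deg p), so the exponents of p and R add up to deg p. If d
    exceeded deg p, then c would divide all of p. *)
Lemma content_exp_dual p R c u d : irreducible_elt c -> exchange_poly p ->
  nonmultiple p c -> u \is a GRing.unit -> size R = size p ->
  content_exp p c d -> rev_at p c = (u * c ^+ d) *: R ->
  (d <= (size p).-1)%N /\ content_exp R c ((size p).-1 - d).
Proof.
move=> ic [p0 _ _] nm uu sz [[h eh] _] eR; have c0 := irreducible_neq0 ic.
have dle : (d <= (size p).-1)%N.
  rewrite leqNgt; apply/negP => hd; apply: nm; apply: dvd_coefs_scale => i.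
  have [hi|hi] := ltnP i (size p); last by rewrite nth_default //; exact: divides0.
  have := congr1 (fun w : {poly S} => w`_((size p).-1 - i)) eh.
  rewrite coef_rev_at; last by lia.
  rewrite subKn; last by lia.
  rewrite coefZ => e.
  exists (c ^+ (d - i.+1) * h`_((size p).-1 - i)).
  apply: (mulIf (expf_neq0 i c0)); rewrite e.
  have -> : d = (d - i.+1 + i.+1)%N by lia.
  rewrite exprD exprS; have -> : (d - i.+1 + i.+1 - i.+1 = d - i.+1)%N by lia.
  ring.
split=> //.
have key : rev_at R c = (u^-1 * c ^+ ((size p).-1 - d)) *: p.
  have R0 : (u * c ^+ d) != 0 by rewrite mulf_neq0 ?expf_neq0 //; apply: contraTneq uu => ->; rewrite unitr0.
  have := rev_atK c p0; rewrite eR rev_atZ // => e.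
  apply/polyP => k; apply: (mulfI R0); rewrite -coefZ e !coefZ.
  rewrite mulrA; congr (_ * _).
  have -> : u * c ^+ d * (u^-1 * c ^+ ((size p).-1 - d)) = u * u^-1 * (c ^+ d * c ^+ ((size p).-1 - d)) by ring.
  by rewrite mulrV // mul1r -exprD; congr (_ ^+ _); lia.
rewrite /content_exp key; split.
  by exists (u^-1 *: p); rewrite scalerA mulrC.
move=> [g eg]; apply: nm; exists (u *: g); apply/polyP => k.
have /polyP/(_ k) := eg; rewrite !coefZ => e.
apply: (mulfI (expf_neq0 ((size p).-1 - d) c0)).
have -> : c ^+ ((size p).-1 - d) * p`_k = u * (u^-1 * c ^+ ((size p).-1 - d) * p`_k).
  by rewrite !mulrA mulrV // mul1r.
by rewrite e exprSr; ring.
Qed.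

End ContentExpMore.

Section ConstantCases.

Variables (S : idomainType) (hS : ufd S) (K : fieldType) (cst : {rmorphism S -> K}).
Variables (T : eqType) (A : exchange_system cst T).
Local Notation ev := (ev cst).
Local Notation seed := (seed A).
Local Notation mut := (mut A).
Local Notation data := (data A).
Local Notation xl := (laurent_exchange A).
Implicit Types (X Y : T) (x y z : K) (p q : {poly S}) (a c u v : S).

Lemma neighbours_inI (l : seq T) X x y p q Y Z : data X x y p q ->
  mut X x = Y -> mut X y = Z -> Y \in l -> Z \in l -> neighbours_in A l X.
Proof. by move=> d <- <- hY hZ; exists x, y, p, q. Qed.

(** Here every exponent d is 1. Mutating at x and at y produces a/(x y) and c/(x y), which are
    proportional; mutating [mut X x] further at y returns x up to a unit, so that seed is equivalent
    to [mut X y]. *)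
Lemma triangle_seeds X x y a c : seed X -> data X x y a%:P c%:P ->
  irreducible_elt a -> irreducible_elt c -> divides c a ->
  exists z Y Z, [/\ z = cst a / (x * y), data X x y a%:P a%:P, data Y x z a%:P a%:P,
    data Z z y a%:P a%:P & forall W, seed W <-> W \in [:: X; Y; Z]].
Proof.
move=> sX d ia ic ca.
have ac : divides a c.
  have [u uu ->] := irreducible_dvd_assoc ic ia ca.
  by exists u^-1; rewrite mulKr.
have [u ua ec] := irreducible_dvd_assoc ia ic ac.
have x0 := (data_neq0 d).1; have y0 := (data_neq0 d).2.
have cinj := data_cst_inj d.
have a0 : cst a != 0 by rewrite (cst_neq0 (data_indep d)) // irreducible_neq0.
have c0 : cst c != 0 by rewrite (cst_neq0 (data_indep d)) // irreducible_neq0.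
have [n [u1 [hn uu1 d1 m1 _]]] := mut_const_inv sX d (erefl _).
have en := content_exp_const_assoc ia ic ca hn; subst n.
have [n [u2 [hn' uu2 d2 m2 _]]] := mut_const_inv sX (data_sym d) (erefl _).
have en := content_exp_const_assoc ic ia ac hn'; subst n.
have s1 := seed_mut sX d; have s2 := seed_mut sX (data_sym d).
rewrite !evC expr1 -mul_polyC -polyCM in d1 m1.
rewrite !evC expr1 -mul_polyC -polyCM in d2 m2.
have ic1 : irreducible_elt (u1 * c).
  apply: (irreducible_associates _ ic); exists u1^-1; rewrite ?unitrV //.
  by rewrite mulKr.
have ac1 : divides a (u1 * c) by exact: divides_mull.
have [n [u3 [hn3 uu3 d3 m3 _]]] := mut_const_inv s1 (data_sym d1) (erefl _).
have en := content_exp_const_assoc ic1 ia ac1 hn3; subst n.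
rewrite !evC expr1 -mul_polyC -polyCM in d3 m3.
have s3 := seed_mut s1 (data_sym d1).
have [eY [ex ez e1 e2]] : mut (mut X x) y = mut X y /\
    [/\ cst (u1 * c) / (cst a / y / x) / y = x, cst a / y / x = cst c / x / y,
        (u1 * c)%:P = (u2 * a)%:P & (u3 * a)%:P = c%:P].
  apply: (@data_equiv_eq _ _ _ _ A _ _ _ _ _ _ _ _ _ _ (u1 * u) u^-1 (u1 * u / u2) (u3 / u) s3 s2 d3 (data_sym d2));
    rewrite ?unitrM ?unitrV ?uu1 ?uu2 ?uu3 ?ua //.
  + by rewrite ec !rmorphM; field; rewrite a0 x0 y0.
  + rewrite ec !rmorphM rmorphV //; field.
    by rewrite x0 y0 (cst_unit_neq0 cst ua).
  + rewrite !evC ec !rmorphM !rmorphV //; field.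
    by rewrite (cst_unit_neq0 cst uu2).
  + rewrite !evC ec !rmorphM !rmorphV //; field.
    by rewrite (cst_unit_neq0 cst ua).
(* The equality of the new variables a/(x y) and c/(x y), not just their proportionality, gives c =
   a. *)
have eca : c = a.
  apply: cinj.
  have -> : cst c = (cst c / x / y) * (x * y) by field; rewrite x0 y0.
  by rewrite -ez; field; rewrite x0 y0.
rewrite eca in e1 e2 d1 d2 d3 ex ez d m1 m2 m3.
have eu1 : u1 * a = a.
  apply: cinj; rewrite -[RHS](_ : x * (cst a / x) = _); last by field.
  by rewrite -{1}ex; field; rewrite a0 x0 y0.
rewrite eu1 in d1 d3 ex e1.
have eu2 : u2 * a = a by apply: polyC_inj; rewrite -e1.
rewrite eu2 in d2.
exists (cst a / y / x), (mut X y), (mut X x); split => //.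
- by field; rewrite x0 y0.
- by rewrite ez; exact: data_sym.
- apply: (@seed_list_closed _ hS _ _ _ A [:: X; mut X y; mut X x] X); first by rewrite !inE eqxx.
  move=> W; rewrite !inE => /or3P[]/eqP ->; split => //.
  + by apply: (neighbours_inI d (erefl _) (erefl _)); rewrite !inE eqxx ?orbT.
  + apply: (neighbours_inI (data_sym d2) (Y := mut X x) _ m2); last by rewrite !inE eqxx.
      rewrite -eY; rewrite eu1 in m3; rewrite -[in RHS]m3; congr (mut _ _).
      by rewrite ex.
    by rewrite !inE eqxx ?orbT.
  + apply: (neighbours_inI d1 m1 eY); by rewrite !inE eqxx ?orbT.
Qed.

(** The new variable is c / y in both cases: if p is constant, it does not divide c and the exponent
    is 0. *)
Lemma mut_const_other X x y p c : seed X -> data X x y p c%:P ->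
  irreducible_elt c -> nonmultiple p c ->
  exists R r, [/\ r != 0, r *: R = rev_at p c, size R = size p,
    data (mut X y) (cst c / y) x c%:P R &
    [/\ mut (mut X y) (cst c / y) = X, xl X y (cst c) &
        xl (mut X y) (cst c / y) (cst c)]].
Proof.
move=> sX d ic nm; have [sp|sp] := ltnP 1 (size p).
  have [R [r [r0 er sz d' h]]] := mut_involves_inv hS sX (data_sym d) sp.
  by rewrite evC coefC eqxx in er d' h; exists R, r; split.
have ep := size1_polyC sp; have [_ _ /(_ sp) ia] := data_poly d.
have [n [u [hn uu d' m [h1 h2]]]] := mut_const_inv sX (data_sym d) ep.
have nd : ~ divides p`_0 c.
  move=> hd; have [v uv ev_] := irreducible_dvd_assoc ia ic hd.
  apply: nm; exists (v^-1)%:P; rewrite {1}ep -mul_polyC -polyCM ev_.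
  by rewrite mulrAC mulrV // mul1r.
have en := content_exp_const0 ic nd hn; subst n.
rewrite evC expr0 divr1 in d' m h1 h2.
exists (u *: p), u^-1; split => //.
- by rewrite invr_eq0 (unit_neq0 uu).
- by rewrite scalerA mulVr // scale1r [in RHS]ep rev_at_const -ep.
- by rewrite size_scale // (unit_neq0 uu).
Qed.

Lemma divf_square (L : fieldType) (E C X1 Y1 P : L) (d m : nat) :
  E != 0 -> X1 != 0 -> Y1 != 0 -> C != 0 -> P != 0 ->
  (C / Y1) ^+ (d + m) * P / (E * C ^+ d) / (C / Y1) ^+ m / (P / Y1 ^+ d / X1) = X1 / E.
Proof.
move=> e0 x0 y0 c0 p0; rewrite exprD !expr_div_n.
have := expf_neq0 d y0; have := expf_neq0 m y0; have := expf_neq0 d c0; have := expf_neq0 m c0.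
set a := Y1 ^+ d; set b := Y1 ^+ m; set e := C ^+ d; set f := C ^+ m => h1 h2 h3 h4.
by field; rewrite e0 x0 p0 h1 h2 h3 h4.
Qed.

(** Mutations at the two variables commute up to units: the path through x, y and x again ends in a
    seed equivalent to the mutation of X at y, and normalization closes the square. *)
Lemma square_seeds X x y p c : seed X -> data X x y p c%:P ->
  irreducible_elt c -> nonmultiple p c ->
  exists (z u : K) (R : {poly S}) (k d : nat) (X2 X3 X4 : T), [/\ size p = k.+1,
    [/\ data X x y p c%:P, data X2 z y p c%:P, data X3 z u R c%:P & data X4 x u R c%:P],
    [/\ (d <= k)%N, ev u R / u ^+ (k - d) = ev y p / y ^+ d,
       xl X x (ev y p / y ^+ d) /\ xl X2 z (ev y p / y ^+ d),
       [/\ xl X y (cst c), xl X2 y (cst c), xl X3 u (cst c) & xl X4 u (cst c)] &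
       xl X3 z (ev u R / u ^+ (k - d)) /\ xl X4 x (ev u R / u ^+ (k - d))] &
    forall W, seed W <-> W \in [:: X; X2; X3; X4]].
Proof.
move=> s1 D1 ic nm; have gp := data_poly D1; have [p00 _ _] := gp.
have x0 := (data_neq0 D1).1; have y0 := (data_neq0 D1).2.
have cinj := data_cst_inj D1; have P0 := (data_ev_neq0 D1).1.
have c0 : cst c != 0 by rewrite (cst_neq0 (data_indep D1)) // irreducible_neq0.
have [d [u2 [hd uu2 D2 m21 [xl1 xl2]]]] := mut_const_inv s1 D1 (erefl _).
rewrite -mul_polyC -polyCM in D2.
have s2 := seed_mut s1 D1.
set z := ev y p / y ^+ d / x in D2 m21 xl2.
set X2 := mut X x in s2 D2 m21 xl2.
have [R4 [r4 [r40 er4 sz4 D4 [m41 xl1y xl4y]]]] := mut_const_other s1 D1 ic nm.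
have s4 := seed_mut s1 (data_sym D1).
set X4 := mut X y in s4 D4 m41 xl4y.
set c2 := u2 * c in D2.
have ic2 : irreducible_elt c2.
  by apply: (irreducible_associates _ ic); exists u2^-1; rewrite ?unitrV // mulKr.
have nm2 : nonmultiple p c2.
  move=> [h eh]; apply: nm; exists (u2 *: h).
  by rewrite scalerA mulrC.
have hd2 : content_exp p c2 d by exact: content_exp_unit.
have c20 : cst c2 != 0 by rewrite (cst_neq0 (data_indep D1)) // irreducible_neq0.
have [R [r [r0 er sz D3 [m32 xl2y xl3y]]]] := mut_const_other s2 D2 ic2 nm2.
have s3 := seed_mut s2 (data_sym D2).
set X3 := mut X2 y in s3 D3 m32 xl3y.
set u := cst c2 / y in D3 m32 xl3y.
have gR := data_poly (data_sym D3); have gR4 := data_poly (data_sym D4).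
have [e ue eR] := content_exp_rev hS ic2 gp gR nm2 hd2 r0 er sz.
have [e4 ue4 eR4] := content_exp_rev hS ic gp gR4 nm hd r40 er4 sz4.
have [dle hd3] := content_exp_dual ic2 gp nm2 ue sz hd2 eR.
have [d3 [u3 [hd3' uu3 D4' m43 [xl3 xl4]]]] := mut_const_inv s3 (data_sym D3) (erefl _).
have ed3 : d3 = ((size p).-1 - d)%N.
  apply: (content_exp_uniq (u := 1) (c := c2) _ _ hd3); rewrite ?unitr1 ?mul1r //.
  exact: irreducible_neq0.
have e0 := cst_unit_neq0 cst ue; have e40 := cst_unit_neq0 cst ue4.
have u20 := cst_unit_neq0 cst uu2.
have evR : ev u R = u ^+ (size p).-1 * ev y p / (cst e * cst c2 ^+ d).
  have h := horner_rev_at cst p c2 (data_neq0 D3).1.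
  have hu : cst c2 / u = y by rewrite /u; field; rewrite c20 y0.
  rewrite -/u hu -!/(ev _ _) eR evZ rmorphM rmorphXn /= in h.
  rewrite -h; field.
  by rewrite e0 expf_neq0.
have evR4 : ev (cst c / y) R4 = (cst c / y) ^+ (size p).-1 * ev y p / (cst e4 * cst c ^+ d).
  have h := horner_rev_at cst p c (data_neq0 D4).1.
  have hu : cst c / (cst c / y) = y by field; rewrite c0 y0.
  rewrite hu -!/(ev _ _) eR4 evZ rmorphM rmorphXn /= in h.
  rewrite -h; field.
  by rewrite e40 expf_neq0.
have s4' := seed_mut s3 (data_sym D3).
(* The exponents at y and at u add up to deg p, so all powers cancel and the third mutation returns
   x up to the unit e. *)
have ex4 : ev u R / u ^+ d3 / z = x / cst e.
  rewrite evR /u /z ed3.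
  have -> : (size p).-1 = (d + ((size p).-1 - d))%N by rewrite subnKC.
  rewrite addKn; exact: divf_square.
have eu : u = cst u2 * (cst c / y) by rewrite /u /c2 rmorphM mulrA.
rewrite ex4 in D4' m43 xl4.
(* The equalities obtained here make the units disappear: c2 = c follows from the second, e = 1 from
   the first. *)
have [eX [exx euu eRR ecc]] : X4 = mut X3 z /\
    [/\ x = x / cst e, cst c / y = u, R4 = R & c%:P = u3 *: c2%:P].
  apply: (@data_equiv_eq _ _ _ _ A _ _ _ _ _ _ _ _ _ _ e u2^-1
    (e * u2 ^+ d / (e4 * u2 ^+ (size p).-1)) (u3^-1 / u2) s4 s4' (data_sym D4) D4');
    rewrite ?unitrM ?unitrV ?unitrM ?unitrX ?uu2 ?uu3 ?ue ?ue4 //.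
  + by field.
  + by rewrite eu rmorphV //; field; rewrite ?y0 ?u20.
  + rewrite evR evR4 eu rmorphM rmorphV ?unitrM ?unitrX ?ue4 ?uu2 //.
    rewrite !rmorphM !rmorphXn /= !exprMn.
    have := expf_neq0 d u20; have := expf_neq0 (size p).-1 u20; have := expf_neq0 d c0.
    set a1 := cst u2 ^+ d; set a2 := cst u2 ^+ _; set a3 := cst c ^+ d => h1 h2 h3.
    by field; rewrite ?e0 ?e40 ?h1 ?h2 ?h3.
  + rewrite evZ !evC /c2 !rmorphM !rmorphV //; field.
    by rewrite u20 (cst_unit_neq0 cst uu3).
have ec2 : c2 = c.
  apply: cinj; rewrite (_ : cst c2 = u * y); last by rewrite /u; field.
  by rewrite -euu; field.
rewrite -ecc exx -exx in D4'.
have e1 : cst e = 1.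
  rewrite -[LHS](_ : x / (x / cst e) = _); last by field; rewrite e0 x0.
  by rewrite -exx divff.
rewrite ec2 in D2 D3 xl2y xl3y.
rewrite eRR euu in D4; rewrite euu in xl4y m41.
rewrite -exx in m43 xl4.
have szp : (0 < size p)%N by rewrite size_poly_gt0; apply: contraNneq p00 => ->; rewrite coef0.
exists z, u, R, (size p).-1, d, X2, X3, X4; split.
- by rewrite prednK.
- split => //; first exact: data_sym.
  exact: (data_sym D4).
- split => //.
  + rewrite e1 divr1 in ex4; rewrite -ed3 -[LHS](mulfVK (data_neq0 D3).2) ex4 /z mulrC.
    by rewrite divfK.
  + by rewrite -ed3 eX.
- apply: (@seed_list_closed _ hS _ _ _ A [:: X; X2; X3; X4] X); first by rewrite !inE eqxx.
  move=> W; rewrite !inE => /or4P[]/eqP ->; split => //.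
  + by apply: (neighbours_inI D1 (erefl _) (erefl _)); rewrite !inE eqxx ?orbT.
  + by apply: (neighbours_inI D2 m21 (erefl _)); rewrite !inE eqxx ?orbT.
  + by apply: (neighbours_inI D3 m32 (esym eX)); rewrite !inE eqxx ?orbT.
  + apply: (neighbours_inI D4 m41 (Z := X3)); rewrite ?inE ?eqxx ?orbT //.
    by rewrite eX.
Qed.

End ConstantCases.

(** * Growth of degrees *)

Section Degree.

Variables (S : idomainType) (K : fieldType) (cst : {rmorphism S -> K}).
Variables (x y : K) (m n : nat).
Hypothesis hxy : indep cst x y.
Local Notation ev := (ev cst).
Local Notation ev2 := (ev2 cst x y).

(** Restriction to the curve x = t^m, y = t^n. Degrees in t add up under multiplication because S[t]
    is a domain. *)
Definition weighted : {rmorphism {poly {poly S}} -> {poly S}} :=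
  horner_eval 'X^n \o map_poly (horner_eval 'X^m \o map_poly (@polyC S)).
Local Notation W := weighted.

(* [x] and [y] need not generate the ambient field, so the weighted degree is
   only a partial function. *)
Definition degree_is (v : K) (d : nat) : Prop := exists P Q,
  [/\ W P != 0, W Q != 0, v * ev2 Q = ev2 P & size (W P) = (d + size (W Q))%N].

Lemma weighted_neq0 P : W P != 0 -> ev2 P != 0.
Proof.
apply: contra_neq => e; have := hxy e => ->.
exact: rmorph0.
Qed.

Lemma degree_is_uniq v d e : degree_is v d -> degree_is v e -> d = e.
Proof.
move=> [P [Q [P0 Q0 h sz]]] [P' [Q' [P'0 Q'0 h' sz']]].
have : P * Q' = P' * Q.
  apply: (ev2_inj hxy); rewrite !rmorphM /= -h -h'; ring.
move/(congr1 (fun w => size (W w))); rewrite !rmorphM !size_mul // sz sz'.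
by have := size_poly_gt0 (W Q); have := size_poly_gt0 (W Q'); rewrite Q0 Q'0; lia.
Qed.

Lemma degree_is_cst c : c != 0 -> degree_is (cst c) 0.
Proof.
move=> c0; exists c%:P%:P, 1; rewrite rmorph1 oner_neq0.
have e : W c%:P%:P = c%:P.
  by rewrite /weighted /= map_polyC /= /horner_eval hornerC map_polyC hornerC.
rewrite e polyC_eq0 c0; split => //.
  by rewrite rmorph1 mulr1 ev2C evC.
by rewrite size_poly1 size_polyC c0.
Qed.

Lemma degree_is_left : degree_is x m.
Proof.
exists 'X%:P, 1; rewrite rmorph1 oner_neq0.
have e : W 'X%:P = 'X^m.
  by rewrite /weighted /= map_polyC /= /horner_eval hornerC map_polyX hornerX.
rewrite e -size_poly_gt0 size_polyXn; split => //.
  by rewrite rmorph1 mulr1 ev2C evX.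
by rewrite size_poly1 addn1.
Qed.

Lemma degree_is_right : degree_is y n.
Proof.
exists 'X, 1; rewrite rmorph1 oner_neq0.
have e : W 'X = 'X^n.
  by rewrite /weighted /= map_polyX /= /horner_eval hornerX.
rewrite e -size_poly_gt0 size_polyXn; split => //.
  by rewrite rmorph1 mulr1 ev2X.
by rewrite size_poly1 addn1.
Qed.

Lemma degree_isM v w d e : degree_is v d -> degree_is w e -> degree_is (v * w) (d + e).
Proof.
move=> [P [Q [P0 Q0 h sz]]] [P' [Q' [P'0 Q'0 h' sz']]].
exists (P * P'), (Q * Q'); rewrite !rmorphM !mulf_neq0 //; split => //.
  by rewrite /= -h -h'; ring.
rewrite !size_mul // sz sz'.
by have := size_poly_gt0 (W Q); have := size_poly_gt0 (W Q'); rewrite Q0 Q'0; lia.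
Qed.

Lemma degree_is_div v w d e : degree_is v (d + e) -> degree_is w e -> degree_is (v / w) d.
Proof.
move=> [P [Q [P0 Q0 h sz]]] [P' [Q' [P'0 Q'0 h' sz']]].
exists (P * Q'), (Q * P'); rewrite !rmorphM !mulf_neq0 //; split => //.
  rewrite /= -h -h'; have : w != 0.
    by apply: contraTneq (weighted_neq0 P'0) => w0; rewrite -h' w0 mul0r eqxx.
  by move=> w0; field.
rewrite !size_mul // sz sz'.
by have := size_poly_gt0 (W Q); have := size_poly_gt0 (W Q'); rewrite Q0 Q'0; lia.
Qed.

Lemma degree_isD v w d e : degree_is v d -> degree_is w e -> (e < d)%N ->
  degree_is (v + w) d.
Proof.
move=> [P [Q [P0 Q0 h sz]]] [P' [Q' [P'0 Q'0 h' sz']]] ed.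
have g1 := size_poly_gt0 (W Q); have g2 := size_poly_gt0 (W Q').
rewrite Q0 in g1; rewrite Q'0 in g2.
have szs : size (W (P * Q' + P' * Q)) = size (W P * W Q').
  rewrite rmorphD !rmorphM; apply: size_polyDl.
  by rewrite !size_mul // sz sz'; lia.
exists (P * Q' + P' * Q), (Q * Q'); split.
- by rewrite -size_poly_eq0 szs size_poly_eq0 mulf_neq0.
- by rewrite rmorphM mulf_neq0.
- by rewrite rmorphD !rmorphM /= -h -h'; ring.
- by rewrite szs rmorphM !size_mul // sz; lia.
Qed.

(** With d > 0 the term of higher degree dominates the constant at each step of Horner's scheme, so
    nothing cancels. *)
Lemma degree_is_ev v d p : (0 < d)%N -> p != 0 -> degree_is v d ->
  degree_is (ev v p) ((size p).-1 * d).
Proof.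
move=> d0 p0 hv; elim/poly_ind: p p0 => [|p c IH]; first by rewrite eqxx.
move=> pc0; rewrite rmorphD rmorphM /= evX evC.
have [p0|p0] := eqVneq p 0.
  rewrite p0 mul0r add0r in pc0 *; rewrite rmorph0 mul0r add0r.
  rewrite polyC_eq0 in pc0; rewrite size_polyC pc0.
  exact: degree_is_cst.
have -> : ((size (p * 'X + c%:P)%R).-1 * d = (size p).-1 * d + d)%N.
  by have := size_poly_gt0 p; rewrite p0 size_MXaddC (negPf p0) /=; case: (size p) => // k _ /=; rewrite mulSn addnC.
have h := degree_isM (IH p0) hv.
have [->|c0] := eqVneq c 0; first by rewrite rmorph0 addr0.
apply: degree_isD h (degree_is_cst c0) _; lia.
Qed.

End Degree.

Section Growth.

Variables (S : idomainType) (hS : ufd S) (K : fieldType) (cst : {rmorphism S -> K}).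
Variables (T : eqType) (A : exchange_system cst T).
Local Notation ev := (ev cst).
Local Notation seed := (seed A).
Local Notation mut := (mut A).
Local Notation data := (data A).

(** The product x y does not depend on the order of the cluster, so each seed of a finite list
    contributes at most one degree. *)
Lemma cluster_degree_bound x0 y0 m n (l : seq T) : indep cst x0 y0 ->
  exists N, forall X x y p q d, X \in l -> data X x y p q ->
    degree_is cst x0 y0 m n (x * y) d -> (d < N)%N.
Proof.
move=> hi; elim: l => [|X l [N hN]]; first by exists 0%N.
have [[x [y [p [q [d [D hd]]]]]]|h] := classic (exists x y p q d,
  data X x y p q /\ degree_is cst x0 y0 m n (x * y) d).
  exists (maxn N d.+1) => Y x' y' p' q' d'; rewrite inE => /orP[/eqP ->|hY] D' hd'.
    have e : x' * y' = x * y.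
      by case: (data_uniq D D') => -[-> -> _ _] //; exact: mulrC.
    rewrite e in hd'; rewrite (degree_is_uniq hi hd' hd); lia.
  have := hN _ _ _ _ _ _ hY D' hd'; lia.
exists N => Y x' y' p' q' d'; rewrite inE => /orP[/eqP ->|hY] D' hd'.
  by case: h; exists x', y', p', q', d'.
exact: hN hY D' hd'.
Qed.

(* The weights [w1], [w2] make the degrees of consecutive variables, divided by
   their weights, a convex sequence. *)
Lemma cluster_degree_growth x0 y0 m0 n0 (k : nat) : indep cst x0 y0 ->
  forall b c w1 w2 m n X x y p q, seed X -> data X x y p q ->
  size p = b.+2 -> size q = c.+2 -> (0 < w1)%N -> (0 < w2)%N ->
  (2 * w1 <= b.+1 * w2)%N -> (2 * w2 <= c.+1 * w1)%N ->
  (0 < m)%N -> (w2 * m < w1 * n)%N ->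
  degree_is cst x0 y0 m0 n0 x m -> degree_is cst x0 y0 m0 n0 y n ->
  exists X' x' y' p' q' d, [/\ seed X', data X' x' y' p' q',
    degree_is cst x0 y0 m0 n0 (x' * y') d & (m + n + k <= d)%N].
Proof.
move=> hi; elim: k => [|k IH] b c w1 w2 m n X x y p q sX D szp szq w10 w20 h1 h2 m_gt0 hmn dx dy.
  exists X, x, y, p, q, (m + n)%N; split => //; last by rewrite addn0.
  exact: degree_isM.
have sq : (1 < size q)%N by rewrite szq.
have [q' [r [_ _ szq' D' _]]] := mut_involves_inv hS sX D sq.
have n_gt0 : (0 < n)%N by nia.
have p0 : p != 0 by rewrite -size_poly_gt0 szp.
(* From 2 w1 n <= (b+1) w2 n and w2 m < w1 n: relative to the weights, the next degree (b+1) n - m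
   again exceeds n. *)
have hw : (w1 * n + w2 * m < w2 * (b.+1 * n))%N by nia.
have hm : (m <= b.+1 * n)%N by nia.
have dz : degree_is cst x0 y0 m0 n0 (ev y p / x) (b.+1 * n - m).
  apply: (degree_is_div hi _ dx); rewrite subnK //.
  by have := degree_is_ev n_gt0 p0 dy; rewrite szp.
have szq2 : size q' = c.+2 by rewrite szq'.
have hz : (w1 * n < w2 * (b.+1 * n - m))%N by rewrite mulnBr; lia.
have [X' [x' [y' [p' [q2 [d [h3 h4 h5 h6]]]]]]] :=
  IH c b w2 w1 n (b.+1 * n - m)%N _ _ _ _ _ (seed_mut sX D) (data_sym D') szq2 szp w20 w10 h2 h1 n_gt0 hz dy dz.
exists X', x', y', p', q2, d; split => //.
(* The sum of the two degrees has increased, which pays for one step of k. *)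
have hm2 : (m < b.+1 * n - m)%N.
  rewrite -(ltn_pmul2l w20); lia.
lia.
Qed.

Lemma exchange_degrees_bound X x y p q : seed X -> data X x y p q ->
  (1 < size p)%N -> (1 < size q)%N -> ((size p).-1 * (size q).-1 <= 3)%N.
Proof.
move=> sX D sp sq; rewrite leqNgt; apply/negP => h.
have [b eb] : exists b, size p = b.+2 by case: (size p) sp => [|[|b]] // _; exists b.
have [c ec] : exists c, size q = c.+2 by case: (size q) sq => [|[|c]] // _; exists c.
rewrite eb ec /= in h.
(* Multiplying the two inequalities shows that they need deg p deg q >= 4. Conversely, if one degree
   is 1, the other is at least 4 and weights in the ratio 2 work; otherwise equal weights do. *)
have [w1 [w2 [w10 w20 h1 h2]]] : exists w1 w2, [/\ (0 < w1)%N, (0 < w2)%N,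
    (2 * w1 <= b.+1 * w2)%N & (2 * w2 <= c.+1 * w1)%N].
  case: b eb h => [|b] eb h; first by exists 1%N, 2%N; split => //; lia.
  case: c ec h => [|c] ec h; first by exists 2%N, 1%N; split => //; lia.
  by exists 1%N, 1%N; split => //; lia.
have hi := data_indep D; have [l hl] := seed_finite A.
(* The initial variables get degrees w1 and w2 + 1; the added 1 makes the first weighted inequality
   strict. *)
have [N hN] := cluster_degree_bound w1 w2.+1 l hi.
have [|X' [x' [y' [p' [q' [d [s' D' hd hdN]]]]]]] :=
  cluster_degree_growth N hi sX D eb ec w10 w20 h1 h2 w10 _
    (degree_is_left cst x y w1 w2.+1) (degree_is_right cst x y w1 w2.+1).
  by rewrite mulnS mulnC; lia.
have := hN _ _ _ _ _ _ (hl _ s') D' hd; lia.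
Qed.

End Growth.

(** * Walks along mutations *)

Lemma tofrac_injective (R : idomainType) : injective (@tofrac R).
Proof. by move=> a b /eqP; rewrite tofrac_eq => /eqP. Qed.

Lemma tofrac_unit_neq0 (R : idomainType) (u : R) : u \is a GRing.unit -> tofrac u != 0.
Proof. by move=> uu; rewrite tofrac_eq0; apply: unit_neq0. Qed.

Lemma twist_field_id (L : fieldType) (b q a1 a2 a3 a4 a5 : L) : a2 != 0 -> a3 != 0 -> a4 != 0 ->
  b * q * a3^-1 * (a1 * a5) = b * (a1 * a3^-1 * (a2 * a4^-1)) * (q * a5) * (a4 * a2^-1).
Proof. by move=> h2 h3 h4; field; rewrite h2 h3 h4. Qed.

Section Twist.

Variables (S : idomainType) (hS : ufd S).
Implicit Types (p q : {poly S}) (a b u v : S).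

(** This is a p(X / u): the exchange polynomial p after its variable has been rescaled by the unit u
    and its value by the unit a. *)
Definition twist a u p : {poly S} := \poly_(k < size p) (a * p`_k * u^-1 ^+ k).

Lemma coef_twist a u p k : (twist a u p)`_k = a * p`_k * u^-1 ^+ k.
Proof.
by rewrite coef_poly; case: ltnP => // h; rewrite nth_default // mulr0 mul0r.
Qed.

Lemma size_twist a u p : a \is a GRing.unit -> u \is a GRing.unit ->
  size (twist a u p) = size p.
Proof.
move=> ua uu; have [->|p0] := eqVneq p 0.
  by apply/eqP; rewrite size_poly0 size_poly_eq0; apply/eqP/polyP => k; rewrite coef_twist coef0 mulr0 mul0r.
apply: size_poly_eq; rewrite !mulf_neq0 ?expf_neq0 ?invr_eq0 ?(unit_neq0 ua) ?(unit_neq0 uu) //.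
by rewrite -lead_coefE lead_coef_eq0.
Qed.

Lemma twist11 p : twist 1 1 p = p.
Proof. by apply/polyP => k; rewrite coef_twist invr1 expr1n mul1r mulr1. Qed.

Lemma twistZ r a u p : twist a u (r *: p) = r *: twist a u p.
Proof. by apply/polyP => k; rewrite coefZ !coef_twist coefZ; ring. Qed.

Lemma twist_scale r a u p : r *: twist a u p = twist (r * a) u p.
Proof. by apply/polyP => k; rewrite coefZ !coef_twist; ring. Qed.

Lemma primitive_twist a u p : a \is a GRing.unit -> u \is a GRing.unit ->
  primitive p -> primitive (twist a u p).
Proof.
move=> ua uu hp f hf h; apply: (hp f hf) => k; have := h k; rewrite coef_twist => hk.
apply: (divides_unitr (u := u^-1 ^+ k)); first by rewrite unitrX // unitrV.
by apply: (divides_unitl ua); rewrite mulrA.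
Qed.

Lemma rev_at_twist b v q a c : a \is a GRing.unit -> b \is a GRing.unit -> v \is a GRing.unit ->
  rev_at (twist b v q) (a * c) =
  twist (b * (a / v) ^+ (size q).-1) (a / v) (rev_at q c).
Proof.
move=> ua ub uv; apply/polyP => k; rewrite coef_twist.
have [hk|hk] := ltnP k (size q); last first.
  by rewrite !(nth_default _) ?mulr0 ?mul0r // (leq_trans (size_poly _ _)) ?size_twist.
rewrite !coef_rev_at ?size_twist // coef_twist; set m := ((size q).-1 - k)%N.
have -> : (size q).-1 = (m + k)%N by rewrite /m; lia.
(* In the fraction field the inverses of units become field inverses, and the claim a field
   identity. *)
apply: tofrac_injective.
have -> : (a / v)^-1 = v * a^-1 by rewrite invrM ?unitrV // invrK.
rewrite !(rmorphM, rmorphXn) /= !rmorphV // exprD !exprMn !exprVn.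
apply: twist_field_id; rewrite expf_neq0 // tofrac_unit_neq0 //.
Qed.

Variables (K : fieldType) (cst : {rmorphism S -> K}).

Lemma ev_twist a u p (y : K) : u \is a GRing.unit ->
  ev cst (cst u * y) (twist a u p) = cst a * ev cst y p.
Proof.
move=> uu; have u0 := cst_unit_neq0 cst uu.
rewrite /ev (horner_coef_wide _ (_ : (size (map_poly cst (twist a u p)) <= size p)%N)); last first.
  by rewrite (leq_trans (size_poly _ _)) // size_poly.
rewrite (horner_coef_wide _ (size_poly _ _ : (size (map_poly cst p) <= size p)%N)).
rewrite mulr_sumr; apply: eq_bigr => i _; rewrite !coef_map coef_twist /=.
rewrite !rmorphM rmorphXn rmorphV // exprMn exprVn.
have := expf_neq0 i u0; set v := cst u ^+ i => v0.
by field.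
Qed.

End Twist.

Section Walk.

Variables (S : idomainType) (hS : ufd S) (K : fieldType) (cst : {rmorphism S -> K}).
Variables (T : eqType) (A : exchange_system cst T).
Local Notation ev := (ev cst).
Local Notation seed := (seed A).
Local Notation mut := (mut A).
Local Notation data := (data A).
Implicit Types (X : T) (x y : K) (p q : {poly S}) (a b u v : S).

(** The unknown constant r stands for the content that a mutation removes; for primitive q1 this
    determines q1 up to a unit. *)
Definition exchange_step (p q q1 : {poly S}) : Prop :=
  exists2 r, r != 0 & r *: q1 = rev_at q p`_0.

(** If the value of p is off by a and x is off by u, the new variable is off by a / u; primitivity
    fixes the new polynomial up to a further unit b1. *)
Lemma twisted_step X x y p q q1 u v a b : seed X ->
  data X (cst u * x) (cst v * y) (twist a v p) (twist b u q) ->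
  u \is a GRing.unit -> v \is a GRing.unit -> a \is a GRing.unit -> b \is a GRing.unit ->
  (1 < size q)%N -> primitive q1 -> exchange_step p q q1 ->
  exists2 b1, b1 \is a GRing.unit &
    data (mut X (cst u * x)) (cst (a / u) * (ev y p / x)) (cst v * y)
      (twist a v p) (twist b1 (a / u) q1) /\
    mut (mut X (cst u * x)) (cst (a / u) * (ev y p / x)) = X.
Proof.
move=> sX D uu uv ua ub sq pq1 [r r0 er].
have sq' : (1 < size (twist b u q))%N by rewrite size_twist.
have [q' [r' [r'0 er' sz D' [m _ _]]]] := mut_involves_inv hS sX D sq'.
have x0 : x != 0.
  by have := (data_neq0 D).1; rewrite mulf_eq0 negb_or => /andP[].
have eX : ev (cst v * y) (twist a v p) / (cst u * x) = cst (a / u) * (ev y p / x).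
  rewrite ev_twist // rmorphM rmorphV //; field.
  by rewrite x0 (cst_unit_neq0 cst uu).
rewrite eX in D' m.
have uau : a / u \is a GRing.unit by rewrite unitrM ua unitrV.
have [_ hq' _] := data_poly (data_sym D').
set b' := b * (a / u) ^+ (size q).-1.
have ub' : b' \is a GRing.unit by rewrite unitrM ub unitrX.
have [] := @primitive_scale_eq _ hS r' r q' (twist b' (a / u) q1) => //.
- by apply: hq'; rewrite sz.
- exact: primitive_twist.
- by rewrite er' coef_twist expr0 mulr1 rev_at_twist // -er twistZ.
move=> e ue eq'; exists (e * b'); first by rewrite unitrM ue.
by rewrite -twist_scale -eq'.
Qed.

Variables (P : nat -> {poly S}) (x : nat -> K).
Hypothesis P_size : forall j, (1 < size (P j))%N.
Hypothesis P_prim : forall j, primitive (P j).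
Hypothesis P_step : forall j, exchange_step (P j.+1) (P j) (P j.+2).
Hypothesis xSS : forall j, x j.+2 = ev (x j.+1) (P j.+1) / x j.

(** [v j] is the ratio of the actual variable to the formal [x j], and [a j] the ratio of the values
    of the polynomials in these variables. Both sequences are extended by one entry with every
    mutation. *)
Lemma twisted_walk X n : seed X -> data X (x 0%N) (x 1%N) (P 1%N) (P 0%N) ->
  exists (Y : nat -> T) (v a : nat -> S),
  [/\ Y 0%N = X, [/\ v 0%N = 1, v 1%N = 1, a 0%N = 1 & a 1%N = 1],
    forall j, (j <= n.+1)%N -> v j \is a GRing.unit /\ a j \is a GRing.unit,
    forall j, (j <= n)%N -> seed (Y j) /\ data (Y j) (cst (v j) * x j) (cst (v j.+1) * x j.+1)
      (twist (a j.+1) (v j.+1) (P j.+1)) (twist (a j) (v j) (P j)) &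
    forall j, (j < n)%N -> [/\ v j.+2 = a j.+1 / v j, mut (Y j) (cst (v j) * x j) = Y j.+1 &
      mut (Y j.+1) (cst (v j.+2) * x j.+2) = Y j]].
Proof.
move=> sX D; elim: n => [|n [Y [v [a [Y0 va0 uva hd hm]]]]].
  exists (fun _ => X), (fun _ => 1), (fun _ => 1); split => //.
  - by move=> j _; rewrite unitr1.
  - by move=> [|//] _; rewrite rmorph1 !mul1r !twist11.
have [sn Dn] := hd n (leqnn n).
have [un uan] := uva n (leqnSn n); have [un1 uan1] := uva n.+1 (leqnn _).
have [b ub [Dn1 mn1]] := twisted_step sn Dn un un1 uan1 uan (P_size n) (@P_prim n.+2) (P_step n).
pose Y' j := if (j <= n)%N then Y j else mut (Y n) (cst (v n) * x n).
pose v' j := if (j <= n.+1)%N then v j else a n.+1 / v n.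
pose a' j := if (j <= n.+1)%N then a j else b.
exists Y', v', a'.
have Ylt j : (j <= n)%N -> Y' j = Y j by rewrite /Y' => ->.
have vlt j : (j <= n.+1)%N -> v' j = v j by rewrite /v' => ->.
have alt j : (j <= n.+1)%N -> a' j = a j by rewrite /a' => ->.
have vn2 : v' n.+2 = a n.+1 / v n by rewrite /v' ltnn.
have an2 : a' n.+2 = b by rewrite /a' ltnn.
have Yn1 : Y' n.+1 = mut (Y n) (cst (v n) * x n) by rewrite /Y' ltnn.
split.
- by rewrite Ylt.
- by rewrite !vlt // !alt.
- move=> j; rewrite leq_eqVlt => /orP[/eqP ->|].
    by rewrite vn2 an2 ub unitrM unitrV uan1 un.
  by rewrite ltnS => hj; rewrite vlt // alt //; apply: uva.
- move=> j; rewrite leq_eqVlt => /orP[/eqP ->|].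
    rewrite vn2 an2 Yn1 vlt // alt // xSS; split; last exact: data_sym.
    exact: seed_mut sn Dn.
  rewrite ltnS => hj; rewrite Ylt // !vlt //; try lia.
  rewrite !alt //; try lia.
  exact: hd.
- move=> j; rewrite ltnS leq_eqVlt => /orP[/eqP ->|hj].
    by rewrite vn2 Yn1 Ylt // vlt // alt // xSS.
  rewrite !vlt ?alt ?Ylt //; try lia.
  exact: hm.
Qed.

Lemma walk_neq0 X j : seed X -> data X (x 0%N) (x 1%N) (P 1%N) (P 0%N) -> x j != 0.
Proof.
move=> sX D; have [Y [v [a [_ _ _ hd _]]]] := twisted_walk j sX D.
have [_ Dj] := hd j (leqnn j).
by have := (data_neq0 Dj).1; rewrite mulf_eq0 negb_or => /andP[].
Qed.

(** When the formal data are periodic, the m-th seed differs from the first one by units only, so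
    the two coincide. Comparing variables and leading coefficients shows that the units at positions
    m and m + 1 are 1. *)
Lemma closed_walk X m : seed X -> data X (x 0%N) (x 1%N) (P 1%N) (P 0%N) ->
  (0 < m)%N -> P m = P 0%N -> P m.+1 = P 1%N ->
  x m = x 0%N -> x m.+1 = x 1%N ->
  exists (Y : nat -> T) (v a : nat -> S),
  [/\ [/\ v 0%N = 1, v 1%N = 1, v m = 1 & v m.+1 = 1],
    forall j, (j <= m.+1)%N -> v j \is a GRing.unit,
    forall j, (j < m)%N -> a j.+1 = v j.+2 * v j,
    [/\ a 0%N = 1, a 1%N = 1, a m = 1 & a m.+1 = 1] &
    (forall j, (j <= m)%N -> data (Y j) (cst (v j) * x j) (cst (v j.+1) * x j.+1)
      (twist (a j.+1) (v j.+1) (P j.+1)) (twist (a j) (v j) (P j))) /\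
    forall W, seed W <-> W \in [seq Y j | j <- iota 0 m]].
Proof.
move=> sX D m_gt0 Pm Pm1 xm xm1.
have x_neq0 j : x j != 0 := walk_neq0 j sX D.
have [Y [v [a [Y0 [v0 v1 a0 a1] uva hd hm]]]] := twisted_walk m sX D.
have [sm Dm] := hd m (leqnn m).
have D0 := D; rewrite -Y0 in D0; have s0 := sX; rewrite -Y0 in s0.
have [vm uam] := uva m (leqnSn m); have [vm1 uam1] := uva m.+1 (leqnn _).
rewrite xm xm1 Pm Pm1 in Dm.
have [eY [e1 e2 e3 e4]] : Y m = Y 0%N /\ [/\ cst (v m) * x 0%N = x 0%N,
    cst (v m.+1) * x 1%N = x 1%N, twist (a m.+1) (v m.+1) (P 1%N) = P 1%N &
    twist (a m) (v m) (P 0%N) = P 0%N].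
  apply: (data_equiv_eq sm s0 Dm D0 vm vm1 uam1 uam) => //; exact: ev_twist.
have cinj := data_cst_inj D.
have evm : v m = 1.
  by apply: cinj; apply: (mulIf (x_neq0 0%N)); rewrite rmorph1 mul1r.
have evm1 : v m.+1 = 1.
  by apply: cinj; apply: (mulIf (x_neq0 1%N)); rewrite rmorph1 mul1r.
have twist_eq c (w : {poly S}) : (1 < size w)%N -> twist c 1 w = w -> c = 1.
  move=> sw /polyP/(_ (size w).-1); rewrite coef_twist invr1 expr1n mulr1 => e.
  apply: (mulIf (_ : w`_(size w).-1 != 0)); last by rewrite e mul1r.
  by rewrite -lead_coefE lead_coef_eq0 -size_poly_gt0 ltnW.
rewrite evm1 in e3; rewrite evm in e4.
have eam1 := twist_eq _ _ (P_size 1) e3; have eam := twist_eq _ _ (P_size 0) e4.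
exists Y, v, a; split => //.
- by move=> j /uva[].
- move=> j hj; have [-> _ _] := hm j hj; rewrite mulrVK //.
  by have [] := uva j (ltnW (ltnW hj : (j < m.+1)%N)).
- split=> [j hj|]; first by have [] := hd j hj.
  have Ymem j : (j <= m)%N -> Y j \in [seq Y j | j <- iota 0 m].
    rewrite leq_eqVlt => /orP[/eqP ->|hj]; last by rewrite map_f // mem_iota.
    by rewrite eY map_f // mem_iota.
  apply: (seed_list_closed hS (Ymem 0%N isT)) => W /mapP[j].
  rewrite mem_iota add0n => hj ->; have hj' := ltnW hj.
  have [sj Dj] := hd j hj'; split => //.
  exists (cst (v j) * x j), (cst (v j.+1) * x j.+1), (twist (a j.+1) (v j.+1) (P j.+1)), (twist (a j) (v j) (P j)).
  split => //; first by have [_ -> _] := hm j hj; apply: Ymem.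
  (* Mutation at the second variable goes one step back; from the first seed, which is also the
     m-th, it leads to the seed of index m - 1. *)
  case: j hj hj' sj Dj => [|j] hj hj' sj Dj; last first.
    by have [_ _ ->] := hm j (ltnW hj); apply: Ymem; exact: ltnW (ltnW hj).
  have hm1 : (m.-1 < m)%N by rewrite prednK.
  rewrite v1 -{1}eY; have [_ _ h] := hm _ hm1.
  move: h; rewrite !prednK // evm1 xm1 => ->; apply: Ymem; exact: leq_pred.
Qed.

End Walk.

(** * Families of exchange polynomials *)

Arguments Poly : simpl never.

Section PolyLists.

Variable R : idomainType.
Implicit Types (a b c d r u : R).

Lemma size_Poly_last (s : seq R) : last 0 s != 0 -> size (Poly s) = size s.
Proof.
case: s => [|b s] h; first by rewrite polyseq0.
by rewrite (@PolyK _ b).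
Qed.

Lemma scale_Poly r (s : seq R) : r *: Poly s = Poly [seq r * e | e <- s].
Proof.
apply/polyP => k; rewrite coefZ !coef_Poly.
have [h|h] := ltnP k (size s); first by rewrite (nth_map 0).
by rewrite !nth_default ?mulr0 // size_map.
Qed.

Lemma rev_at_linear a b c : a != 0 -> rev_at (Poly [:: b; a]) c = Poly [:: a * c; b].
Proof.
move=> a0; apply/polyP => k; rewrite coef_poly size_Poly_last // !coef_Poly.
by case: k => [|[|[|k]]] //=; rewrite ?expr1 ?expr0 ?mulr1.
Qed.

Lemma rev_at_quadratic a b c d : a != 0 ->
  rev_at (Poly [:: c; b; a]) d = Poly [:: a * d ^+ 2; b * d; c].
Proof.
move=> a0; apply/polyP => k; rewrite coef_poly size_Poly_last // !coef_Poly.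
by case: k => [|[|[|[|k]]]] //=; rewrite ?expr1 ?expr0 ?mulr1.
Qed.

Lemma rev_at_cubic a b c d e : a != 0 ->
  rev_at (Poly [:: d; c; b; a]) e = Poly [:: a * e ^+ 3; b * e ^+ 2; c * e; d].
Proof.
move=> a0; apply/polyP => k; rewrite coef_poly size_Poly_last // !coef_Poly.
by case: k => [|[|[|[|[|k]]]]] //=; rewrite ?expr1 ?expr0 ?mulr1.
Qed.

Lemma primitive_linear a b :
  (forall p, irreducible_elt p -> divides p a -> ~ divides p b) -> primitive (Poly [:: b; a]).
Proof.
move=> h p ip hp; have := hp 0%N; have := hp 1%N; rewrite !coef_Poly /=; exact: h.
Qed.

Lemma primitive_quadratic a b c :
  (forall p, irreducible_elt p -> divides p a -> divides p b -> ~ divides p c) ->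
  primitive (Poly [:: c; b; a]).
Proof.
move=> h p ip hp; have := hp 0%N; have := hp 1%N; have := hp 2%N; rewrite !coef_Poly /=; exact: h.
Qed.

Lemma primitive_cubic a b c d :
  (forall p, irreducible_elt p -> divides p a -> divides p b -> divides p c -> ~ divides p d) ->
  primitive (Poly [:: d; c; b; a]).
Proof.
move=> h p ip hp; have := hp 0%N; have := hp 1%N; have := hp 2%N; have := hp 3%N.
rewrite !coef_Poly /=; exact: h.
Qed.

Lemma twist_linear r u a b : twist r u (Poly [:: b; a]) = Poly [:: r * b; r * a / u].
Proof.
apply/polyP => k; rewrite coef_twist !coef_Poly.
by case: k => [|[|[|k]]] //=; rewrite ?expr0 ?expr1 ?mulr1 // mulr0 mul0r.
Qed.

Lemma twist_quadratic r u a b c : twist r u (Poly [:: c; b; a]) =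
  Poly [:: r * c; r * b / u; r * a * u^-1 ^+ 2].
Proof.
apply/polyP => k; rewrite coef_twist !coef_Poly.
by case: k => [|[|[|[|k]]]] //=; rewrite ?expr0 ?expr1 ?mulr1 // mulr0 mul0r.
Qed.

Lemma twist_cubic r u a b c d : twist r u (Poly [:: d; c; b; a]) =
  Poly [:: r * d; r * c / u; r * b * u^-1 ^+ 2; r * a * u^-1 ^+ 3].
Proof.
apply/polyP => k; rewrite coef_twist !coef_Poly.
by case: k => [|[|[|[|[|k]]]]] //=; rewrite ?expr0 ?expr1 ?mulr1 // mulr0 mul0r.
Qed.

Definition coprime2 a b := forall p, irreducible_elt p -> divides p a -> ~ divides p b.
Definition coprime3 a b c := forall p, irreducible_elt p ->
  divides p a -> divides p b -> ~ divides p c.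
Definition coprime4 a b c d := forall p, irreducible_elt p ->
  divides p a -> divides p b -> divides p c -> ~ divides p d.

Lemma coprime2C a b : coprime2 a b -> coprime2 b a.
Proof. by move=> h p ip pa pb; exact: h pb pa. Qed.

Lemma coprime2_unit u v a b : u \is a GRing.unit -> v \is a GRing.unit ->
  coprime2 a b -> coprime2 (a * u) (b * v).
Proof.
by move=> uu uv h p ip /(divides_unitr uu) pa /(divides_unitr uv); exact: h pa.
Qed.

Lemma coprime3_unit u v w a b c : u \is a GRing.unit -> v \is a GRing.unit ->
  w \is a GRing.unit -> coprime3 a b c -> coprime3 (a * u) (b * v) (c * w).
Proof.
move=> uu uv uw h p ip /(divides_unitr uu) pa /(divides_unitr uv) pb /(divides_unitr uw).
exact: h pa pb.
Qed.

Lemma coprime4_unit u v w t a b c d : u \is a GRing.unit -> v \is a GRing.unit ->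
  w \is a GRing.unit -> t \is a GRing.unit ->
  coprime4 a b c d -> coprime4 (a * u) (b * v) (c * w) (d * t).
Proof.
move=> uu uv uw ut h p ip /(divides_unitr uu) pa /(divides_unitr uv) pb.
move=> /(divides_unitr uw) pc /(divides_unitr ut); exact: h pa pb pc.
Qed.

Lemma size2_Poly (p : {poly R}) : size p = 2%N -> p = Poly [:: p`_0; p`_1] /\ p`_1 != 0.
Proof.
move=> sp; split; last by rewrite -[1%N]/(2.-1) -sp -lead_coefE lead_coef_eq0 -size_poly_eq0 sp.
apply/polyP => k; rewrite coef_Poly.
by case: k => [|[|k]] //=; rewrite !nth_default // sp.
Qed.

Lemma size3_Poly (p : {poly R}) : size p = 3%N -> p = Poly [:: p`_0; p`_1; p`_2] /\ p`_2 != 0.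
Proof.
move=> sp; split; last by rewrite -[2%N]/(3.-1) -sp -lead_coefE lead_coef_eq0 -size_poly_eq0 sp.
apply/polyP => k; rewrite coef_Poly.
by case: k => [|[|[|k]]] //=; rewrite !nth_default // sp.
Qed.

Lemma size4_Poly (p : {poly R}) : size p = 4%N ->
  p = Poly [:: p`_0; p`_1; p`_2; p`_3] /\ p`_3 != 0.
Proof.
move=> sp; split; last by rewrite -[3%N]/(4.-1) -sp -lead_coefE lead_coef_eq0 -size_poly_eq0 sp.
apply/polyP => k; rewrite coef_Poly.
by case: k => [|[|[|[|k]]]] //=; rewrite !nth_default // sp.
Qed.

Lemma primitive_divides (p : {poly R}) f : primitive p -> irreducible_elt f ->
  ~ (forall k, (k < size p)%N -> divides f p`_k).
Proof.
move=> hp hf h; apply: (hp f hf) => k; have [/h//|hk] := ltnP k (size p).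
by rewrite nth_default //; exact: divides0.
Qed.

End PolyLists.

Section EvLists.

Variables (S : idomainType) (K : fieldType) (cst : {rmorphism S -> K}).

Lemma ev_linear y a b : ev cst y (Poly [:: b; a]) = cst a * y + cst b.
Proof.
by rewrite /ev map_Poly_id0 ?rmorph0 // horner_Poly /= mul0r add0r.
Qed.

Lemma ev_quadratic y a b c :
  ev cst y (Poly [:: c; b; a]) = cst a * y ^+ 2 + cst b * y + cst c.
Proof. by rewrite /ev map_Poly_id0 ?rmorph0 // horner_Poly /=; ring. Qed.

Lemma ev_cubic y a b c d :
  ev cst y (Poly [:: d; c; b; a]) = cst a * y ^+ 3 + cst b * y ^+ 2 + cst c * y + cst d.
Proof. by rewrite /ev map_Poly_id0 ?rmorph0 // horner_Poly /=; ring. Qed.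

End EvLists.

(** * Exchange polynomials along two alternating parameter maps *)

Section Family.

Variables (S : idomainType) (hS : ufd S) (I : Type).
Variables (sigma tau : I -> I) (P Q : I -> {poly S}) (good : I -> Prop).
Hypothesis good_sigma : forall i, good i -> good (sigma i).
Hypothesis good_tau : forall i, good i -> good (tau i).
Hypothesis P_sigma : forall i, P (sigma i) = P i.
Hypothesis Q_tau : forall i, Q (tau i) = Q i.
Hypothesis P_size : forall i, good i -> (1 < size (P i))%N.
Hypothesis Q_size : forall i, good i -> (1 < size (Q i))%N.
Hypothesis P_prim : forall i, good i -> primitive (P i).
Hypothesis Q_prim : forall i, good i -> primitive (Q i).
Hypothesis Q_step : forall i, good i -> exchange_step (P i) (Q i) (Q (sigma i)).
Hypothesis P_step : forall i, good i -> exchange_step (Q i) (P i) (P (tau i)).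

Fixpoint alternate i j :=
  if j is k.+1 then (if odd k then tau else sigma) (alternate i k) else i.

(** One parameter encodes both polynomials of a seed. Since [sigma] keeps P and [tau] keeps Q, a
    step replaces only the polynomial that the mutation changes, and the entries j and j + 1 both
    come from [alternate i j]. *)
Definition family i j := if odd j then P (alternate i j) else Q (alternate i j).

Lemma good_alternate i j : good i -> good (alternate i j).
Proof. by move=> gi; elim: j => [|j IH] //=; case: ifP => _; auto. Qed.

Lemma family_size i j : good i -> (1 < size (family i j))%N.
Proof. by move=> /(good_alternate j) gj; rewrite /family; case: ifP => _; auto. Qed.

Lemma family_prim i j : good i -> primitive (family i j).
Proof.
by move=> /(good_alternate j) gj; rewrite /family; case: ifP => _; [exact: P_prim|exact: Q_prim].
Qed.

Lemma family_step i j : good i -> exchange_step (family i j.+1) (family i j) (family i j.+2).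
Proof.
move=> /(good_alternate j) gj; rewrite /family /=; case: (odd j) => /=.
  by rewrite P_sigma Q_tau; exact: P_step.
by rewrite Q_tau P_sigma; exact: Q_step.
Qed.

End Family.

Section Orbit.

Variables (S : idomainType) (K : fieldType) (cst : {rmorphism S -> K}).
Variables (P : nat -> {poly S}) (x y : K).

Fixpoint orbit_pair j : K * K :=
  if j is k.+1 then
    let: (u, v) := orbit_pair k in (v, ev cst v (P k.+1) / u)
  else (x, y).

Definition orbit j := (orbit_pair j).1.

Lemma orbitSS j : orbit j.+2 = ev cst (orbit j.+1) (P j.+1) / orbit j.
Proof. by rewrite /orbit /=; case: (orbit_pair j). Qed.

End Orbit.

(** * Pentagons *)

Section PentagonFamily.

Variables (S : idomainType) (hS : ufd S).

Definition pent_par : Type := S * S * S * S * S.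
Implicit Types i : pent_par.

(* [pent_sigma] and [pent_tau] describe the mutation at the variable whose
   exchange polynomial is [pent_P], resp. [pent_Q]; likewise for [hex] and [oct]. *)
Definition pent_sigma i : pent_par := let: (A, B, C, D, E) := i in (A, E, D, C, B).
Definition pent_tau i : pent_par := let: (A, B, C, D, E) := i in (B, A, C, E, D).
Definition pent_P i : {poly S} := let: (A, B, C, D, E) := i in Poly [:: B * E; A].
Definition pent_Q i : {poly S} := let: (A, B, C, D, E) := i in Poly [:: D * E; C].

Definition pent_good i : Prop := let: (A, B, C, D, E) := i in
  [/\ A != 0, B != 0, C != 0, D != 0 & E != 0] /\
  [/\ coprime2 A B, coprime2 A E, coprime2 B D, coprime2 C D & coprime2 C E].

Lemma pent_good_sigma i : pent_good i -> pent_good (pent_sigma i).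
Proof. by case: i => [[[[A B] C] D] E] [[? ? ? ? ?] [? ? ? ? ?]]; do !split => //; exact: coprime2C. Qed.

Lemma pent_good_tau i : pent_good i -> pent_good (pent_tau i).
Proof. by case: i => [[[[A B] C] D] E] [[? ? ? ? ?] [? ? ? ? ?]]; do !split => //; exact: coprime2C. Qed.

Lemma pent_P_sigma i : pent_P (pent_sigma i) = pent_P i.
Proof. by case: i => [[[[A B] C] D] E] /=; rewrite mulrC. Qed.

Lemma pent_Q_tau i : pent_Q (pent_tau i) = pent_Q i.
Proof. by case: i => [[[[A B] C] D] E] /=; rewrite mulrC. Qed.

Lemma pent_P_size i : pent_good i -> (1 < size (pent_P i))%N.
Proof. by case: i => [[[[A B] C] D] E] [[? ? ? ? ?] _]; rewrite /= size_Poly_last. Qed.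

Lemma pent_Q_size i : pent_good i -> (1 < size (pent_Q i))%N.
Proof. by case: i => [[[[A B] C] D] E] [[? ? ? ? ?] _]; rewrite /= size_Poly_last. Qed.

Lemma pent_P_prim i : pent_good i -> primitive (pent_P i).
Proof.
case: i => [[[[A B] C] D] E] [_ [AB AE _ _ _]]; apply: primitive_linear => p ip pA.
by case/(irreducible_prime hS ip); [exact: AB pA|exact: AE pA].
Qed.

Lemma pent_Q_prim i : pent_good i -> primitive (pent_Q i).
Proof.
case: i => [[[[A B] C] D] E] [_ [_ _ _ CD CE]]; apply: primitive_linear => p ip pC.
by case/(irreducible_prime hS ip); [exact: CD pC|exact: CE pC].
Qed.

(** The reversed polynomial has the coefficients C B E and D E; the content to be removed is the
    common part E of the two constant terms. *)
Lemma pent_Q_step i : pent_good i ->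
  exchange_step (pent_P i) (pent_Q i) (pent_Q (pent_sigma i)).
Proof.
case: i => [[[[A B] C] D] E] [[? ? ? ? ?] _] /=; exists E => //.
rewrite scale_Poly rev_at_linear // coef_Poly /=.
by congr (Poly [:: _; _]); ring.
Qed.

Lemma pent_P_step i : pent_good i ->
  exchange_step (pent_Q i) (pent_P i) (pent_P (pent_tau i)).
Proof.
case: i => [[[[A B] C] D] E] [[? ? ? ? ?] _] /=; exists E => //.
rewrite scale_Poly rev_at_linear // coef_Poly /=.
by congr (Poly [:: _; _]); ring.
Qed.

Definition pent := family pent_sigma pent_tau pent_P pent_Q.

Lemma pent_size i j : pent_good i -> (1 < size (pent i j))%N.
Proof.
exact: (family_size pent_good_sigma pent_good_tau pent_P_size pent_Q_size).
Qed.

Lemma pent_prim i j : pent_good i -> primitive (pent i j).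
Proof.
exact: (family_prim pent_good_sigma pent_good_tau pent_P_prim pent_Q_prim).
Qed.

Lemma pent_step i j : pent_good i -> exchange_step (pent i j.+1) (pent i j) (pent i j.+2).
Proof.
exact: (family_step pent_good_sigma pent_good_tau pent_P_sigma pent_Q_tau
  pent_Q_step pent_P_step).
Qed.

(** These are the rescalings that absorb the one unit left free on a closed pentagon. *)
Lemma pent_rescale i u : u \is a GRing.unit -> pent_good i ->
  let: (A, B, C, D, E) := i in pent_good (A * 1, B * u, C * 1, D * u, E * u^-1).
Proof.
case: i => [[[[A B] C] D] E] uu [[A0 B0 C0 D0 E0] [AB AE BD CD CE]].
have u0 := unit_neq0 uu; have uv : u^-1 \is a GRing.unit by rewrite unitrV.
have u1 := unitr1 S.
split; split; rewrite ?mulf_neq0 ?oner_neq0 ?invr_eq0 //; exact: coprime2_unit.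
Qed.

(** E is the common part of p(0) and q(0), with cofactors B and D; the other coprimality conditions
    express that p and q are primitive. *)
Lemma pent_decomposition (p q : {poly S}) : size p = 2%N -> size q = 2%N ->
  exchange_poly p -> exchange_poly q ->
  exists i, [/\ pent_good i, p = pent_P i & q = pent_Q i].
Proof.
move=> sp sq [p0 hp _] [q0 hq _].
have [ep p1] := size2_Poly sp; have [eq_ q1] := size2_Poly sq.
have [E [B [D [eB eD E0 BD]]]] := coprime_extraction hS q`_0 p0.
exists (p`_1, B, q`_1, D, E).
have B0 : B != 0 by apply: contraNneq p0 => h; rewrite eB h mulr0.
have D0 : D != 0 by apply: contraNneq q0 => h; rewrite eD h mulr0.
have primp f : irreducible_elt f -> divides f p`_1 -> ~ divides f p`_0.
  move=> hf h1 h0; rewrite sp in hp; apply: (hp isT f hf) => k.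
  by case: k => [|[|k]] //; rewrite nth_default ?sp //; exact: divides0.
have primq f : irreducible_elt f -> divides f q`_1 -> ~ divides f q`_0.
  move=> hf h1 h0; rewrite sq in hq; apply: (hq isT f hf) => k.
  by case: k => [|[|k]] //; rewrite nth_default ?sq //; exact: divides0.
split.
- split; first by split.
  split => // f hf h1 h2.
  + by apply: (primp f hf h1); rewrite eB; exact: divides_mull.
  + by apply: (primp f hf h1); rewrite eB; exact: divides_mulr.
  + by apply: (primq f hf h1); rewrite eD; exact: divides_mull.
  + by apply: (primq f hf h1); rewrite eD; exact: divides_mulr.
- by rewrite /= mulrC -eB.
- by rewrite /= mulrC -eD.
Qed.

End PentagonFamily.

(** The conclusion says that x4 precedes x0. Applied to the sequence shifted by one it gives x5 x2 =
    A x1 + B E = x0 x2, hence x5 = x0. *)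
Lemma pent_closing (K : fieldType) (A B C D E x0 x1 x2 x3 x4 : K) : x2 != 0 ->
  x2 * x0 = A * x1 + B * E -> x3 * x1 = D * x2 + C * B -> x4 * x2 = E * x3 + A * C ->
  x4 * x1 = C * x0 + D * E.
Proof.
move=> x20 h2 h3 h4; apply: (mulfI x20); apply/eqP; rewrite -subr_eq0.
have -> : x2 * (x4 * x1) - x2 * (C * x0 + D * E) =
  x1 * (x4 * x2 - (E * x3 + A * C)) + E * (x3 * x1 - (D * x2 + C * B))
    - C * (x2 * x0 - (A * x1 + B * E)) by ring.
by rewrite h2 h3 h4 !subrr !mulr0 subr0 addr0.
Qed.

Section PentagonSystem.

Variables (S : idomainType) (hS : ufd S) (K : fieldType) (cst : {rmorphism S -> K}).
Variables (T : eqType) (A : exchange_system cst T).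
Local Notation seed := (seed A).
Local Notation data := (data A).

Lemma pentagon_seeds X x y p q : seed X -> data X x y p q ->
  size p = 2%N -> size q = 2%N ->
  exists (i : pent_par S) (z : nat -> K) (Y : nat -> T),
  [/\ pent_good i, z 5%N = z 0%N,
    forall j, (j < 5)%N -> data (Y j) (z j) (z j.+1) (pent i j.+1) (pent i j) &
    forall W, seed W <-> W \in [seq Y j | j <- iota 0 5]].
Proof.
move=> sX D sp sq.
have [[[[[b0 b] c] d] e] [gi ep eq_]] := pent_decomposition hS sp sq (data_poly D) (data_poly (data_sym D)).
set i := (b0, b, c, d, e) in gi ep eq_.
pose P := pent i; pose xx := orbit cst P x y.
have DX : data X (xx 0%N) (xx 1%N) (P 1%N) (P 0%N).
  have -> : P 1%N = p by rewrite ep; exact: pent_P_sigma.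
  have -> : P 0%N = q by rewrite eq_.
  exact: D.
(* The period is odd, so this equates a [pent_P] with the [pent_Q] of i: after five steps the two
   roles are exchanged. *)
have E5 : P 5%N = P 0%N.
  rewrite /P /pent /family /i /=.
  by rewrite [d * e]mulrC.
have E6 : P 6%N = P 1%N.
  rewrite /P /pent /family /i /=.
  by [].
have hxx := orbitSS cst P x y; rewrite -/xx in hxx.
have hclose : (forall j, xx j != 0) -> xx 5%N = xx 0%N /\ xx 6%N = xx 1%N.
  move=> x0.
  have hm j : xx j.+2 * xx j = ev cst (xx j.+1) (P j.+1) by rewrite hxx divfK.
  move: (hm 0%N) (hm 1%N) (hm 2%N) (hm 3%N) (hm 4%N).
  rewrite /P /pent /family /i /=.
  rewrite !ev_linear !rmorphM => h2 h3 h4 h5 h6.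
  have h41 : xx 4%N * xx 1%N = cst c * xx 0%N + cst d * cst e.
    by apply: (@pent_closing _ (cst b0) (cst b) (cst c) (cst d) (cst e) _ _ (xx 2%N) (xx 3%N)) => //;
      [rewrite h2|rewrite h3|rewrite h4]; ring.
  have h52 : xx 5%N * xx 2%N = cst b0 * xx 1%N + cst b * cst e.
    rewrite (@pent_closing _ (cst d) (cst c) (cst b0) (cst e) (cst b) (xx 1%N) (xx 2%N) (xx 3%N) (xx 4%N) (xx 5%N)) //;
      [ring|rewrite h3|rewrite h4|rewrite h5]; ring.
  have e5 : xx 5%N = xx 0%N.
    by apply: (mulIf (x0 2%N)); rewrite h52 [RHS]mulrC h2; ring.
  split=> //; apply: (mulIf (x0 4%N)); rewrite h6 e5 [RHS]mulrC h41; ring.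
have hsz j : (1 < size (P j))%N by exact: pent_size.
have hpr j : primitive (P j) by exact: pent_prim.
have hst j : exchange_step (P j.+1) (P j) (P j.+2) by exact: pent_step.
have hclose' : xx 5%N = xx 0%N /\ xx 6%N = xx 1%N.
  apply: hclose => j.
  exact: (walk_neq0 hS hsz hpr hst hxx j sX DX).
have [Y [v [a [[v0 v1 v5 v6] vu ha [a0 a1 a5 a6] [hY hW]]]]] :=
  closed_walk hS hsz hpr hst hxx sX DX (isT : (0 < 5)%N) E5 E6 hclose'.1 hclose'.2.
have cinj := data_cst_inj D.
(* The relations a_(j+1) = v_(j+2) v_j, with units 1 at both ends, leave v_3 as the only free
   unit. *)
have v2 : v 2%N = 1 by rewrite -a1 (ha 0%N) // v0 mulr1.
have v4 : v 4%N = 1 by rewrite -a5 (ha 4%N) // v6 mul1r.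
have a2 : a 2%N = v 3%N by rewrite (ha 1%N) // v1 mulr1.
have a3 : a 3%N = 1 by rewrite (ha 2%N) // v4 v2 mulr1.
have a4 : a 4%N = v 3%N by rewrite (ha 3%N) // v5 mul1r.
have u3 := vu 3%N isT; set u := v 3%N in u3 a2 a4.
(* The exponents of u are found by matching the coefficients of the twisted polynomials with those
   of a pentagon. *)
pose i' : pent_par S := (b0 * 1, b * u, c * 1, d * u, e * u^-1).
have gauge j : (j <= 5)%N -> twist (a j) (v j) (P j) = pent i' j.
  have n0 : cst u != 0 by exact: cst_unit_neq0.
  rewrite /P /pent /family /i; case: j => [|[|[|[|[|[|j]]]]]] // _ /=;
    rewrite twist_linear ?v0 ?v1 ?v2 ?v4 ?v5 ?a0 ?a1 ?a2 ?a3 ?a4 ?a5 -/u;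
    congr (Poly [:: _; _]); apply: cinj;
    rewrite !rmorphM ?rmorphV ?unitr1 //= ?rmorph1 ?invr1 ?mulr1 ?mul1r; by field.
exists i', (fun j => cst (v j) * xx j), Y; split => //.
- exact: (pent_rescale u3 gi).
- by rewrite v5 v0 hclose'.1.
- move=> j hj; have := hY j (ltnW hj); rewrite !gauge //; exact: ltnW.
Qed.

End PentagonSystem.

(** * Hexagons *)

Section HexagonFamily.

Variables (S : idomainType) (hS : ufd S).

Definition hex_par : Type := S * S * S * S * S * S * S.
Implicit Types i : hex_par.

Definition hex_sigma i : hex_par :=
  let: (A, B, C, D, E, F, G) := i in (A, B, F, E, D, C, G).
Definition hex_tau i : hex_par :=
  let: (A, B, C, D, E, F, G) := i in (C, B, A, D, G, F, E).
Definition hex_P i : {poly S} :=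
  let: (A, B, C, D, E, F, G) := i in Poly [:: C * F * G ^+ 2; B * G; A].
Definition hex_Q i : {poly S} :=
  let: (A, B, C, D, E, F, G) := i in Poly [:: E * F * G; D].

Definition hex_good i : Prop := let: (A, B, C, D, E, F, G) := i in
  [/\ [/\ A != 0, C != 0, D != 0 & E != 0], F != 0 & G != 0] /\
  [/\ coprime2 A G /\ coprime2 C E, [/\ coprime2 D E, coprime2 D F & coprime2 D G],
      coprime2 E G & [/\ coprime3 A B C, coprime3 A B F & coprime3 B C F]].

Lemma hex_good_sigma i : hex_good i -> hex_good (hex_sigma i).
Proof.
case: i => [[[[[[A B] C] D] E] F] G] [[[? ? ? ?] ? ?] [[? ?] [? ? ?] ? [? ? h]]].
do !split => //; try exact: coprime2C.
by move=> p ip pB pF /(h p ip pB).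
Qed.

Lemma hex_good_tau i : hex_good i -> hex_good (hex_tau i).
Proof.
case: i => [[[[[[A B] C] D] E] F] G] [[[? ? ? ?] ? ?] [[? ?] [? ? ?] ? [h1 h2 h3]]].
do !split => //; try exact: coprime2C.
- by move=> p ip pC pB pA; exact: h1 pA pB pC.
- by move=> p ip pC pB pA; exact: h3 pB pC pA.
- by move=> p ip pC pB pA; exact: h2 pB pC pA.
Qed.

Lemma hex_P_sigma i : hex_P (hex_sigma i) = hex_P i.
Proof. by case: i => [[[[[[A B] C] D] E] F] G] /=; rewrite [F * C]mulrC. Qed.

Lemma hex_Q_tau i : hex_Q (hex_tau i) = hex_Q i.
Proof. by case: i => [[[[[[A B] C] D] E] F] G] /=; congr (Poly [:: _; _]); ring. Qed.

Lemma hex_P_size i : hex_good i -> (1 < size (hex_P i))%N.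
Proof. by case: i => [[[[[[A B] C] D] E] F] G] [[[? ? ? ?] ? ?] _]; rewrite /= size_Poly_last. Qed.

Lemma hex_Q_size i : hex_good i -> (1 < size (hex_Q i))%N.
Proof. by case: i => [[[[[[A B] C] D] E] F] G] [[[? ? ? ?] ? ?] _]; rewrite /= size_Poly_last. Qed.

Lemma hex_P_prim i : hex_good i -> primitive (hex_P i).
Proof.
case: i => [[[[[[A B] C] D] E] F] G] [_ [[AG _] _ _ [ABC ABF _]]].
apply: primitive_quadratic => p ip pA.
case/(irreducible_prime hS ip) => [pB|/(AG _ ip pA)] //.
case/(irreducible_prime hS ip) => [|/(irreducible_prime_exp hS ip)]; last exact: AG pA.
by case/(irreducible_prime hS ip); [exact: ABC pA pB|exact: ABF pA pB].
Qed.

Lemma hex_Q_prim i : hex_good i -> primitive (hex_Q i).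
Proof.
case: i => [[[[[[A B] C] D] E] F] G] [_ [_ [DE DF DG] _ _]].
apply: primitive_linear => p ip pD.
case/(irreducible_prime hS ip) => [|]; last exact: DG pD.
by case/(irreducible_prime hS ip); [exact: DE pD|exact: DF pD].
Qed.

Lemma hex_Q_step i : hex_good i ->
  exchange_step (hex_P i) (hex_Q i) (hex_Q (hex_sigma i)).
Proof.
case: i => [[[[[[A B] C] D] E] F] G] [[[? ? ? ?] ? ?] _] /=.
exists (F * G); first by rewrite mulf_neq0.
rewrite scale_Poly rev_at_linear // coef_Poly /=.
by congr (Poly [:: _; _]); ring.
Qed.

(** The coefficients A (E F G)^2, B G (E F G) and C F G^2 share F G^2; the quotient is a quadratic
    of the same shape with E in place of G and A, C exchanged. *)
Lemma hex_P_step i : hex_good i ->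
  exchange_step (hex_Q i) (hex_P i) (hex_P (hex_tau i)).
Proof.
case: i => [[[[[[A B] C] D] E] F] G] [[[? ? ? ?] ? ?] _] /=.
exists (F * G ^+ 2); first by rewrite mulf_neq0 ?expf_neq0.
rewrite scale_Poly rev_at_quadratic // coef_Poly /=.
by congr (Poly [:: _; _; _]); ring.
Qed.

Definition hex := family hex_sigma hex_tau hex_P hex_Q.

Lemma hex_size i j : hex_good i -> (1 < size (hex i j))%N.
Proof.
exact: (family_size hex_good_sigma hex_good_tau hex_P_size hex_Q_size).
Qed.

Lemma hex_prim i j : hex_good i -> primitive (hex i j).
Proof.
exact: (family_prim hex_good_sigma hex_good_tau hex_P_prim hex_Q_prim).
Qed.

Lemma hex_step i j : hex_good i -> exchange_step (hex i j.+1) (hex i j) (hex i j.+2).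
Proof.
exact: (family_step hex_good_sigma hex_good_tau hex_P_sigma hex_Q_tau
  hex_Q_step hex_P_step).
Qed.

Lemma hex_rescale i u v : u \is a GRing.unit -> v \is a GRing.unit -> hex_good i ->
  let: (A, B, C, D, E, F, G) := i in
  hex_good (A * 1, B * (v / u), C * v, D * 1, E * u, F * (v * u^-1 ^+ 2), G * (u / v)).
Proof.
case: i => [[[[[[A B] C] D] E] F] G] uu uv [[[? ? ? ?] ? ?] [[? ?] [? ? ?] ? [? ? ?]]].
have u1 := unitr1 S; have u0 := unit_neq0 uu; have v0 := unit_neq0 uv.
have e1 : v / u \is a GRing.unit by rewrite unitrM uv unitrV.
have e2 : u / v \is a GRing.unit by rewrite unitrM uu unitrV.
have e3 : v * u^-1 ^+ 2 \is a GRing.unit by rewrite unitrM uv unitrX ?unitrV.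
have e4 := unit_neq0 e1; have e5 := unit_neq0 e2; have e6 := unit_neq0 e3.
do !split; rewrite ?mulf_neq0 ?oner_neq0 ?expf_neq0 ?invr_eq0 //;
  solve [exact: coprime2_unit | exact: coprime3_unit].
Qed.

(* A prime dividing B, C and F is moved into G. *)
Lemma hex_reduction n (B C E F G : S) : F != 0 -> factors_le n F ->
  coprime2 E C -> coprime2 E G ->
  exists B' C' F' G', [/\ B' * G' = B * G, C' * F' * G' ^+ 2 = C * F * G ^+ 2,
    F' * G' = F * G, coprime2 E C' /\ coprime2 E G' & coprime3 B' C' F'].
Proof.
elim: n B C F G => [|n IH] B C F G F0 hF EC EG;
  (have [[p [ip [B1 eB] [C1 eC] [F1 eF]]]|h] := classic (exists p,
    [/\ irreducible_elt p, divides p B, divides p C & divides p F]); last first).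
- by exists B, C, F, G; split => // p ip pB pC pF; apply: h; exists p.
- by have [|m] := factors_le_mulS (p := p) (a := F1) (n := 0) ip; rewrite // mulrC -eF.
- by exists B, C, F, G; split => // p ip pB pC pF; apply: h; exists p.
have F10 : F1 != 0 by apply: contraNneq F0 => h; rewrite eF h mul0r.
have [m [em] hm] := factors_le_mulS ip (eq_ind _ (factors_le n.+1) hF _ (etrans eF (mulrC _ _))).
rewrite -em in hm.
have pC : divides p C by exists C1.
have [|f hf hE|B' [C' [F' [G' [h1 h2 h3 h4 h5]]]]] := IH B1 C1 F1 (G * p) F10 hm.
- by move=> f hf hE hC; apply: (EC f hf hE); rewrite eC; exact: divides_mulr.
- case/(irreducible_prime hS hf); first exact: EG hE.
  by move=> hfp; apply: (EC f hf hE); exact: divides_trans hfp pC.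
exists B', C', F', G'; split => //; rewrite ?h1 ?h2 ?h3 ?eB ?eC ?eF; ring.
Qed.

(** The common part F0 of the constant terms gives q(0) = E F0 and p(0) = C0 F0. The reduction,
    started with G = 1, splits F0 into F G so that p(0) = C F G^2 and the middle coefficient is B G;
    the middle coefficient may be zero. *)
Lemma hex_decomposition (p q : {poly S}) : size p = 3%N -> size q = 2%N ->
  exchange_poly p -> exchange_poly q ->
  exists i, [/\ hex_good i, p = hex_P i & q = hex_Q i].
Proof.
move=> sp sq [p0 hp _] [q0 hq _].
have [ep p2] := size3_Poly sp; have [eq_ q1] := size2_Poly sq.
have [F0 [E [C0 [eE eC F00 EC]]]] := coprime_extraction hS p`_0 q0.
have [n hn] := exists_factors_le hS F00.
have [|B [C [F [G [e1 e2 e3 [EC' EG] BCF]]]]] :=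
  @hex_reduction n p`_1 C0 E F0 1 F00 hn EC.
  by move=> f hf _ /(irreducible_ndvd1 hf).
rewrite mulr1 in e1; rewrite expr1n mulr1 [C0 * _]mulrC -eC in e2; rewrite mulr1 in e3.
have e4 : E * F * G = q`_0 by rewrite -mulrA e3 mulrC -eE.
exists (p`_2, B, C, q`_1, E, F, G).
have C00 : C != 0 by apply: contraNneq p0 => h; rewrite -e2 h !mul0r.
have F0' : F != 0 by apply: contraNneq p0 => h; rewrite -e2 h mulr0 mul0r.
have G0 : G != 0 by apply: contraNneq p0 => h; rewrite -e2 h expr0n mulr0.
have E0 : E != 0 by apply: contraNneq q0 => h; rewrite -e4 h !mul0r.
have primp f : irreducible_elt f -> divides f p`_2 -> divides f p`_1 -> ~ divides f p`_0.
  rewrite sp in hp; move=> hf h2 h1 h0; apply: (primitive_divides (hp isT) hf).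
  by rewrite sp => -[|[|[|]]].
have primq f : irreducible_elt f -> divides f q`_1 -> ~ divides f q`_0.
  rewrite sq in hq; move=> hf h1 h0; apply: (primitive_divides (hq isT) hf).
  by rewrite sq => -[|[|]].
split; last 2 first.
- by rewrite {1}ep /= -e1 -e2.
- by rewrite {1}eq_ /= -e4.
split; first by do !split.
split => //; last split => //.
- split; last exact: coprime2C.
  move=> f hf hA hG; apply: (primp f hf hA); rewrite -?e1 -?e2.
    exact: divides_mull.
  by rewrite expr2; apply/divides_mull/divides_mull.
- split=> f hf hD h; apply: (primq f hf hD); rewrite -e4.
  + by rewrite -mulrA; exact: divides_mulr.
  + exact/divides_mulr/divides_mull.
  + exact: divides_mull.
- move=> f hf hA hB hC; apply: (primp f hf hA); rewrite -?e1 -?e2; first exact: divides_mulr.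
  by rewrite -mulrA; exact: divides_mulr.
- move=> f hf hA hB hF; apply: (primp f hf hA); rewrite -?e1 -?e2; first exact: divides_mulr.
  exact/divides_mulr/divides_mull.
Qed.

End HexagonFamily.

(* [t] is the variable preceding [x0]; the conclusion says that it also follows
   [x4]. *)
Lemma hex_closing (K : fieldType) (A B C D E F G t x0 x1 x2 x3 x4 : K) :
  x1 != 0 -> x2 != 0 -> E != 0 ->
  t * x1 = D * x0 + E * F * G -> x2 * x0 = A * x1 ^+ 2 + B * G * x1 + C * F * G ^+ 2 ->
  x3 * x1 = E * x2 + D * C * G -> x4 * x2 = F * x3 ^+ 2 + B * D * x3 + A * C * D ^+ 2 ->
  x3 * t = G * x4 + E * A * D.
Proof.
move=> x10 x20 E0 h0 h1 h2 h3.
(* The factor x1 x3 - D C G is E x2; multiplied by it, t becomes a polynomial in x1 and x3. *)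
have e1 : t * (x1 * x3 - D * C * G) = E * F * G * x3 + D * E * (A * x1 + B * G).
  apply: (mulfI x10); apply/eqP; rewrite -subr_eq0.
  have -> : x1 * (t * (x1 * x3 - D * C * G)) - x1 * (E * F * G * x3 + D * E * (A * x1 + B * G)) =
    (t * x1 - (D * x0 + E * F * G)) * (x1 * x3 - D * C * G)
    + D * x0 * (x3 * x1 - (E * x2 + D * C * G))
    + D * E * (x2 * x0 - (A * x1 ^+ 2 + B * G * x1 + C * F * G ^+ 2))
    - E * F * G * 0 by ring.
  by rewrite h0 h1 h2 !subrr !mulr0 !mul0r !addr0 subr0.
apply: (mulfI (mulf_neq0 E0 x20)); apply/eqP; rewrite -subr_eq0.
have -> : E * x2 * (x3 * t) - E * x2 * (G * x4 + E * A * D) =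
  x3 * (t * (x1 * x3 - D * C * G) - (E * F * G * x3 + D * E * (A * x1 + B * G)))
  - E * G * (x4 * x2 - (F * x3 ^+ 2 + B * D * x3 + A * C * D ^+ 2))
  - (x3 * t - E * A * D) * (x3 * x1 - (E * x2 + D * C * G)) by ring.
by rewrite e1 h2 h3 !subrr !mulr0 !subr0.
Qed.

Section HexagonSystem.

Variables (S : idomainType) (hS : ufd S) (K : fieldType) (cst : {rmorphism S -> K}).
Variables (T : eqType) (A : exchange_system cst T).
Local Notation seed := (seed A).
Local Notation data := (data A).

Lemma hexagon_seeds X x y p q : seed X -> data X x y p q ->
  size p = 3%N -> size q = 2%N ->
  exists (i : hex_par S) (z : nat -> K) (Y : nat -> T),
  [/\ hex_good i, z 6%N = z 0%N,
    forall j, (j < 6)%N -> data (Y j) (z j) (z j.+1) (hex i j.+1) (hex i j) &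
    forall W, seed W <-> W \in [seq Y j | j <- iota 0 6]].
Proof.
move=> sX D0 sp sq.
have [[[[[[[b0 b] c] d] e] f] g] [gi ep eq_]] :=
  hex_decomposition hS sp sq (data_poly D0) (data_poly (data_sym D0)).
set i := (b0, b, c, d, e, f, g) in gi ep eq_.
pose P := hex i; pose xx := orbit cst P x y.
have cinj := data_cst_inj D0.
have DX : data X (xx 0%N) (xx 1%N) (P 1%N) (P 0%N).
  have -> : P 1%N = p by rewrite ep; exact: hex_P_sigma.
  have -> : P 0%N = q by rewrite eq_.
  exact: D0.
have E6 : P 6%N = P 0%N by [].
have E7 : P 7%N = P 1%N by [].
have hxx : forall j, xx j.+2 = ev cst (xx j.+1) (P j.+1) / xx j by exact: orbitSS.
clearbody xx.
have hsz j : (1 < size (P j))%N by exact: hex_size.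
have hpr j : primitive (P j) by exact: hex_prim.
have hst j : exchange_step (P j.+1) (P j) (P j.+2) by exact: hex_step.
have x0 j : xx j != 0 := walk_neq0 hS hsz hpr hst hxx j sX DX.
have [x6 x7] : xx 6%N = xx 0%N /\ xx 7%N = xx 1%N.
  have [[[_ _ d0 e0] _ g0] _] := gi.
  have cn a : a != 0 -> cst a != 0 by exact: cst_neq0 (data_indep D0) _.
  have hm j : xx j.+2 * xx j = ev cst (xx j.+1) (P j.+1) by rewrite hxx divfK.
  move: (hm 0%N) (hm 1%N) (hm 2%N) (hm 3%N) (hm 4%N) (hm 5%N).
  rewrite /P /hex /family /i /= !ev_linear !ev_quadratic !(rmorphM, rmorphXn) /= => h2 h3 h4 h5 h6 h7.
  (* The predecessor of x0 satisfies, by [hex_closing], the relation that defines x5, so the two are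
     equal. *)
  have h51 : xx 5%N * xx 1%N = cst d * xx 0%N + cst e * cst f * cst g.
    have e5 : xx 5%N = (cst d * xx 0%N + cst e * cst f * cst g) / xx 1%N.
      apply: (mulfI (x0 3%N)); rewrite [LHS]mulrC h5.
      rewrite (@hex_closing _ (cst b0) (cst b) (cst c) (cst d) (cst e) (cst f) (cst g) _
        (xx 0%N) (xx 1%N) (xx 2%N) (xx 3%N) (xx 4%N)) ?divfK ?cn //;
        [ring|rewrite h2|rewrite h3|rewrite h4]; ring.
    by rewrite e5 divfK.
  (* The same identity shifted by two, with x1 as the predecessor of x2; comparing both values gives
     x6 = x0. *)
  have h51' : xx 5%N * xx 1%N = cst d * xx 6%N + cst e * cst f * cst g.
    rewrite (@hex_closing _ (cst f) (cst b) (cst b0) (cst e) (cst g) (cst c) (cst d) _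
        (xx 2%N) (xx 3%N) (xx 4%N) (xx 5%N) (xx 6%N)) ?cn //;
        [ring|rewrite mulrC h3|rewrite h4|rewrite h5|rewrite h6]; ring.
  have e6 : xx 6%N = xx 0%N.
    by apply: (mulfI (cn _ d0)); apply: (addIr (cst e * cst f * cst g)); rewrite -h51' h51.
  split=> //; apply: (mulIf (x0 5%N)); rewrite h7 e6 [RHS]mulrC h51; ring.
have [Y [v [a [[v0 v1 v6 v7] vu ha [a0 a1 a6 a7] [hY hW]]]]] :=
  closed_walk hS hsz hpr hst hxx sX DX (isT : (0 < 6)%N) E6 E7 x6 x7.
have v2 : v 2%N = 1 by rewrite -a1 (ha 0%N) // v0 mulr1.
have v5 : v 5%N = 1 by rewrite -a6 (ha 5%N) // v7 mul1r.
have a2 : a 2%N = v 3%N by rewrite (ha 1%N) // v1 mulr1.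
have a3 : a 3%N = v 4%N by rewrite (ha 2%N) // v2 mulr1.
have a4 : a 4%N = v 3%N by rewrite (ha 3%N) // v5 mul1r.
have a5 : a 5%N = v 4%N by rewrite (ha 4%N) // v6 mul1r.
have u3 := vu 3%N isT; have u4 := vu 4%N isT.
set u := v 3%N in u3 a2 a4; set w := v 4%N in u4 a3 a5.
(* The two free units are v_3 and v_4; their exponents come from matching coefficients. *)
pose i' : hex_par S := (b0 * 1, b * (w / u), c * w, d * 1, e * u, f * (w * u^-1 ^+ 2), g * (u / w)).
have gauge j : (j <= 6)%N -> twist (a j) (v j) (P j) = hex i' j.
  have n0 : cst u != 0 by exact: cst_unit_neq0.
  have m0 : cst w != 0 by exact: cst_unit_neq0.
  rewrite /P /hex /family /i; case: j => [|[|[|[|[|[|[|j]]]]]]] // _ /=;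
    rewrite ?twist_linear ?twist_quadratic ?v0 ?v1 ?v2 ?v5 ?v6 ?a0 ?a1 ?a2 ?a3 ?a4 ?a5 ?a6 -/u -/w;
    (first [congr (Poly [:: _; _; _]) | congr (Poly [:: _; _])]); apply: cinj;
    rewrite !(rmorphM, rmorphXn) ?rmorphV ?unitr1 //= ?rmorph1 ?invr1 ?expr1n ?mulr1 ?mul1r;
    by field; rewrite ?n0 ?m0.
exists i', (fun j => cst (v j) * xx j), Y; split => //.
- exact: (hex_rescale u3 u4 gi).
- by rewrite v6 v0 x6.
- move=> j hj; have := hY j (ltnW hj); rewrite !gauge //; exact: ltnW.
Qed.

End HexagonSystem.

(** * Octagons *)

Lemma divides_exp (R : idomainType) (f a : R) n : (0 < n)%N -> divides f a -> divides f (a ^+ n).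
Proof. by case: n => // n _ h; rewrite exprS; exact: divides_mulr. Qed.

Ltac dvd := match goal with
  | |- divides _ (_ * _) => first [apply: divides_mulr; dvd | apply: divides_mull; dvd]
  | |- divides _ (_ ^+ _) => apply: divides_exp; [done | dvd]
  | _ => assumption
  end.

Section OctagonFamily.

Variables (S : idomainType) (hS : ufd S).

Definition oct_par : Type := S * S * S * S * S * S * S * S * S * S.
Implicit Types i : oct_par.

Definition oct_sigma i : oct_par :=
  let: (A, B, C, D, E, F, G, H, K, L) := i in (A, B, C, G, F, E, D, H, L, K).
Definition oct_tau i : oct_par :=
  let: (A, B, C, D, E, F, G, H, K, L) := i in (D, C, B, A, E, K, H, G, F, L).
Definition oct_P i : {poly S} :=
  let: (A, B, C, D, E, F, G, H, K, L) := i in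
  Poly [:: D * G * H ^+ 2 * K ^+ 3 * L ^+ 3; C * H * K ^+ 2 * L ^+ 2; B * K * L; A].
Definition oct_Q i : {poly S} :=
  let: (A, B, C, D, E, F, G, H, K, L) := i in Poly [:: F * G * H * K * L ^+ 2; E].

Definition oct_good i : Prop := let: (A, B, C, D, E, F, G, H, K, L) := i in
  [/\ [/\ A != 0, D != 0, E != 0 & F != 0], [/\ G != 0, H != 0, K != 0 & L != 0] &
  [/\ [/\ coprime2 A K, coprime2 A L, coprime2 D F & coprime2 D L],
      [/\ coprime2 E F, coprime2 E G, coprime2 E H, coprime2 E K & coprime2 E L],
      [/\ coprime2 F H, coprime2 F K, coprime2 F L, coprime2 G K & coprime2 K L],
      coprime3 A B H /\ coprime3 C D G &
      [/\ coprime4 A B C D, coprime4 A B C G, coprime4 B C D H & coprime4 B C G H]]].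

Lemma oct_good_sigma i : oct_good i -> oct_good (oct_sigma i).
Proof.
case: i => [[[[[[[[[A B] C] D] E] F] G] H] K] L] [[? ? ? ?] [? ? ? ?]
  [[? ? ? ?] [? ? ? ? ?] [? ? ? ? ?] [? h] [? ? h1 h2]]].
do !split => //; try exact: coprime2C.
by move=> p ip pC pG pD; exact: h pC pD pG.
Qed.

Lemma oct_good_tau i : oct_good i -> oct_good (oct_tau i).
Proof.
case: i => [[[[[[[[[A B] C] D] E] F] G] H] K] L] [[? ? ? ?] [? ? ? ?]
  [[? ? ? ?] [? ? ? ? ?] [? ? ? ? ?] [h1 h2] [h3 h4 h5 h6]]].
do !split => //; try exact: coprime2C.
- by move=> p ip p1 p2 p3; exact: h2 p2 p1 p3.
- by move=> p ip p1 p2 p3; exact: h1 p2 p1 p3.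
- by move=> p ip p1 p2 p3 p4; exact: h3 p4 p3 p2 p1.
- by move=> p ip p1 p2 p3 p4; exact: h5 p3 p2 p1 p4.
- by move=> p ip p1 p2 p3 p4; exact: h4 p3 p2 p1 p4.
- by move=> p ip p1 p2 p3 p4; exact: h6 p2 p1 p4 p3.
Qed.

Lemma oct_P_sigma i : oct_P (oct_sigma i) = oct_P i.
Proof.
case: i => [[[[[[[[[A B] C] D] E] F] G] H] K] L] /=.
by congr (Poly [:: _; _; _; _]); ring.
Qed.

Lemma oct_Q_tau i : oct_Q (oct_tau i) = oct_Q i.
Proof.
case: i => [[[[[[[[[A B] C] D] E] F] G] H] K] L] /=.
by congr (Poly [:: _; _]); ring.
Qed.

Lemma oct_P_size i : oct_good i -> (1 < size (oct_P i))%N.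
Proof.
by case: i => [[[[[[[[[A B] C] D] E] F] G] H] K] L] [[? ? ? ?] _ _]; rewrite /= size_Poly_last.
Qed.

Lemma oct_Q_size i : oct_good i -> (1 < size (oct_Q i))%N.
Proof.
by case: i => [[[[[[[[[A B] C] D] E] F] G] H] K] L] [[? ? ? ?] _ _]; rewrite /= size_Poly_last.
Qed.

Lemma oct_P_prim i : oct_good i -> primitive (oct_P i).
Proof.
case: i => [[[[[[[[[A B] C] D] E] F] G] H] K] L] [_ _ [[AK AL _ _] _ _ [ABH _] [ABCD ABCG _ _]]].
apply: primitive_cubic => p ip pA.
have pr := irreducible_prime hS ip; have pe := irreducible_prime_exp hS ip.
have nK := AK p ip pA; have nL := AL p ip pA.
case/pr => [/pr[pB|//]|//].
case/pr => [/pr[/pr[pC|pH]|/pe//]|/pe//]; last by case: (ABH p ip pA pB).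
case/pr => [/pr[/pr[/pr[]|/pe]|/pe//]|/pe//].
- exact: ABCD pA pB pC.
- exact: ABCG pA pB pC.
- exact: ABH pA pB.
Qed.

Lemma oct_Q_prim i : oct_good i -> primitive (oct_Q i).
Proof.
case: i => [[[[[[[[[A B] C] D] E] F] G] H] K] L] [_ _ [_ [EF EG EH EK EL] _ _ _]].
apply: primitive_linear => p ip pE.
have pr := irreducible_prime hS ip; have pe := irreducible_prime_exp hS ip.
case/pr => [/pr[/pr[/pr[]|]|]|/pe].
- exact: EF pE.
- exact: EG pE.
- exact: EH pE.
- exact: EK pE.
- exact: EL pE.
Qed.

Lemma oct_Q_step i : oct_good i ->
  exchange_step (oct_P i) (oct_Q i) (oct_Q (oct_sigma i)).
Proof.
case: i => [[[[[[[[[A B] C] D] E] F] G] H] K] L] [[? ? ? ?] [? ? ? ?] _] /=.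
exists (G * H * K * L ^+ 2); first by rewrite !mulf_neq0 ?expf_neq0.
rewrite scale_Poly rev_at_linear // coef_Poly /=.
by congr (Poly [:: _; _]); ring.
Qed.

(** Every coefficient of the reversed cubic contains G H^2 K^3 L^3; the quotient has the same shape
    with F in place of K and the other parameters permuted. *)
Lemma oct_P_step i : oct_good i ->
  exchange_step (oct_Q i) (oct_P i) (oct_P (oct_tau i)).
Proof.
case: i => [[[[[[[[[A B] C] D] E] F] G] H] K] L] [[? ? ? ?] [? ? ? ?] _] /=.
exists (G * H ^+ 2 * K ^+ 3 * L ^+ 3); first by rewrite !mulf_neq0 ?expf_neq0.
rewrite scale_Poly rev_at_cubic // coef_Poly /=.
by congr (Poly [:: _; _; _; _]); ring.
Qed.

Definition oct := family oct_sigma oct_tau oct_P oct_Q.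

Lemma oct_size i j : oct_good i -> (1 < size (oct i j))%N.
Proof.
exact: (family_size oct_good_sigma oct_good_tau oct_P_size oct_Q_size).
Qed.

Lemma oct_prim i j : oct_good i -> primitive (oct i j).
Proof.
exact: (family_prim oct_good_sigma oct_good_tau oct_P_prim oct_Q_prim).
Qed.

Lemma oct_step i j : oct_good i -> exchange_step (oct i j.+1) (oct i j) (oct i j.+2).
Proof.
exact: (family_step oct_good_sigma oct_good_tau oct_P_sigma oct_Q_tau
  oct_Q_step oct_P_step).
Qed.

Lemma oct_rescale i a b c d e f g h k l :
  [/\ a \is a GRing.unit, b \is a GRing.unit, c \is a GRing.unit, d \is a GRing.unit &
      e \is a GRing.unit] ->
  [/\ f \is a GRing.unit, g \is a GRing.unit, h \is a GRing.unit, k \is a GRing.unit &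
      l \is a GRing.unit] -> oct_good i ->
  let: (A, B, C, D, E, F, G, H, K, L) := i in
  oct_good (A * a, B * b, C * c, D * d, E * e, F * f, G * g, H * h, K * k, L * l).
Proof.
move=> [ua ub uc ud ue] [uf ug uh uk ul].
case: i => [[[[[[[[[A B] C] D] E] F] G] H] K] L] [[? ? ? ?] [? ? ? ?]
  [[? ? ? ?] [? ? ? ? ?] [? ? ? ? ?] [? ?] [? ? ? ?]]].
do !split; rewrite ?mulf_neq0 //;
  solve [exact: unit_neq0 | exact: coprime2_unit | exact: coprime3_unit | exact: coprime4_unit].
Qed.

(* A prime dividing C, D and G is moved into H. *)
Lemma oct_reduction1 n (C D F G H : S) : factors_le n G ->
  coprime2 F D -> coprime2 F H ->
  exists C' D' G' H', [/\ C' * H' = C * H, D' * G' * H' ^+ 2 = D * G * H ^+ 2,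
    G' * H' = G * H, coprime2 F D' /\ coprime2 F H' & coprime3 C' D' G'].
Proof.
elim: n C D G H => [|n IH] C D G H hG FD FH;
  (have [[p [ip [C1 eC] [D1 eD] [G1 eG]]]|h] := classic (exists p,
    [/\ irreducible_elt p, divides p C, divides p D & divides p G]); last first).
- by exists C, D, G, H; split => // p ip pC pD pG; apply: h; exists p.
- by have [|m] := factors_le_mulS (p := p) (a := G1) (n := 0) ip; rewrite // mulrC -eG.
- by exists C, D, G, H; split => // p ip pC pD pG; apply: h; exists p.
have [m [em] hm] := factors_le_mulS ip (eq_ind _ (factors_le n.+1) hG _ (etrans eG (mulrC _ _))).
rewrite -em in hm.
have pD : divides p D by exists D1.
have [f hf hF hD|f hf hF|C' [D' [G' [H' [h1 h2 h3 h4 h5]]]]] := IH C1 D1 G1 (H * p) hm.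
- by apply: (FD f hf hF); rewrite eD; dvd.
- case/(irreducible_prime hS hf); first exact: FH hF.
  by move=> hfp; apply: (FD f hf hF); exact: divides_trans hfp pD.
exists C', D', G', H'; split => //; rewrite ?h1 ?h2 ?h3 ?eC ?eD ?eG; ring.
Qed.

(* A prime dividing B, C, H and D (resp. G) is moved into K (resp. L). *)
Lemma oct_reduction2 n (B C D F G H K L : S) : factors_le n (D * G) ->
  [/\ coprime2 F D, coprime2 F H, coprime2 F K & coprime2 F L] ->
  [/\ coprime3 C D G, coprime2 G K, coprime2 D L & coprime2 K L] ->
  exists B' C' D' G' H' K' L',
  [/\ [/\ B' * K' * L' = B * K * L, C' * H' * K' ^+ 2 * L' ^+ 2 = C * H * K ^+ 2 * L ^+ 2,
        D' * G' * H' ^+ 2 * K' ^+ 3 * L' ^+ 3 = D * G * H ^+ 2 * K ^+ 3 * L ^+ 3 &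
        G' * H' * K' * L' ^+ 2 = G * H * K * L ^+ 2],
      [/\ coprime2 F D', coprime2 F H', coprime2 F K' & coprime2 F L'],
      [/\ coprime3 C' D' G', coprime2 G' K', coprime2 D' L' & coprime2 K' L'] &
      coprime4 B' C' D' H' /\ coprime4 B' C' G' H'].
Proof.
elim: n B C D G H K L => [|n IH] B C D G H K L hDG [FD FH FK FL] [CDG GK DL KL];
  (have [[p [ip [[B1 eB] [C1 eC]] pDG [H1 eH]]]|h] := classic (exists p,
    [/\ irreducible_elt p, divides p B /\ divides p C, divides p D \/ divides p G & divides p H]);
    last first).
- exists B, C, D, G, H, K, L; do !split => //; move=> p ip pB pC pD pH; apply: h; exists p.
    by split => //; left.
  by split => //; right.
- have [a ea] : divides p (D * G) by case: pDG => ?; dvd.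
  by have [|m] := factors_le_mulS (p := p) (a := a) (n := 0) ip; rewrite // mulrC -ea.
- exists B, C, D, G, H, K, L; do !split => //; move=> p ip pB pC pD pH; apply: h; exists p.
    by split => //; left.
  by split => //; right.
have pC : divides p C by exists C1.
have pH : divides p H by exists H1.
have pr (f : S) : irreducible_elt f -> forall a b : S, divides f (a * b) -> divides f a \/ divides f b.
  by move=> hf a b; exact: (irreducible_prime hS hf).
case: pDG => [pD|pG].
(* Dividing B, C, D and H by p takes p, p^2 and p^3 out of B, C H and D H^2, which matches the
   powers K, K^2 and K^3. *)
- have [D1 eD] := pD.
  have [m [em] hm] : exists2 m, n.+1 = m.+1 & factors_le m (D1 * G).
    by apply: (factors_le_mulS ip); rewrite mulrA [p * _]mulrC -eD.
  rewrite -em in hm.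
  have [||B' [C' [D' [G' [H' [K' [L' [[h1 h2 h3 h4] h5 h6 h7]]]]]]]] :=
    IH B1 C1 D1 G H1 (K * p) L hm.
  + split => // f hf hF h.
    * by apply: (FD f hf hF); rewrite eD; dvd.
    * by apply: (FH f hf hF); rewrite eH; dvd.
    * case/(pr f hf): h => [|h]; first exact: FK hF.
      exact: (FD f hf hF (divides_trans h pD)).
  + split => // [f hf h1 h2 h3|f hf h1 h2|f hf h1 h2|f hf h1 h2].
    * by apply: (CDG f hf _ _ h3); rewrite ?eC ?eD; dvd.
    (* The prime moved into K divides C and D, so the coprimality of C, D and G keeps it away from
       G. *)
    * case/(pr f hf): h2 => h2; first exact: (GK f hf h1 h2).
      exact: (CDG f hf (divides_trans h2 pC) (divides_trans h2 pD) h1).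
    * by apply: (DL f hf _ h2); rewrite eD; dvd.
    * case/(pr f hf): h1 => h1; first exact: (KL f hf h1 h2).
      exact: (DL f hf (divides_trans h1 pD) h2).
  exists B', C', D', G', H', K', L'; split => //.
  by split; rewrite ?h1 ?h2 ?h3 ?h4 ?eB ?eC ?eD ?eH; ring.
- have [G1 eG] := pG.
  have [m [em] hm] : exists2 m, n.+1 = m.+1 & factors_le m (D * G1).
    by apply: (factors_le_mulS ip); rewrite mulrCA [p * _]mulrC -eG.
  rewrite -em in hm.
  have [||B' [C' [D' [G' [H' [K' [L' [[h1 h2 h3 h4] h5 h6 h7]]]]]]]] :=
    IH B1 C1 D G1 H1 K (L * p) hm.
  + split => // f hf hF h.
    * by apply: (FH f hf hF); rewrite eH; dvd.
    * case/(pr f hf): h => [|h]; first exact: FL hF.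
      exact: (FH f hf hF (divides_trans h pH)).
  + split => // [f hf h1 h2 h3|f hf h1 h2|f hf h1 h2|f hf h1 h2].
    * by apply: (CDG f hf _ h2); rewrite ?eC ?eG; dvd.
    * by apply: (GK f hf _ h2); rewrite eG; dvd.
    * case/(pr f hf): h2 => h2; first exact: (DL f hf h1 h2).
      exact: (CDG f hf (divides_trans h2 pC) h1 (divides_trans h2 pG)).
    * case/(pr f hf): h2 => h2; first exact: (KL f hf h1 h2).
      exact: (GK f hf (divides_trans h2 pG) h1).
  exists B', C', D', G', H', K', L'; split => //.
  by split; rewrite ?h1 ?h2 ?h3 ?h4 ?eB ?eC ?eG ?eH; ring.
Qed.

(** The common part G0 of the constant terms is split by the first reduction into G H, and the
    second one extracts K and L; H, K and L start from 1. The remaining conditions come from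
    primitivity of p and q. *)
Lemma oct_decomposition (p q : {poly S}) : size p = 4%N -> size q = 2%N ->
  exchange_poly p -> exchange_poly q ->
  exists i, [/\ oct_good i, p = oct_P i & q = oct_Q i].
Proof.
move=> sp sq [p0 hp _] [q0 hq _].
have [ep p3] := size4_Poly sp; have [eq_ q1] := size2_Poly sq.
have [G0 [F [D0 [eF eD G00 FD]]]] := coprime_extraction hS p`_0 q0.
have nd1 (f : S) : irreducible_elt f -> ~ divides f 1 by exact: irreducible_ndvd1.
have [n hn] := exists_factors_le hS G00.
have [|C1 [D1 [G1 [H1 [e1 e2 e3 [FD1 FH1] CDG1]]]]] := @oct_reduction1 n p`_1 D0 F G0 1 hn FD.
  by move=> f hf _ /(nd1 f hf).
rewrite mulr1 in e1; rewrite expr1n mulr1 [D0 * _]mulrC -eD in e2; rewrite mulr1 in e3.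
have DG1 : D1 * G1 != 0 by apply: contraNneq p0 => h; rewrite -e2 h mul0r.
have [m hm] := exists_factors_le hS DG1.
have [||B [C [D [G [H [K [L [[h1 h2 h3 h4] [? ? ? ?] [? ? ? ?] [? ?]]]]]]]]] :=
  @oct_reduction2 m p`_2 C1 D1 F G1 H1 1 1 hm.
- by split => // f hf _ /(nd1 f hf).
- by split => // f hf ? /(nd1 f hf).
rewrite !mulr1 in h1; rewrite !expr1n !mulr1 e1 in h2; rewrite !expr1n !mulr1 e2 in h3.
rewrite expr1n !mulr1 e3 in h4.
have h5 : F * G * H * K * L ^+ 2 = q`_0 by rewrite eF -h4; ring.
exists (p`_3, B, C, D, q`_1, F, G, H, K, L).
have [D0' G0' H0 K0 L0] : [/\ D != 0, G != 0, H != 0, K != 0 & L != 0].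
  by split; apply: contraNneq p0 => h; rewrite -h3 h ?expr0n /= ?(mul0r, mulr0).
have F0 : F != 0 by apply: contraNneq q0 => h; rewrite -h5 h !mul0r.
have primp f : irreducible_elt f -> divides f p`_3 -> divides f p`_2 -> divides f p`_1 -> ~ divides f p`_0.
  rewrite sp in hp; move=> hf d3 d2 d1 d0; apply: (primitive_divides (hp isT) hf).
  by rewrite sp => -[|[|[|[|]]]].
have primq f : irreducible_elt f -> divides f q`_1 -> ~ divides f q`_0.
  rewrite sq in hq; move=> hf d1 d0; apply: (primitive_divides (hq isT) hf).
  by rewrite sq => -[|[|]].
split; last 2 first.
- by rewrite {1}ep /= -h1 -h2 -h3.
- by rewrite {1}eq_ /= -h5.
rewrite -h1 -h2 -h3 in primp; rewrite -h5 in primq.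
split; [by split|by split|].
split; [split|split|split|split|split] => //; try exact: coprime2C.
- by move=> f hf d1 d2; apply: (primp f hf d1); dvd.
- by move=> f hf d1 d2; apply: (primp f hf d1); dvd.
- by move=> f hf d1 d2; apply: (primq f hf d1); dvd.
- by move=> f hf d1 d2; apply: (primq f hf d1); dvd.
- by move=> f hf d1 d2; apply: (primq f hf d1); dvd.
- by move=> f hf d1 d2; apply: (primq f hf d1); dvd.
- by move=> f hf d1 d2; apply: (primq f hf d1); dvd.
- by move=> f hf d1 d2 d3; apply: (primp f hf d1); dvd.
- by move=> f hf d1 d2 d3 d4; apply: (primp f hf d1); dvd.
- by move=> f hf d1 d2 d3 d4; apply: (primp f hf d1); dvd.
Qed.

End OctagonFamily.

(* [t] is the variable preceding [x0]; the conclusion says that it also follows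
   [x6].  Eliminating x0, x2 and x4 expresses t and x5 as M / D1 and N / D1 with
   M, N and D1 polynomials in x1 and x3, which leaves an identity in x1 and x3. *)
Lemma oct_closing (K0 : fieldType) (A B C D E F G H K L t x0 x1 x2 x3 x4 x5 x6 : K0) :
  x1 != 0 -> x2 != 0 -> x3 != 0 -> x4 != 0 -> F != 0 -> L != 0 ->
  t * x1 = E * x0 + F * G * H * K * L ^+ 2 ->
  x2 * x0 = A * x1 ^+ 3 + B * K * L * x1 ^+ 2 + C * H * K ^+ 2 * L ^+ 2 * x1
            + D * G * H ^+ 2 * K ^+ 3 * L ^+ 3 ->
  x3 * x1 = F * x2 + E * D * H * L * K ^+ 2 ->
  x4 * x2 = G * x3 ^+ 3 + C * E * K * x3 ^+ 2 + B * D * E ^+ 2 * K ^+ 2 * x3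
            + A * H * D ^+ 2 * E ^+ 3 * K ^+ 3 ->
  x5 * x3 = L * x4 + F * A * D * K * E ^+ 2 ->
  x6 * x4 = H * x5 ^+ 3 + B * F * E * x5 ^+ 2 + C * A * F ^+ 2 * E ^+ 2 * x5
            + G * D * A ^+ 2 * F ^+ 3 * E ^+ 3 ->
  x5 * t = K * x6 + L * G * A * E * F ^+ 2.
Proof.
move=> x10 x20 x30 x40 F0 L0 h0 h1 h2 h3 h4 h5.
set e0 := F * G * H * K * L ^+ 2 in h0.
set f2 := E * D * H * L * K ^+ 2 in h2.
set l4 := F * A * D * K * E ^+ 2 in h4.
set k6 := L * G * A * E * F ^+ 2.
pose D1 := x3 * x1 - f2.
have D1F : D1 = F * x2 by rewrite /D1 h2 addrK.
have D10 : D1 != 0 by rewrite D1F mulf_neq0.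
pose M := E * F * (A * x1 ^+ 2 + B * K * L * x1 + C * H * K ^+ 2 * L ^+ 2) + e0 * x3.
pose N := F * L * (G * x3 ^+ 2 + C * E * K * x3 + B * D * E ^+ 2 * K ^+ 2) + l4 * x1.
have e1 : t * D1 = M.
  apply: (mulfI x10); apply/eqP; rewrite -subr_eq0.
  have -> : x1 * (t * D1) - x1 * M = (t * x1 - (E * x0 + e0)) * D1
    + E * x0 * (x3 * x1 - (F * x2 + f2))
    + E * F * (x2 * x0 - (A * x1 ^+ 3 + B * K * L * x1 ^+ 2 + C * H * K ^+ 2 * L ^+ 2 * x1
            + D * G * H ^+ 2 * K ^+ 3 * L ^+ 3)).
    by rewrite /M /D1 /e0 /f2; ring.
  by rewrite h0 h1 h2 !subrr !mulr0 mul0r !addr0.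
have e2 : x5 * D1 = N.
  apply: (mulfI x30); apply/eqP; rewrite -subr_eq0.
  have -> : x3 * (x5 * D1) - x3 * N = (x5 * x3 - (L * x4 + l4)) * D1
    + L * x4 * (x3 * x1 - (F * x2 + f2))
    + F * L * (x4 * x2 - (G * x3 ^+ 3 + C * E * K * x3 ^+ 2 + B * D * E ^+ 2 * K ^+ 2 * x3
            + A * H * D ^+ 2 * E ^+ 3 * K ^+ 3)).
    by rewrite /N /D1 /l4 /f2; ring.
  by rewrite h2 h3 h4 !subrr !mulr0 mul0r !addr0.
have e3 : t * (x5 * x3 - l4) =
    L * K * (H * x5 ^+ 2 + B * F * E * x5 + C * A * F ^+ 2 * E ^+ 2) + k6 * x3.
  apply: (mulfI (mulf_neq0 D10 D10)).
  have -> : D1 * D1 * (t * (x5 * x3 - l4)) = (t * D1) * ((x5 * D1) * x3 - l4 * D1) by ring.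
  have -> : D1 * D1 * (L * K * (H * x5 ^+ 2 + B * F * E * x5 + C * A * F ^+ 2 * E ^+ 2) + k6 * x3) =
    L * K * (H * (x5 * D1) ^+ 2 + B * F * E * (x5 * D1) * D1 + C * A * F ^+ 2 * E ^+ 2 * D1 ^+ 2)
    + k6 * x3 * D1 ^+ 2 by ring.
  by rewrite e1 e2 /M /N /D1 /e0 /f2 /l4 /k6; ring.
(* Multiplied by L x4 = x5 x3 - l4, the claim follows from x5 times [e3] and the last two exchange
   relations. *)
apply: (mulfI (mulf_neq0 L0 x40)); apply/eqP; rewrite -subr_eq0.
have -> : L * x4 * (x5 * t) - L * x4 * (K * x6 + k6) =
  x5 * (t * (x5 * x3 - l4)
        - (L * K * (H * x5 ^+ 2 + B * F * E * x5 + C * A * F ^+ 2 * E ^+ 2) + k6 * x3))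
  - (x5 * t - k6) * (x5 * x3 - (L * x4 + l4))
  - L * K * (x6 * x4 - (H * x5 ^+ 3 + B * F * E * x5 ^+ 2 + C * A * F ^+ 2 * E ^+ 2 * x5
            + G * D * A ^+ 2 * F ^+ 3 * E ^+ 3)).
  by rewrite /l4 /k6; ring.
by rewrite e3 h4 h5 !subrr !mulr0 !subr0.
Qed.

Section OctagonSystem.

Variables (S : idomainType) (hS : ufd S) (K : fieldType) (cst : {rmorphism S -> K}).
Variables (T : eqType) (A : exchange_system cst T).
Local Notation seed := (seed A).
Local Notation data := (data A).

Lemma octagon_seeds X x y p q : seed X -> data X x y p q ->
  size p = 4%N -> size q = 2%N ->
  exists (i : oct_par S) (z : nat -> K) (Y : nat -> T),
  [/\ oct_good i, z 8%N = z 0%N,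
    forall j, (j < 8)%N -> data (Y j) (z j) (z j.+1) (oct i j.+1) (oct i j) &
    forall W, seed W <-> W \in [seq Y j | j <- iota 0 8]].
Proof.
move=> sX D0 sp sq.
have [[[[[[[[[[b0 b] c] d] e] f] g] h] k] l] [gi ep eq_]] :=
  oct_decomposition hS sp sq (data_poly D0) (data_poly (data_sym D0)).
set i := (b0, b, c, d, e, f, g, h, k, l) in gi ep eq_.
pose P := oct i; pose xx := orbit cst P x y.
have cinj := data_cst_inj D0.
have DX : data X (xx 0%N) (xx 1%N) (P 1%N) (P 0%N).
  have -> : P 1%N = p by rewrite ep; exact: oct_P_sigma.
  have -> : P 0%N = q by rewrite eq_.
  exact: D0.
have E8 : P 8%N = P 0%N by [].
have E9 : P 9%N = P 1%N by [].
have hxx : forall j, xx j.+2 = ev cst (xx j.+1) (P j.+1) / xx j by exact: orbitSS.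
clearbody xx.
have hsz j : (1 < size (P j))%N by exact: oct_size.
have hpr j : primitive (P j) by exact: oct_prim.
have hst j : exchange_step (P j.+1) (P j) (P j.+2) by exact: oct_step.
have x0 j : xx j != 0 := walk_neq0 hS hsz hpr hst hxx j sX DX.
have [x8 x9] : xx 8%N = xx 0%N /\ xx 9%N = xx 1%N.
  have [[_ _ e0 f0] [_ _ k0 l0] _] := gi.
  have cn a : a != 0 -> cst a != 0 by exact: cst_neq0 (data_indep D0) _.
  have hm j : xx j.+2 * xx j = ev cst (xx j.+1) (P j.+1) by rewrite hxx divfK.
  move: (hm 0%N) (hm 1%N) (hm 2%N) (hm 3%N) (hm 4%N) (hm 5%N) (hm 6%N) (hm 7%N).
  rewrite /P /oct /family /i /= !ev_linear !ev_cubic !(rmorphM, rmorphXn) /=.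
  move=> h2 h3 h4 h5 h6 h7 h8 h9.
  pose q0 := cst f * cst g * cst h * cst k * cst l ^+ 2.
  have h71 : xx 7%N * xx 1%N = cst e * xx 0%N + q0.
    have e7 : xx 7%N = (cst e * xx 0%N + q0) / xx 1%N.
      apply: (mulfI (x0 5%N)); rewrite [LHS]mulrC h7.
      rewrite (@oct_closing _ (cst b0) (cst b) (cst c) (cst d) (cst e) (cst f) (cst g)
        (cst h) (cst k) (cst l) _
        (xx 0%N) (xx 1%N) (xx 2%N) (xx 3%N) (xx 4%N) (xx 5%N) (xx 6%N)) ?divfK ?cn //;
        [ring|rewrite h2|rewrite h3|rewrite h4|rewrite h5|rewrite h6]; ring.
    by rewrite e7 divfK.
  (* The closing identity shifted by two, with x1 as the predecessor of x2: x7 x1 has the same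
     expression in x8 as in x0. *)
  have h71' : xx 7%N * xx 1%N = cst e * xx 8%N + q0.
    rewrite (@oct_closing _ (cst g) (cst c) (cst b) (cst b0) (cst f) (cst l) (cst h)
        (cst d) (cst e) (cst k) _
        (xx 2%N) (xx 3%N) (xx 4%N) (xx 5%N) (xx 6%N) (xx 7%N) (xx 8%N)) ?cn //;
        [rewrite /q0; ring|rewrite mulrC h3|rewrite h4|rewrite h5|rewrite h6|rewrite h7|rewrite h8];
        ring.
  have e8 : xx 8%N = xx 0%N.
    by apply: (mulfI (cn _ e0)); apply: (addIr q0); rewrite -h71' h71.
  split=> //; apply: (mulIf (x0 7%N)); rewrite h9 e8 [RHS]mulrC h71 /q0; ring.
have [Y [v [a [[v0 v1 v8 v9] vu ha [a0 a1 a8 a9] [hY hW]]]]] :=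
  closed_walk hS hsz hpr hst hxx sX DX (isT : (0 < 8)%N) E8 E9 x8 x9.
have v2 : v 2%N = 1 by rewrite -a1 (ha 0%N) // v0 mulr1.
have v7 : v 7%N = 1 by rewrite -a8 (ha 7%N) // v9 mul1r.
have a2 : a 2%N = v 3%N by rewrite (ha 1%N) // v1 mulr1.
have a3 : a 3%N = v 4%N by rewrite (ha 2%N) // v2 mulr1.
have a4 : a 4%N = v 5%N * v 3%N by rewrite (ha 3%N).
have a5 : a 5%N = v 6%N * v 4%N by rewrite (ha 4%N).
have a6 : a 6%N = v 5%N by rewrite (ha 5%N) // v7 mul1r.
have a7 : a 7%N = v 6%N by rewrite (ha 6%N) // v8 mul1r.
have u3 := vu 3%N isT; have u4 := vu 4%N isT; have u5 := vu 5%N isT; have u6 := vu 6%N isT.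
set n3 := v 3%N in u3 a2 a4; set n4 := v 4%N in u4 a3 a5.
set n5 := v 5%N in u5 a4 a6; set n6 := v 6%N in u6 a5 a7.
(* The free units are v_3, ..., v_6; the exponents solve the system obtained by comparing the
   coefficients of all eight twisted polynomials. *)
pose i' : oct_par S := (b0 * 1, b * (n4 * n6 * n3^-1 * n5^-1 ^+ 2), c * (n4 * n6 * n3^-1 ^+ 2 * n5^-1),
  d * n6, e * 1, f * n3, g * (n4 * n3^-1 ^+ 3), h * (n4 * n6 * n5^-1 ^+ 3),
  k * (n5 * n6^-1), l * (n3 * n5 * n4^-1)).
have gauge j : (j <= 8)%N -> twist (a j) (v j) (P j) = oct i' j.
  have c3 : cst n3 != 0 by exact: cst_unit_neq0.
  have c4 : cst n4 != 0 by exact: cst_unit_neq0.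
  have c5 : cst n5 != 0 by exact: cst_unit_neq0.
  have c6 : cst n6 != 0 by exact: cst_unit_neq0.
  rewrite /P /oct /family /i; case: j => [|[|[|[|[|[|[|[|[|j]]]]]]]]] // _ /=;
    rewrite ?twist_linear ?twist_cubic ?v0 ?v1 ?v2 ?v7 ?v8 ?a0 ?a1 ?a2 ?a3 ?a4 ?a5 ?a6 ?a7 ?a8
      -/n3 -/n4 -/n5 -/n6;
    (first [congr (Poly [:: _; _; _; _]) | congr (Poly [:: _; _])]); apply: cinj;
    rewrite !(rmorphM, rmorphXn) ?rmorphV ?unitr1 //= ?rmorph1 ?invr1 ?expr1n ?mulr1 ?mul1r;
    by field; rewrite ?c3 ?c4 ?c5 ?c6.
exists i', (fun j => cst (v j) * xx j), Y; split => //.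
- apply: (oct_rescale (i := i)) gi; split;
    by rewrite ?unitrM ?unitrX ?unitrV ?unitr1 ?u3 ?u4 ?u5 ?u6.
- by rewrite v8 v0 x8.
- move=> j hj; have := hY j (ltnW hj); rewrite !gauge //; exact: ltnW.
Qed.

End OctagonSystem.

(** * The classification *)

Section Gcd.

Variables (S : idomainType) (hS : ufd S).
Implicit Types a b c d : S.

Lemma coprime2_gcd a b : a != 0 -> coprime2 a b -> is_gcd [:: a; b] 1.
Proof.
move=> a0 h; apply: (@coprime_is_gcd1 _ hS _ a) => //; first exact: mem_head.
by move=> p ip hp; apply: (h p ip); apply: hp; rewrite !inE eqxx ?orbT.
Qed.

(** The parameter B, and in the octagon also C, may vanish; in each triple that occurs the first or
    the third entry is known to be nonzero. *)
Lemma coprime3_gcd a b c : (a != 0) || (c != 0) -> coprime3 a b c -> is_gcd [:: a; b; c] 1.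
Proof.
move=> ac0 h; have hc : coprime_seq [:: a; b; c].
  by move=> p ip hp; apply: (h p ip); apply: hp; rewrite !inE eqxx ?orbT.
case/orP: ac0 => e0; apply: (coprime_is_gcd1 hS _ e0 hc); rewrite !inE eqxx ?orbT //.
Qed.

Lemma coprime4_gcd a b c d : (a != 0) || (c != 0) -> coprime4 a b c d ->
  is_gcd [:: a; b; c; d] 1.
Proof.
move=> ac0 h; have hc : coprime_seq [:: a; b; c; d].
  by move=> p ip hp; apply: (h p ip); apply: hp; rewrite !inE eqxx ?orbT.
case/orP: ac0 => e0; apply: (coprime_is_gcd1 hS _ e0 hc); rewrite !inE eqxx ?orbT //.
Qed.

End Gcd.

(** * Translation into the explicit lists of seeds *)

Section Concrete.

Variables (S : idomainType) (hS : ufd S) (A : LP_algebra S 2).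
Hypotheses (hnorm : normalized A) (hfin : finite_type A).
Local Notation F := (ambient S 2).
Local Notation cst := (cst S 2).
Local Notation ev := (ev cst).
Local Notation sys := (LP_exchange_system hnorm hfin).
Implicit Types (X : {fset F * F}) (x y z : F) (p q : {poly S}).

Lemma ev_linear_eq y (a b a' b' : S) : a = a' -> b = b' ->
  ev y (Poly [:: b; a]) = cst a' * y + cst b'.
Proof. by move=> -> ->; exact: ev_linear. Qed.

Lemma ev_quadratic_eq y (a b c a' b' c' : S) : a = a' -> b = b' -> c = c' ->
  ev y (Poly [:: c; b; a]) = cst a' * y ^+ 2 + cst b' * y + cst c'.
Proof. by move=> -> -> ->; exact: ev_quadratic. Qed.

Lemma ev_cubic_eq y (a b c d a' b' c' d' : S) : a = a' -> b = b' -> c = c' -> d = d' ->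
  ev y (Poly [:: d; c; b; a]) = cst a' * y ^+ 3 + cst b' * y ^+ 2 + cst c' * y + cst d'.
Proof. by move=> -> -> -> ->; exact: ev_cubic. Qed.

Lemma seed_data_fset X x y p q u v : seed_data X x y p q -> ev y p = u -> ev x q = v ->
  X = [fset (x, u); (y, v)]%fset.
Proof. by move=> d <- <-; exact: seed_data_set. Qed.

Lemma seed_data_fset_sym X x y p q u v : seed_data X x y p q -> ev y p = u -> ev x q = v ->
  X = [fset (y, v); (x, u)]%fset.
Proof. by move=> /seed_data_sym d <- <-; exact: seed_data_set. Qed.

Lemma triangle_of_seed X x y (a c : S) : seeds A X -> seed_data X x y a%:P c%:P ->
  irreducible_elt a -> irreducible_elt c -> divides c a -> triangle A.
Proof.
move=> sX d ia ic ca.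
have [z [Y [Z [ez dX dY dZ hl]]]] := @triangle_seeds S hS F cst _ sys X x y a c sX d ia ic ca.
exists x, y, z, a; split; first exact: ez.
rewrite -(seed_data_fset dX (evC _ _ _) (evC _ _ _)).
rewrite -(seed_data_fset dY (evC _ _ _) (evC _ _ _)).
rewrite -(seed_data_fset dZ (evC _ _ _) (evC _ _ _)).
exact: hl.
Qed.

Lemma square_of_seed X x y p (c : S) : seeds A X -> seed_data X x y p c%:P ->
  irreducible_elt c -> nonmultiple p c -> square A.
Proof.
move=> sX d ic nm.
have [z [u [R [k [n [X2 [X3 [X4 [sz [d1 d2 d3 d4] [nk e [h1 h2] [h3 h4 h5 h6] [h7 h8]] hl]]]]]]]]] :=
  @square_seeds S hS F cst _ sys X x y p c sX d ic nm.
have ek : u ^ (k%:Z - n%:Z) = u ^+ (k - n) by rewrite subzn.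
exists x, y, z, u, c, p, R, k, n%:Z; split; first exact: sz.
  move=> [v uv ev_]; apply: nm; exists v%:P.
  have e1 : ev y p = ev y (v * c)%:P by rewrite evC rmorphM; exact: ev_.
  by rewrite (ev_injr (seed_data_indep d) e1) polyCM mulrC mul_polyC.
rewrite ek.
have E1 := seed_data_fset d1 (erefl _) (evC _ _ _); have E2 := seed_data_fset d2 (erefl _) (evC _ _ _).
have E3 := seed_data_fset d3 (erefl _) (evC _ _ _); have E4 := seed_data_fset d4 (erefl _) (evC _ _ _).
clear d d1 d2 d3 d4 sX; subst X X2 X3 X4.
split; [exact: hl|split; [exact: h1|exact: h2]|split; [exact: h3|exact: h4|exact: h5|exact: h6]
  |split; [exact: h7|exact: h8]|exact: e].
Qed.

Lemma pentagon_of_seed X x y p q : seeds A X -> seed_data X x y p q ->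
  size p = 2%N -> size q = 2%N -> pentagon A.
Proof.
move=> sX d sp sq.
have [[[[[a b] c] d'] e] [z [Y [gi z5 hd hl]]]] :=
  @pentagon_seeds S hS F cst _ sys X x y p q sX d sp sq.
have [[a0 b0 c0 d0 e0] [h1 h2 h3 h4 h5]] := gi.
exists (z 0%N), (z 1%N), (z 2%N), (z 3%N), (z 4%N), a, b, c, d', e; split; last first.
  by split; exact: coprime2_gcd.
have D0 := hd 0%N isT; have D1 := hd 1%N isT; have D2 := hd 2%N isT.
have D3 := hd 3%N isT; have D4 := hd 4%N isT; rewrite z5 in D4.
have E0 : Y 0%N = [fset (z 0%N, (cst a * z 1%N + cst (b * e))%R); (z 1%N, (cst c * z 0%N + cst (d' * e))%R)]%fset.
  by apply: (seed_data_fset D0); apply: ev_linear_eq; ring.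
have E1 : Y 1%N = [fset (z 2%N, (cst a * z 1%N + cst (e * b))%R); (z 1%N, (cst d' * z 2%N + cst (c * b))%R)]%fset.
  by apply: (seed_data_fset_sym D1); apply: ev_linear_eq; ring.
have E2 : Y 2%N = [fset (z 2%N, (cst e * z 3%N + cst (a * c))%R); (z 3%N, (cst d' * z 2%N + cst (b * c))%R)]%fset.
  by apply: (seed_data_fset D2); apply: ev_linear_eq; ring.
have E3 : Y 3%N = [fset (z 4%N, (cst e * z 3%N + cst (c * a))%R); (z 3%N, (cst b * z 4%N + cst (d' * a))%R)]%fset.
  by apply: (seed_data_fset_sym D3); apply: ev_linear_eq; ring.
have E4 : Y 4%N = [fset (z 4%N, (cst c * z 0%N + cst (e * d'))%R); (z 0%N, (cst b * z 4%N + cst (a * d'))%R)]%fset.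
  by apply: (seed_data_fset D4); apply: ev_linear_eq; ring.
rewrite /= E0 E1 E2 E3 E4 in hl.
exact: hl.
Qed.

Lemma hexagon_of_seed X x y p q : seeds A X -> seed_data X x y p q ->
  size p = 3%N -> size q = 2%N -> hexagon A.
Proof.
move=> sX d0 sp sq.
have [[[[[[[a b] c] d] e] f] g] [z [Y [gi z6 hd hl]]]] :=
  @hexagon_seeds S hS F cst _ sys X x y p q sX d0 sp sq.
have [[[a0 c0 d0' e0] f0 g0] [[h1 h2] [h3 h4 h5] h6 [h7 h8 h9]]] := gi.
exists (z 0%N), (z 1%N), (z 2%N), (z 3%N), (z 4%N), (z 5%N), a, b, c, d, e, f, g; split; last first.
  split; [split|split| |split]; try exact: coprime2_gcd.
  + by apply: coprime3_gcd => //; rewrite a0.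
  + by apply: coprime3_gcd => //; rewrite a0.
  + by apply: coprime3_gcd => //; rewrite f0 orbT.
have E0 : Y 0%N =
  [fset (z 0%N, (cst a * z 1%N ^+ 2 + cst (b * g) * z 1%N + cst (c * f * g ^+ 2))%R);
        (z 1%N, (cst d * z 0%N + cst (e * f * g))%R)]%fset.
  by apply: (seed_data_fset (hd 0%N isT)); [apply: ev_quadratic_eq|apply: ev_linear_eq]; ring.
have E1 : Y 1%N =
  [fset (z 2%N, (cst a * z 1%N ^+ 2 + cst (b * g) * z 1%N + cst (f * c * g ^+ 2))%R);
        (z 1%N, (cst e * z 2%N + cst (d * c * g))%R)]%fset.
  by apply: (seed_data_fset_sym (hd 1%N isT)); [apply: ev_linear_eq|apply: ev_quadratic_eq]; ring.
have E2 : Y 2%N =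
  [fset (z 2%N, (cst f * z 3%N ^+ 2 + cst (b * d) * z 3%N + cst (a * c * d ^+ 2))%R);
        (z 3%N, (cst e * z 2%N + cst (g * c * d))%R)]%fset.
  by apply: (seed_data_fset (hd 2%N isT)); [apply: ev_quadratic_eq|apply: ev_linear_eq]; ring.
have E3 : Y 3%N =
  [fset (z 4%N, (cst f * z 3%N ^+ 2 + cst (b * d) * z 3%N + cst (c * a * d ^+ 2))%R);
        (z 3%N, (cst g * z 4%N + cst (e * a * d))%R)]%fset.
  by apply: (seed_data_fset_sym (hd 3%N isT)); [apply: ev_linear_eq|apply: ev_quadratic_eq]; ring.
have E4 : Y 4%N =
  [fset (z 4%N, (cst c * z 5%N ^+ 2 + cst (b * e) * z 5%N + cst (f * a * e ^+ 2))%R);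
        (z 5%N, (cst g * z 4%N + cst (d * a * e))%R)]%fset.
  by apply: (seed_data_fset (hd 4%N isT)); [apply: ev_quadratic_eq|apply: ev_linear_eq]; ring.
have E5 : Y 5%N =
  [fset (z 0%N, (cst c * z 5%N ^+ 2 + cst (b * e) * z 5%N + cst (a * f * e ^+ 2))%R);
        (z 5%N, (cst d * z 0%N + cst (g * f * e))%R)]%fset.
  have D := hd 5%N isT; rewrite z6 in D.
  by apply: (seed_data_fset_sym D); [apply: ev_linear_eq|apply: ev_quadratic_eq]; ring.
rewrite /= E0 E1 E2 E3 E4 E5 in hl.
exact: hl.
Qed.

Lemma octagon_of_seed X x y p q : seeds A X -> seed_data X x y p q ->
  size p = 4%N -> size q = 2%N -> octagon A.
Proof.
move=> sX d0 sp sq.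
have [[[[[[[[[[a b] c] d] e] f] g] h] k] l] [z [Y [gi z8 hd hl]]]] :=
  @octagon_seeds S hS F cst _ sys X x y p q sX d0 sp sq.
have [[a0 d0' e0 f0] [g0 h0 k0 l0] [[? ? ? ?] [? ? ? ? ?] [? ? ? ? ?] [? ?] [? ? ? ?]]] := gi.
exists (z 0%N), (z 1%N), (z 2%N), (z 3%N), (z 4%N), (z 5%N), (z 6%N), (z 7%N),
  a, b, c, d, e, f, g, h, k, l; split; last first.
  split; [split|split|split|split|split]; try exact: coprime2_gcd.
  + by apply: coprime3_gcd => //; rewrite a0.
  + by apply: coprime3_gcd => //; rewrite g0 orbT.
  + by apply: coprime4_gcd => //; rewrite a0.
  + by apply: coprime4_gcd => //; rewrite a0.
  + by apply: coprime4_gcd => //; rewrite d0' orbT.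
  + by apply: coprime4_gcd => //; rewrite g0 orbT.
have E0 : Y 0%N =
  [fset (z 0%N, (cst a * z 1%N ^+ 3 + cst (b * k * l) * z 1%N ^+ 2 + cst (c * h * k ^+ 2 * l ^+ 2) * z 1%N + cst (d * g * h ^+ 2 * k ^+ 3 * l ^+ 3))%R);
        (z 1%N, (cst e * z 0%N + cst (f * g * h * k * l ^+ 2))%R)]%fset.
  by apply: (seed_data_fset (hd 0%N isT)); [apply: ev_cubic_eq|apply: ev_linear_eq]; ring.
have E1 : Y 1%N =
  [fset (z 2%N, (cst a * z 1%N ^+ 3 + cst (b * l * k) * z 1%N ^+ 2 + cst (c * h * l ^+ 2 * k ^+ 2) * z 1%N + cst (g * d * h ^+ 2 * l ^+ 3 * k ^+ 3))%R);
        (z 1%N, (cst f * z 2%N + cst (e * d * h * l * k ^+ 2))%R)]%fset.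
  by apply: (seed_data_fset_sym (hd 1%N isT)); [apply: ev_linear_eq|apply: ev_cubic_eq]; ring.
have E2 : Y 2%N =
  [fset (z 2%N, (cst g * z 3%N ^+ 3 + cst (c * e * k) * z 3%N ^+ 2 + cst (b * d * e ^+ 2 * k ^+ 2) * z 3%N + cst (a * h * d ^+ 2 * e ^+ 3 * k ^+ 3))%R);
        (z 3%N, (cst f * z 2%N + cst (l * h * d * e * k ^+ 2))%R)]%fset.
  by apply: (seed_data_fset (hd 2%N isT)); [apply: ev_cubic_eq|apply: ev_linear_eq]; ring.
have E3 : Y 3%N =
  [fset (z 4%N, (cst g * z 3%N ^+ 3 + cst (c * k * e) * z 3%N ^+ 2 + cst (b * d * k ^+ 2 * e ^+ 2) * z 3%N + cst (h * a * d ^+ 2 * k ^+ 3 * e ^+ 3))%R);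
        (z 3%N, (cst l * z 4%N + cst (f * a * d * k * e ^+ 2))%R)]%fset.
  by apply: (seed_data_fset_sym (hd 3%N isT)); [apply: ev_linear_eq|apply: ev_cubic_eq]; ring.
have E4 : Y 4%N =
  [fset (z 4%N, (cst h * z 5%N ^+ 3 + cst (b * f * e) * z 5%N ^+ 2 + cst (c * a * f ^+ 2 * e ^+ 2) * z 5%N + cst (g * d * a ^+ 2 * f ^+ 3 * e ^+ 3))%R);
        (z 5%N, (cst l * z 4%N + cst (k * d * a * f * e ^+ 2))%R)]%fset.
  by apply: (seed_data_fset (hd 4%N isT)); [apply: ev_cubic_eq|apply: ev_linear_eq]; ring.
have E5 : Y 5%N =
  [fset (z 6%N, (cst h * z 5%N ^+ 3 + cst (b * e * f) * z 5%N ^+ 2 + cst (c * a * e ^+ 2 * f ^+ 2) * z 5%N + cst (d * g * a ^+ 2 * e ^+ 3 * f ^+ 3))%R);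
        (z 5%N, (cst k * z 6%N + cst (l * g * a * e * f ^+ 2))%R)]%fset.
  by apply: (seed_data_fset_sym (hd 5%N isT)); [apply: ev_linear_eq|apply: ev_cubic_eq]; ring.
have E6 : Y 6%N =
  [fset (z 6%N, (cst d * z 7%N ^+ 3 + cst (c * l * f) * z 7%N ^+ 2 + cst (b * g * l ^+ 2 * f ^+ 2) * z 7%N + cst (h * a * g ^+ 2 * l ^+ 3 * f ^+ 3))%R);
        (z 7%N, (cst k * z 6%N + cst (e * a * g * l * f ^+ 2))%R)]%fset.
  by apply: (seed_data_fset (hd 6%N isT)); [apply: ev_cubic_eq|apply: ev_linear_eq]; ring.
have E7 : Y 7%N =
  [fset (z 0%N, (cst d * z 7%N ^+ 3 + cst (c * f * l) * z 7%N ^+ 2 + cst (b * g * f ^+ 2 * l ^+ 2) * z 7%N + cst (a * h * g ^+ 2 * f ^+ 3 * l ^+ 3))%R);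
        (z 7%N, (cst e * z 0%N + cst (k * h * g * f * l ^+ 2))%R)]%fset.
  have D := hd 7%N isT; rewrite z8 in D.
  by apply: (seed_data_fset_sym D); [apply: ev_linear_eq|apply: ev_cubic_eq]; ring.
rewrite /= E0 E1 E2 E3 E4 E5 E6 E7 in hl.
exact: hl.
Qed.

(** Two associate constants give the triangle; in every other case p is not a multiple of c and the
    square arises. *)
Lemma constant_case X x y p (c : S) : seeds A X -> seed_data X x y p c%:P -> triangle A \/ square A.
Proof.
move=> sX d; have gp := seed_data_poly d.
have [_ _ ic'] := seed_data_poly (seed_data_sym d).
have ic : irreducible_elt c by have := ic' (size_polyC_leq1 c); rewrite coefC eqxx.
have [sp|sp] := ltnP 1 (size p).
  by right; apply: (square_of_seed sX d ic); apply: nonmultiple_exchange => //; rewrite leqNgt sp.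
have [cp|cp] := classic (divides c p`_0).
  have [_ _ /(_ sp) ip] := gp; rewrite (size1_polyC sp) in d.
  by left; exact: (triangle_of_seed sX d ip ic cp).
by right; apply: (square_of_seed sX d ic); apply: nonmultiple_exchange.
Qed.

End Concrete.

Theorem theorem6p6 (S : idomainType) (hS : ufd S) (A : LP_algebra S 2)
    (hnorm : normalized A) (hfin : finite_type A) :
  triangle A \/ square A \/ pentagon A \/ hexagon A \/ octagon A.
Proof.
have [X sX] := seeds_inhabited A.
have [x [y [p [q d]]]] := is_seed_data (seeds_seed sX).
have [sq|sq] := leqP (size q) 1.
  rewrite (size1_polyC sq) in d.
  by case: (constant_case hS hnorm hfin sX d); tauto.
have [sp|sp] := leqP (size p) 1.
  rewrite (size1_polyC sp) in d.
  by case: (constant_case hS hnorm hfin sX (seed_data_sym d)); tauto.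
have := @exchange_degrees_bound S hS _ _ _ (LP_exchange_system hnorm hfin) X x y p q sX d sp sq.
have [sz|[sz|[sz|[sz|[sz|sz]]]]] : (size p = 2 /\ size q = 2 \/ size p = 3 /\ size q = 2 \/
    size p = 2 /\ size q = 3 \/ size p = 4 /\ size q = 2 \/ size p = 2 /\ size q = 4 \/
    3 < (size p).-1 * (size q).-1)%N.
- case: (size p) sp => [|[|[|[|[|m]]]]] // _; case: (size q) sq => [|[|[|[|[|n]]]]] // _ /=; try tauto; lia.
- by move=> _; have := pentagon_of_seed hS hnorm hfin sX d sz.1 sz.2; tauto.
- by move=> _; have := hexagon_of_seed hS hnorm hfin sX d sz.1 sz.2; tauto.
- by move=> _; have := hexagon_of_seed hS hnorm hfin sX (seed_data_sym d) sz.2 sz.1; tauto.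
- by move=> _; have := octagon_of_seed hS hnorm hfin sX d sz.1 sz.2; tauto.
- by move=> _; have := octagon_of_seed hS hnorm hfin sX (seed_data_sym d) sz.2 sz.1; tauto.
- by rewrite leqNgt sz.
Qed.
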